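(* Let $f\in L^1_a(\mathbb{R}^d_+)$ be continuous and of locally bounded variation, and let $x\in\mathbb{R}^d_+$. Put $\Phi_x(t):=M_{sph,a}(f)(x,t)$ and let $\widehat{\Phi_x}(\tau)=\int_0^\infty \Phi_x(t)j_\gamma(t\tau)t^{2\gamma+1}dt$ be its one-dimensional Hankel transform of order $\gamma$. If $$\left\|\,\partial_\tau \widehat{\Phi_x}(\tau)\,\tau^{\gamma+1}e^{-\frac{\tau^2}{2}}\right\|_{L^\infty(0,\infty)}<\infty,$$ then $$\left|\left(\Phi_x *_\gamma e^{-\frac{(\cdot)^2}{4}}\right)(t)-\sigma_n\big(SCE_{B,w}(f)\big)(t)\right|=O\big(n^{-\frac{7}{32}}\big)\qquad (n\to\infty),$$ where $SCE_{B,w}(f)(t)=\sum_{k=0}^\infty c_k(x)\varphi_k(t)$ is the spherical Bessel-chromatic expansion of $f$ at $x$ with weight $w(\tau)=e^{-\tau^2}$, and $\sigma_n$ denotes its Cesàro means.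
   Context: $\mathbb{R}^d_+=\{x\in\mathbb{R}^d: x_i>0,\ i=1,\dots,d\}$; $a=(a_1,\dots,a_d)$ with $a_i=2\alpha_i+1>0$ (so $\alpha_i>-\frac12$), $|a|=\sum_i a_i$, $x^a=\prod_i x_i^{a_i}$, and $\gamma:=\frac{d+|a|}{2}-1$. $L^p_a(\mathbb{R}^d_+)$ is the $L^p$ space with respect to the measure $x^a\,dx$. Entire Bessel function: $j_\alpha(z)=\sum_{k\ge0}\frac{(-1)^k\Gamma(\alpha+1)}{\Gamma(k+1)\Gamma(k+\alpha+1)}\left(\frac z2\right)^{2k}$. Bessel translation: $T_a^y=T_{a_d}^{y_d}\cdots T_{a_1}^{y_1}$, where $T_{a_i}^{y_i}$ acts on the $i$-th variable by $$T_{a_i}^{y_i}f(x)=\frac{\Gamma(\alpha_i+1)}{\sqrt\pi\,\Gamma(\alpha_i+\frac12)}\int_0^\pi f\big(x_1,\dots,\sqrt{x_i^2+y_i^2-2x_iy_i\cos\vartheta},\dots,x_d\big)\sin^{2\alpha_i}\vartheta\,d\vartheta .$$ In one dimension with order $\gamma$ (i.e. $\alpha=\gamma$) it is denoted $T_\gamma^t$. Weighted spherical mean: $M_{sph,a}(f)(x,t)=\frac{1}{|S^d_{1+}|_a}\int_{S^d_{1+}}T_a^{t\vartheta}f(x)\,\vartheta^a\,dS(\vartheta)$, where $S^d_{1+}$ is the part of the unit sphere of $\mathbb{R}^d$ in $\mathbb{R}^d_+$, $dS$ is surface measure and $|S^d_{1+}|_a=\int_{S^d_{1+}}\vartheta^a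 dS(\vartheta)$. One-dimensional Bessel convolution of order $\gamma$: $(F*_\gamma G)(t)=\int_0^\infty T_\gamma^tF(s)\,G(s)\,s^{2\gamma+1}ds$. Let $\{p_k\}_{k\ge0}$ be the orthonormal polynomials on $(0,\infty)$ with respect to the weight $e^{-\tau^2}\tau^{2\gamma+1}$. Then $$c_k(x)=\int_0^\infty p_k(\tau)\widehat{\Phi_x}(\tau)e^{-\tau^2}\tau^{2\gamma+1}d\tau,\qquad \varphi_k(t)=\frac{2}{\Gamma(\gamma+1)}\int_0^\infty p_k(\tau)e^{-\tau^2}j_\gamma(t\tau)\tau^{2\gamma+1}d\tau .$$ Cesàro means of a series $S=\sum_{k\ge 0}s_k$: $\sigma_n(S)=\frac1n\sum_{k=0}^{n-1}S_k$, where $S_k=\sum_{j=0}^k s_j$. *)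

(* Defs.v *)
From HB Require Import structures.
From mathcomp Require Import all_boot all_order all_algebra.
From mathcomp Require Import all_classical all_reals all_analysis.

Set Implicit Arguments.
Unset Strict Implicit.
Unset Printing Implicit Defensive.

Import Order.TTheory GRing.Theory Num.Theory.
Import numFieldNormedType.Exports.

Local Open Scope classical_set_scope.
Local Open Scope ring_scope.

(* Lebesgue measure on R^n, carried by n-tuples: the product of [lebesgue_measure]
   on the first coordinate with Lebesgue measure on the remaining ones. *)
Section lebesgue_tuple.
Context {R : realType}.

Section step.
Variables (n : nat)
  (m : {sigma_finite_measure set (n.-tuple (measurableTypeR R)) -> \bar R}).

Definition tcons (p : measurableTypeR R * n.-tuple (measurableTypeR R)) :
  n.+1.-tuple (measurableTypeR R) := [tuple of p.1 :: p.2].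

Let measurable_tcons : measurable_fun setT tcons.
Proof. exact: measurable_cons. Qed.

Definition lebesgue_tuple_step :=
  pushforward ((@lebesgue_measure R) \x m)%E tcons.

Let pm : {measure set (n.+1.-tuple (measurableTypeR R)) -> \bar R} :=
  measure_function_pushforward__canonical__measure_function_Measure
    ((@lebesgue_measure R) \x m)%E measurable_tcons.

HB.instance Definition _ := isMeasure.Build _ _ _ lebesgue_tuple_step
  (measure0 pm) (measure_ge0 pm) (@measure_semi_sigma_additive _ _ _ pm).

Let lebesgue_tuple_step_sigma_finite : sigma_finite setT lebesgue_tuple_step.
Proof.
have /sigma_finiteP[F [FT ndF Foo]] := sigma_finiteT (@lebesgue_measure R).
have /sigma_finiteP[H [HT ndH Hoo]] := sigma_finiteT m.
pose G (p : n.+1.-tuple (measurableTypeR R)) :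
    measurableTypeR R * n.-tuple (measurableTypeR R) :=
  (thead p, [tuple of behead p]).
have tconsK p : G (tcons p) = p.
  by case: p => x t; rewrite /G /tcons /= theadE; congr pair; exact: val_inj.
have mG : measurable_fun setT G.
  by apply: measurable_fun_pair; [exact: measurable_tnth|exact: measurable_behead].
exists (fun k => G @^-1` (F k `*` H k)).
  rewrite -preimage_bigcup; apply/esym; rewrite -subTset => p _ /=.
  have [i _ Fi] : (\bigcup_k F k) (G p).1 by rewrite -FT.
  have [j _ Hj] : (\bigcup_k H k) (G p).2 by rewrite -HT.
  exists (maxn i j) => //; split.
    by move: Fi; exact/subsetPset/ndF/leq_maxl.
  by move: Hj; exact/subsetPset/ndH/leq_maxr.
move=> k; have [mF Fk] := Foo k; have [mH Hk] := Hoo k; split.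
  by rewrite -[X in measurable X]setTI; apply: mG => //; exact: measurableX.
rewrite /lebesgue_tuple_step /pushforward -comp_preimage.
rewrite (_ : G \o tcons = id) ?preimage_id; last by apply/funext.
by rewrite product_measure1E// lte_mul_pinfty// ge0_fin_numE.
Qed.

HB.instance Definition _ :=
  Measure_isSigmaFinite.Build _ _ _ lebesgue_tuple_step
    lebesgue_tuple_step_sigma_finite.

End step.

Fixpoint lebesgue_tuple (n : nat) :
    {sigma_finite_measure set (n.-tuple (measurableTypeR R)) -> \bar R} :=
  match n with
  | 0 => \d_([tuple] : 0.-tuple (measurableTypeR R))
  | n'.+1 => lebesgue_tuple_step (lebesgue_tuple n')
  end.

End lebesgue_tuple.

Section bessel.
Context {R : realType}.
Implicit Types (n : nat) (F G : R -> R).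

Local Notation mu := (@lebesgue_measure R).

(* Points and the topology of R^n live on row vectors, measures on tuples. *)
Definition vec n (u : n.-tuple (measurableTypeR R)) : 'rV[R]_n :=
  \row_i tnth u i.

Definition orthant n : set 'rV[R]_n := [set x | forall i, 0 < x 0 i].

Definition mxpow n (x a : 'rV[R]_n) : R := \prod_i (x 0 i `^ a 0 i).

Definition Gamma (s : R) : R :=
  \int[mu]_(t in `]0, +oo[) (t `^ (s - 1) * expR (- t)).

Definition bessel_j (alpha z : R) : R :=
  limn (series (fun k : nat =>
    (-1) ^+ k * Gamma (alpha + 1) / (Gamma (k%:R + 1) * Gamma (k%:R + alpha + 1))
    * (z / 2) ^+ (2 * k))).

(* [Rintegral] returns 0 where an integral diverges.  For f in L^1_a, continuous
   on the orthant, the iterated integrals below diverge at most on null sets of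
   y and of t: f may blow up at the boundary of the orthant. *)
Definition translation1 (alpha t : R) F (s : R) : R :=
  Gamma (alpha + 1) / (Num.sqrt pi * Gamma (alpha + 1 / 2)) *
  \int[mu]_(theta in `[0, pi])
    (F (Num.sqrt (s ^+ 2 + t ^+ 2 - 2 * s * t * cos theta))
     * sin theta `^ (2 * alpha)).

Definition set_coord n (x : 'rV[R]_n) (i : 'I_n) (r : R) : 'rV[R]_n :=
  \row_j (if j == i then r else x 0 j).

Definition coord_translation n (alpha : R) (i : 'I_n) (y : R)
    (f : 'rV[R]_n -> R) : 'rV[R]_n -> R :=
  fun x => translation1 alpha y (fun r => f (set_coord x i r)) (x 0 i).

(* [foldl] over [enum 'I_n] lets the translation in the first variable act
   first; the index of the i-th one is alpha_i, where a_i = 2 alpha_i + 1. *)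
Definition bessel_translation n (a y : 'rV[R]_n) (f : 'rV[R]_n -> R) :
    'rV[R]_n -> R :=
  foldl (fun g i => coord_translation ((a 0 i - 1) / 2) i (y 0 i) g) f
    (enum 'I_n).

(* The part of the unit sphere of R^(n+1) in the open orthant is the graph of
   h(u) = sqrt (1 - |u|^2) over the u in R^n with positive coordinates and
   |u| < 1.  Since d_i h = - u_i / h, the area element of this graph is
   sqrt (1 + |grad h|^2) du = du / h(u).  For n = 0 the chart is a point and
   the surface measure is the unit mass at 1. *)
Definition sphere_chart n : set (n.-tuple (measurableTypeR R)) :=
  [set u | orthant (vec u) /\ \sum_i tnth u i ^+ 2 < 1].

Definition sphere_height n (u : n.-tuple (measurableTypeR R)) : R :=
  Num.sqrt (1 - \sum_i tnth u i ^+ 2).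

Definition sphere_point n (u : n.-tuple (measurableTypeR R)) : 'rV[R]_n.+1 :=
  vec [tuple of sphere_height u :: u].

Definition sphere_integral n (F : 'rV[R]_n.+1 -> R) : R :=
  \int[lebesgue_tuple n]_(u in @sphere_chart n)
    (F (sphere_point u) / sphere_height u).

Definition spherical_mean n (a : 'rV[R]_n.+1) (f : 'rV[R]_n.+1 -> R)
    (x : 'rV[R]_n.+1) (t : R) : R :=
  (sphere_integral (fun theta => mxpow theta a))^-1 *
  sphere_integral (fun theta =>
    bessel_translation a (t *: theta) f x * mxpow theta a).

Definition L1_weighted n (a : 'rV[R]_n) (f : 'rV[R]_n -> R) : Prop :=
  (lebesgue_tuple n).-integrable [set u | orthant (vec u)]
    (fun u => (f (vec u) * mxpow (vec u) a)%:E).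

Definition continuously_differentiable n (phi : 'rV[R]_n.+1 -> R) : Prop :=
  (forall x, differentiable phi x) /\
  (forall j, continuous (fun x => 'D_(delta_mx 0 j) phi x)).

Definition divergence n (phi : 'I_n.+1 -> 'rV[R]_n.+1 -> R)
    (x : 'rV[R]_n.+1) : R :=
  \sum_i 'D_(delta_mx 0 i) (phi i) x.

(* De Giorgi's definition of BV_loc on the open orthant: on each compact subset
   K, the variation, tested against the C^1 vector fields supported in K of
   Euclidean norm at most 1, is finite. *)
Definition locally_BV n (f : 'rV[R]_n.+1 -> R) : Prop :=
  forall K : set 'rV[R]_n.+1, compact K -> K `<=` @orthant n.+1 ->
  exists M : R, forall phi : 'I_n.+1 -> 'rV[R]_n.+1 -> R,
    (forall i, continuously_differentiable (phi i)) ->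
    (forall i x, ~ K x -> phi i x = 0) ->
    (forall x, \sum_i phi i x ^+ 2 <= 1) ->
    \int[lebesgue_tuple n.+1]_(u in [set u | orthant (vec u)])
      (f (vec u) * divergence phi (vec u)) <= M.

Definition mean_order n (a : 'rV[R]_n) : R := (n%:R + \sum_i a 0 i) / 2 - 1.

Definition hankel (gam : R) F (tau : R) : R :=
  \int[mu]_(t in `]0, +oo[) (F t * bessel_j gam (t * tau) * t `^ (2 * gam + 1)).

Definition bessel_convolution (gam : R) F G (t : R) : R :=
  \int[mu]_(s in `]0, +oo[)
    (translation1 gam t F s * G s * s `^ (2 * gam + 1)).

Definition Linf_norm F : \bar R :=
  'N[mu]_+oo%E [EFin \o (F \_ `]0, +oo[)].

(* The sign of p_k is left free; it cancels in the products c_k phi_k. *)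
Definition orthonormal_polynomials (gam : R) (p : nat -> {poly R}) : Prop :=
  (forall k, size (p k) = k.+1) /\
  (forall k l, \int[mu]_(tau in `]0, +oo[)
      ((p k).[tau] * (p l).[tau] * (expR (- tau ^+ 2) * tau `^ (2 * gam + 1)))
    = (k == l)%:R).

Definition chromatic_coef (gam : R) (p : nat -> {poly R}) F (k : nat) : R :=
  \int[mu]_(tau in `]0, +oo[)
    ((p k).[tau] * hankel gam F tau * expR (- tau ^+ 2) * tau `^ (2 * gam + 1)).

Definition chromatic_fun (gam : R) (p : nat -> {poly R}) (k : nat) (t : R) : R :=
  2 / Gamma (gam + 1) *
  \int[mu]_(tau in `]0, +oo[)
    ((p k).[tau] * expR (- tau ^+ 2) * bessel_j gam (t * tau)
     * tau `^ (2 * gam + 1)).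

(* The terms of the expansion; F stands for the spherical mean of f at x. *)
Definition SCE (gam : R) (p : nat -> {poly R}) F (t : R) (k : nat) : R :=
  chromatic_coef gam p F k * chromatic_fun gam p k t.

Definition cesaro_mean (s : R^nat) (N : nat) : R :=
  N%:R^-1 * \sum_(0 <= k < N) \sum_(0 <= j < k.+1) s j.

End bessel.

(* Main.v *)
Require Import Defs.
From HB Require Import structures.
From mathcomp Require Import all_boot all_order all_algebra.
From mathcomp Require Import all_classical all_reals all_analysis.
From mathcomp Require Import measurable_realfun.
From mathcomp Require Import ring lra zify.

(** Write [j] for [bessel_j gam], [w(tau) = expR (- tau^2) * tau^(2 gam + 1)], and
[<u, v>] for the integral of [u v w] over the half-line.  The idea is to read both
sides on the Hankel side, where the statement becomes one about orthogonal
polynomials.  The convolution with the Gaussian is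
[c * <hatPhi, j (t .)>] with [c = 2 / Gamma (gam + 1)] (lemma [convolution_gauss]),
and the [k]-th partial sum of the expansion is
[c * \sum_(i <= k) <p_i, hatPhi> <p_i, j (t .)>].  Their difference is the defect of
the [k]-th partial sum in Parseval's identity.  The partial sums reproduce every
polynomial of degree at most [k] (lemma [projection_poly]), so that [j (t .)] may be
replaced by its distance to a polynomial.  Now [j] is entire: a Taylor polynomial
of degree at most [k] misses [j (t tau)] by at most
[4^-(k+1) * expR (4 t tau)], which is square integrable for [w] (lemma
[bessel_j_poly_approx]).  Hence the defects are O(k 4^-k) and summable (lemma
[parseval_defect]), and the Cesaro means err by O(1/N), which is O(N^(-7/32)).

The formula for the convolution rests on three facts.
- The substitution of the third side [r] of a triangle with sides [s], [t] for the
  angle between them turns the Bessel translation into an integral operator whose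
  kernel is, up to a factor in [t] alone, a power of the area times [r s]; so it is
  symmetric in [r] and [s] (lemmas [translation_symmetric] and
  [translation_symmetric_signed]).
- [T^t (j (tau .)) (s) = j (tau s) * j (tau t)] (lemma [product_formula]).  Both
  sides are power series in [tau]; the means of the even powers of [r] are computed
  from the moments of the weight [sin^(2 gam)], and the coefficients agree by an
  identity of Chu-Vandermonde type.
- The Gaussian is the Hankel transform of a Gaussian (lemma [gauss_transform]).

It also needs the integrability of [Phi t^(2 gam + 1)] (lemma
[spherical_mean_integrable]).  In polar coordinates this integral is at most a
constant times the integral over the orthant of [T^y |f| (x) * y^a] in [y], and
each one-dimensional translation preserves the mass: the symmetry above moves it
from [|f|] to the constant function 1.  Since [|j| <= 1] by Poisson's integral,
[hatPhi] is then bounded. *)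

Set Implicit Arguments.
Unset Strict Implicit.
Unset Printing Implicit Defensive.

Import Order.TTheory GRing.Theory Num.Theory.
Import numFieldNormedType.Exports.
Import HBNNSimple.

Local Open Scope classical_set_scope.
Local Open Scope ring_scope.

(** * Changes of variables for nonnegative integrands *)

Section density.
Local Open Scope ereal_scope.
Context d (T : measurableType d) (R : realType).
Variables (mu : {measure set T -> \bar R}) (g : T -> R).
Hypothesis mg : measurable_fun setT g.
Hypothesis g0 : forall x, (0 <= g x)%R.

(** The measure with density [g] is built because changes of variables are proved
    below as equalities of measures, decided on half-open intervals. *)
Definition density (A : set T) : \bar R := \int[mu]_(x in A) (g x)%:E.

Let density0 : density set0 = 0. Proof. exact: integral_set0. Qed.

Let density_ge0 A : 0 <= density A.
Proof. by apply: integral_ge0 => x _; rewrite lee_fin. Qed.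

Let density_sigma_additive : semi_sigma_additive density.
Proof.
move=> F mF tF mUF; rewrite /density ge0_integral_bigcup//=.
- by apply: is_cvg_ereal_nneg_natsum_cond => n _ _; exact: density_ge0.
- by apply/measurable_EFinP/measurable_funTS.
- by move=> x _; rewrite lee_fin.
Qed.

HB.instance Definition _ := isMeasure.Build _ _ _ density
  density0 density_ge0 density_sigma_additive.

Definition density_measure : {measure set T -> \bar R} := density.

Lemma ge0_integral_density (f : T -> \bar R) :
  measurable_fun setT f -> (forall x, 0 <= f x) ->
  \int[density_measure]_x f x = \int[mu]_x (f x * (g x)%:E).
Proof.
move=> mf f0.
pose h := nnsfun_approx measurableT mf.
have fE x : f x = limn (fun n => (h n x)%:E).
  by apply/esym/cvg_lim => //; exact: cvg_nnsfun_approx.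
have -> : \int[density_measure]_x f x = limn (fun n => \int[density_measure]_x (h n x)%:E).
  under eq_integral do rewrite fE.
  apply: monotone_convergence => //.
  - by move=> n; apply/measurable_EFinP.
  - by move=> n x _ //=; rewrite lee_fin.
  - by move=> x _ a b ab; rewrite lee_fin; exact/lefP/nd_nnsfun_approx.
have -> : \int[mu]_x (f x * (g x)%:E) =
    limn (fun n => \int[mu]_x ((h n x)%:E * (g x)%:E)).
  rewrite -monotone_convergence//.
  - apply: eq_integral => x _; apply/esym/cvg_lim => //.
    by apply: cvgeZr => //; exact: cvg_nnsfun_approx.
  - by move=> n; apply: emeasurable_funM; exact/measurable_EFinP.
  - by move=> n x _; rewrite mule_ge0 ?lee_fin.
  - move=> x _ a b ab/=; rewrite lee_wpmul2r ?lee_fin//.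
    exact/lefP/nd_nnsfun_approx.
congr (limn _); apply/funext => n.
have indich r : measurable_fun setT (fun x => (r * \1_(h n @^-1` [set r]) x)%:E).
  by apply: (measurable_comp measurableT) => //; exact: measurable_funM.
transitivity (\int[density_measure]_x
   (\sum_(y \in range (h n)) (y * \1_(h n @^-1` [set y]) x)%:E)).
  by apply: eq_integral => t tE; rewrite /= fimfunE -fsumEFin.
rewrite ge0_integral_fsum//; last by move=> m y Ey; exact: nnfun_muleindic_ge0.
transitivity (\int[mu]_x (\sum_(y \in range (h n))
    (y * \1_(h n @^-1` [set y]) x)%:E * (g x)%:E)); last first.
  apply: eq_integral => x xE.
  rewrite -ge0_mule_fsuml => [|y]; last exact: nnfun_muleindic_ge0.
  by rewrite fsumEFin // -(fimfunE _ x).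
rewrite ge0_integral_fsum//; last 2 first.
  - by move=> y; apply: emeasurable_funM => //; exact/measurable_EFinP.
  - by move=> m y Ey; rewrite mule_ge0 ?lee_fin ?g0 //; exact: nnfun_muleindic_ge0.
apply: eq_fsbigr => r /[!inE] rhn.
have r0 : (0 <= r)%R by case: rhn => x _ <-; exact: fun_ge0.
have mA : measurable (h n @^-1` [set r]) by [].
under eq_integral do rewrite EFinM.
under [RHS]eq_integral do rewrite EFinM -muleA.
rewrite ge0_integralZl//; last exact/measurable_EFinP/measurable_indic.
rewrite ge0_integralZl//; last 2 first.
  - apply: emeasurable_funM; last exact/measurable_EFinP.
    exact/measurable_EFinP/measurable_indic.
  - by move=> x _; rewrite mule_ge0// lee_fin.
congr (_ * _); rewrite integral_indic// setIT.
rewrite [LHS]integral_mkcond; apply: eq_integral => x _.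
by rewrite patchE indicE; case: ifPn => _; rewrite ?mul1e ?mul0e.
Qed.

End density.

Section subst.
Context {R : realType}.
Local Notation mu := (@lebesgue_measure R).
Variables (F dF : R -> R).

(** Substitution is proved by comparing two measures: Lebesgue measure on the image
    segment, and the push-forward by [F] of the measure of density [dF].  They agree
    on half-open intervals by the fundamental theorem of calculus, so they agree;
    hence [f] may be any nonnegative measurable function. *)
Lemma ge0_subst_segment (a b : R) (f : R -> \bar R) : a < b ->
  (forall x, x \in `[a, b] -> is_derive x 1%R F (dF x)) ->
  {within `[a, b], continuous dF} ->
  (forall x, x \in `[a, b] -> 0 < dF x) ->
  measurable_fun setT f -> (forall x, 0 <= f x)%E ->
  (\int[mu]_(y in `[F a, F b]) f y = \int[mu]_(x in `[a, b]) (f (F x) * (dF x)%:E))%E.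
Proof.
move=> ab Fd cdF dF0 mf f0.
have cF : {within `[a, b], continuous F}.
  apply: derivable_within_continuous => x xab.
  by have := Fd _ xab => -[].
have sincF (x y : R) : x \in `[a, b] -> y \in `[a, b] -> x < y -> F x < F y.
  move=> xab yab xy.
  have sub c : x <= c <= y -> c \in `[a, b].
    move: xab yab; rewrite !in_itv/= => /andP[? ?] /andP[? ?] /andP[? ?].
    by apply/andP; split; lra.
  have Fd' c : c \in `]x, y[ -> is_derive c 1 F (dF c).
    rewrite in_itv/= => /andP[? ?]; apply/Fd/sub.
    by apply/andP; split; apply: ltW.
  have cF' : {within `[x, y], continuous F}.
    by apply: continuous_subspaceW cF => c /=; rewrite in_itv/=; exact: sub.
  have [c cxy /eqP] := MVT xy Fd' cF'.
  rewrite subr_eq addrC => /eqP ->; rewrite ltrDl mulr_gt0//.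
    by apply/dF0/sub; move: cxy; rewrite in_itv/= => /andP[? ?]; rewrite !ltW.
  by rewrite subr_gt0.
have incF : {in `[a, b] &, {mono F : x y / x <= y}}.
  by apply: le_mono_in => x y xab yab; exact: sincF.
have aab : a \in `[a, b] by rewrite in_itv/= lexx ltW.
have bab : b \in `[a, b] by rewrite in_itv/= lexx ltW.
have Fab : F a < F b by rewrite ltNge incF// -ltNge.
have mD : measurable `]a, b]%classic by exact: measurable_itv.
have mFD : measurable `]F a, F b]%classic by exact: measurable_itv.
have mab : measurable `[a, b]%classic by exact: measurable_itv.
pose F' : measurableTypeR R -> measurableTypeR R := F \_ `[a, b].
have mF' : measurable_fun setT F'.
  apply/(measurable_restrictT F) => //.
  exact: subspace_continuous_measurable_fun.
pose g : R -> R := dF \_ `]a, b].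
have mg : measurable_fun setT g.
  apply/(measurable_restrictT dF) => //.
  apply: (measurable_funS mab); first exact: subset_itv_oc_cc.
  exact: subspace_continuous_measurable_fun.
have g0 x : (0 <= g x)%R.
  rewrite /g patchE; case: ifPn => // /[!inE] xab.
  by apply/ltW/dF0; exact: subset_itv_oc_cc.
pose nu := density_measure mu mg g0.
pose m2 : {measure set (measurableTypeR R) -> \bar R} :=
  measure_function_pushforward__canonical__measure_function_Measure nu mF'.
have i0 x : 0 <= (\1_(`]F a, F b]%classic : set R) x : R) by rewrite indicE ler0n.
pose m1 : {measure set (measurableTypeR R) -> \bar R} :=
  density_measure mu (measurable_indic mFD) i0.
(* clamping [u] to the image segment lets every half-open interval be pulled back *)
pose cl u := Num.max (F a) (Num.min u (F b)).
have clP u : exists2 c, c \in `[a, b] & F c = cl u.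
  apply: IVT => //; first exact: ltW.
  rewrite (min_l (ltW Fab)) (max_r (ltW Fab)) /cl le_max lexx/= ge_max ltW//=.
  by rewrite ge_min lexx orbT.
have clE u y : y \in `]F a, F b] -> (u < y) = (cl u < y) /\ (y <= u) = (y <= cl u).
  rewrite in_itv/= => /andP[ay yb]; rewrite /cl; split.
    by rewrite gt_max ay/= gt_min (ltNge (F b)) yb orbF.
  by rewrite le_max (leNgt y) ay/= le_min yb andbT.
have m12 A : measurable A -> m1 A = m2 A.
  apply: (@measure_unique _ R (measurableTypeR R) (@ocitv R) (fun k => `](- k%:R)%R, k%:R]%classic)) => //.
  - exact: ocitvI.
  - by move=> k; exact: is_ocitv.
  - by rewrite bigcup_itvT.
  - move=> _ [[u v] _ <-]/=.
    have [c cab Fc] := clP u; have [e eab Fe] := clP v.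
    have sce x : x \in `]c, e] -> x \in `]a, b].
      move: cab eab; rewrite !in_itv/= => /andP[? ?] /andP[? ?] /andP[? ?].
      by apply/andP; split; lra.
    have -> : m1 `]u, v]%classic = mu `]F c, F e]%classic.
      rewrite /m1/= /density integral_indic//; congr (mu _); apply/seteqP; split => y /=.
        move=> [yab uyv]; have [_ Ev] := clE v y yab; have [Eu _] := clE u y yab.
        by move: uyv; rewrite !in_itv/= Eu Ev Fc Fe.
      move=> yce; have yab : y \in `]F a, F b].
        move: yce; rewrite !in_itv/= => /andP[? ?]; apply/andP; split.
          by apply: le_lt_trans; last eassumption; rewrite incF//; case/andP: cab.
        by apply: le_trans; first eassumption; rewrite incF//; case/andP: eab.
      have [_ Ev] := clE v y yab; have [Eu _] := clE u y yab.
      by split=> //; move: yce; rewrite !in_itv/= Eu Ev Fc Fe.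
    have -> : m2 `]u, v]%classic = (\int[mu]_(x in `]c, e]) (dF x)%:E)%E.
      rewrite /m2/= /pushforward/= /density integral_mkcond [RHS]integral_mkcond.
      apply: eq_integral => x _; rewrite !patchE.
      have [xab|xab] := boolP (x \in `]a, b]).
        have xab' : x \in `[a, b] by exact: subset_itv_oc_cc xab.
        have F'x : F' x = F x by rewrite /F' patchE mem_set.
        have yab : F x \in `]F a, F b].
          move: (xab); rewrite !in_itv/= => /andP[ax xb].
          by rewrite sincF//= incF.
        have [_ Ev] := clE v _ yab; have [Eu _] := clE u _ yab.
        have -> : (x \in F' @^-1` `]u, v]) = (x \in `]c, e]).
          rewrite [LHS](_ : _ = (F' x \in `]u, v])); last first.
            by apply/idP/idP => [/set_mem|h]//; exact/mem_set.
          rewrite F'x !in_itv/= Eu Ev -Fc -Fe; apply/andP/andP => -[h1 h2].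
            by rewrite -incF// h2 ltNge -incF// -ltNge.
          have := sce x; rewrite !in_itv/= h1 h2 => /(_ erefl)/andP[? ?].
          by rewrite sincF// incF.
        by rewrite mem_setE /g patchE mem_set.
      rewrite [X in if _ then X else _](_ : _ = 0%E); last first.
        by rewrite /g patchE memNset//; exact/negP.
      rewrite if_same ifF//; apply/negbTE; apply: contra xab.
      by rewrite mem_setE; exact: sce.
    have [ce|ec] := ltP c e; last first.
      rewrite set_itv_ge ?measure0 ?set_itv_ge ?integral_set0//= bnd_simp -leNgt//.
      by rewrite incF.
    have sce' x : x \in `[c, e] -> x \in `[a, b].
      move: cab eab; rewrite !in_itv/= => /andP[? ?] /andP[? ?] /andP[? ?].
      by apply/andP; split; lra.
    have cdFce : {within `[c, e], continuous dF}.
      by apply: continuous_subspaceW cdF => x /=; exact: sce'.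
    have cFt x : x \in `[a, b] -> F @ x --> F x.
      move=> xab; apply/differentiable_continuous/derivable1_diffP.
      by have := Fd _ xab => -[].
    rewrite lebesgue_measure_itv/= lte_fin sincF// integral_itv_obnd_cbnd; last first.
      apply/measurable_EFinP.
      apply: (@measurable_funS _ _ _ _ `[c, e]) => //; first exact: subset_itv_oc_cc.
      exact: subspace_continuous_measurable_fun.
    rewrite (@continuous_FTC2 _ dF F)//.
    - split.
      + move=> x /subset_itv_oo_cc /sce' xab.
        by have := Fd _ xab => -[].
      + by apply: cvg_at_right_filter; exact: cFt.
      + by apply: cvg_at_left_filter; exact: cFt.
    - move=> x /subset_itv_oo_cc /sce' xab.
      by rewrite derive1E; have := Fd _ xab => -[].
  - move=> k; apply: (@le_lt_trans _ _ (mu `]F a, F b])%E).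
      rewrite /m1/= /density integral_indic//.
      by apply: le_measure; rewrite ?inE//; exact: measurableI.
    by rewrite lebesgue_measure_itv/= lte_fin Fab -EFinB ltry.
rewrite -integral_itv_obnd_cbnd; last exact: measurable_funTS.
have -> : (\int[mu]_(y in `]F a, F b]) f y = \int[m1]_y f y)%E.
  rewrite /m1 [RHS]ge0_integral_density// [LHS]integral_mkcond.
  apply: eq_integral => x _.
  by rewrite patchE indicE; case: ifPn => _; rewrite ?mule1 ?mule0.
have -> : (\int[m1]_y f y = \int[m2]_y f y)%E.
  by apply: eq_measure_integral => A mA _; exact: m12.
rewrite ge0_integral_pushforward//= preimage_setT.
rewrite ge0_integral_density//; last exact: measurableT_comp.
rewrite -integral_itv_obnd_cbnd; last first.
  have s : `]a, b] `<=` `[a, b] by exact: subset_itv_oc_cc.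
  have mFc : measurable_fun `]a, b] (F : R -> R).
    by apply: (measurable_funS mab s); exact: subspace_continuous_measurable_fun.
  have mdFc : measurable_fun `]a, b] (dF : R -> R).
    by apply: (measurable_funS mab s); exact: subspace_continuous_measurable_fun.
  apply: emeasurable_funM; last exact/measurable_EFinP.
  exact: (measurableT_comp mf mFc).
rewrite [RHS]integral_mkcond; apply: eq_integral => x _.
rewrite [RHS]patchE; case: ifPn => xab.
  have -> : g x = dF x by rewrite /g patchE xab.
  have -> // : F' x = F x.
  by rewrite /F' patchE mem_set//; exact/subset_itv_oc_cc/set_mem.
have -> : g x = 0 by rewrite /g patchE (negbTE xab).
by rewrite mule0.
Qed.

End subst.

Section subst_open.
Context {R : realType}.
Local Notation mu := (@lebesgue_measure R).

(** Exhausting an open interval by segments carries the substitution to functions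
    whose derivative degenerates at the ends. *)
Lemma ge0_subst (F dF G : R -> R) (i j : interval R) (a_ b_ : nat -> R) (f : R -> \bar R) :
  (forall n, a_ n.+1 <= a_ n) -> (forall n, b_ n <= b_ n.+1) ->
  (forall n, a_ n < b_ n) ->
  [set` i] = \bigcup_n `[a_ n, b_ n]%classic ->
  (forall x, x \in i -> F x \in j) ->
  (forall y, y \in j -> G y \in i /\ F (G y) = y) ->
  (forall x, x \in i -> is_derive x 1 F (dF x)) ->
  (forall x, x \in i -> {for x, continuous dF}) ->
  (forall x, x \in i -> 0 < dF x) ->
  measurable_fun setT f -> (forall x, 0 <= f x)%E ->
  (\int[mu]_(y in [set` j]) f y = \int[mu]_(x in [set` i]) (f (F x) * (dF x)%:E))%E.
Proof.
move=> a_d b_i ab iE Fij Gji Fd cdF dF0 mf f0.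
have sub n x : x \in `[a_ n, b_ n] -> x \in i.
  by move=> xn; have : [set` i] x by rewrite iE; exists n.
have ni m n : (m <= n)%N -> a_ n <= a_ m /\ b_ m <= b_ n.
  elim: n => [|n IH]; first by rewrite leqn0 => /eqP ->.
  rewrite leq_eqVlt => /predU1P[-> //|]; rewrite ltnS => /IH[h1 h2].
  by split; [exact: le_trans h1|exact: (le_trans h2)].
have sinc n (x y : R) : x \in `[a_ n, b_ n] -> y \in `[a_ n, b_ n] -> x <= y -> F x <= F y.
  move=> xab yab; rewrite le_eqVlt => /predU1P[-> //|xy].
  have sb c : c \in `[x, y] -> c \in i.
    move=> h; apply: (sub n); move: h xab yab; rewrite !in_itv/= => /andP[? ?] /andP[? ?] /andP[? ?].
    by apply/andP; split; lra.
  have Fd' c : c \in `]x, y[ -> is_derive c 1 F (dF c).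
    by move=> /subset_itv_oo_cc h; exact/Fd/sb.
  have cF' : {within `[x, y], continuous F}.
    by apply: derivable_within_continuous => c /sb ci; have := Fd _ ci => -[].
  have [c /subset_itv_oo_cc/sb/dF0 cxy /eqP] := MVT xy Fd' cF'.
  by rewrite subr_eq => /eqP ->; rewrite lerDr mulr_ge0 ?ltW// subr_gt0.
have aab n : a_ n \in `[a_ n, b_ n] by rewrite in_itv/= lexx ltW.
have bab n : b_ n \in `[a_ n, b_ n] by rewrite in_itv/= lexx ltW.
have cF n : {within `[a_ n, b_ n], continuous F}.
  by apply: derivable_within_continuous => c /sub ci; have := Fd _ ci => -[].
have jE : [set` j] = \bigcup_n `[F (a_ n), F (b_ n)]%classic.
  apply/seteqP; split => y /=.
    move=> /Gji[]; set x := G y => xi <-.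
    have : [set` i] x by []. rewrite iE => -[n _ /= xn]; exists n => //=.
    by rewrite in_itv/= !(sinc n)//; move: xn; rewrite in_itv/= => /andP[].
  move=> [n _ /= yn].
  have [|c cn <-] := IVT (ltW (ab n)) (cF n) (v := y).
    have Fab : F (a_ n) <= F (b_ n) by apply: (sinc n) => //; exact: ltW.
    by rewrite min_l// max_r.
  exact/Fij/(sub n).
have mF : measurable_fun [set` i] F.
  apply: subspace_continuous_measurable_fun => //.
  by apply: derivable_within_continuous => c ci; have := Fd _ ci => -[].
have mdF : measurable_fun [set` i] dF.
  apply: subspace_continuous_measurable_fun => //.
  apply: continuous_in_subspaceT => x /[!inE]; exact: cdF.
have mfF : measurable_fun [set` i] (fun x => f (F x) * (dF x)%:E)%E.
  apply: emeasurable_funM; last exact/measurable_EFinP.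
  exact: (measurableT_comp mf mF).
have c1 := @ge0_nondecreasing_set_cvg_integral _ (measurableTypeR R) R (fun n => `[F (a_ n), F (b_ n)]%classic) f mu.
have c2 := @ge0_nondecreasing_set_cvg_integral _ (measurableTypeR R) R (fun n => `[a_ n, b_ n]%classic) (fun x => f (F x) * (dF x)%:E)%E mu.
rewrite jE iE.
have H1 : nondecreasing_seq (fun n => `[F (a_ n), F (b_ n)]%classic).
  move=> m n mn; apply/subsetPset => y /=; rewrite !in_itv/=.
  have [h1 h2] := ni _ _ mn.
  have amn : a_ m \in `[a_ n, b_ n].
    by rewrite in_itv/= h1 (le_trans (ltW (ab m))).
  have bmn : b_ m \in `[a_ n, b_ n].
    by rewrite in_itv/= h2 (le_trans h1)// ltW.
  move=> /andP[y1 y2]; apply/andP; split.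
    by apply: le_trans y1; apply: (sinc n).
  by apply: (le_trans y2); apply: (sinc n).
have /cvg_lim <-// := c1 H1 (fun=> measurable_itv _)
  (fun=> measurable_funTS mf) (fun _ x _ => f0 x).
have H2 : nondecreasing_seq (fun n => `[a_ n, b_ n]%classic).
  move=> m n mn; apply/subsetPset => y /=; rewrite !in_itv/=.
  have [h1 h2] := ni _ _ mn.
  by move=> /andP[y1 y2]; rewrite (le_trans h1)// (le_trans y2).
have H3 n : measurable_fun (`[a_ n, b_ n]%classic : set (measurableTypeR R))
    (fun x => f (F x) * (dF x)%:E)%E.
  by apply: measurable_funS mfF => // x; exact: sub.
have H4 n (x : measurableTypeR R) : `[a_ n, b_ n]%classic x ->
    (0 <= f (F x) * (dF x)%:E)%E.
  by move=> /sub xi; rewrite mule_ge0// lee_fin ltW// dF0.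
have /cvg_lim <-// := c2 H2 (fun=> measurable_itv _) H3 H4.
congr (limn _); apply/funext => n.
have cdFn : {within `[a_ n, b_ n], continuous dF}.
  by apply: continuous_in_subspaceT => x /[!inE] /= /sub; exact: cdF.
exact: (ge0_subst_segment (ab n) (fun x xn => Fd x (sub n x xn)) cdFn
  (fun x xn => dF0 x (sub n x xn)) mf f0).
Qed.

End subst_open.

Section subst_cor.
Context {R : realType}.
Local Notation mu := (@lebesgue_measure R).
Variables (F dF G : R -> R) (f : R -> \bar R).

Lemma ge0_subst_oo (a b c d : R) : a < b ->
  (forall x, a < x < b -> c < F x < d) ->
  (forall y, c < y < d -> a < G y < b /\ F (G y) = y) ->
  (forall x, a < x < b -> is_derive x 1 F (dF x)) ->
  (forall x, a < x < b -> {for x, continuous dF}) ->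
  (forall x, a < x < b -> 0 < dF x) ->
  measurable_fun setT f -> (forall x, 0 <= f x)%E ->
  (\int[mu]_(y in `]c, d[) f y = \int[mu]_(x in `]a, b[) (f (F x) * (dF x)%:E))%E.
Proof.
move=> ab Fij Gji Fd cdF dF0 mf f0.
(* [n.+3] makes the two margins together shorter than [b - a] *)
pose e (n : nat) := (b - a) / n.+3%:R.
have e0 n : 0 < e n by rewrite divr_gt0// subr_gt0.
have ed n : e n.+1 <= e n.
  by rewrite ler_pM2l ?subr_gt0// lef_pV2 ?posrE// ler_nat.
have e2 n : e n + e n < b - a.
  rewrite /e -mulrDr -[ltRHS]mulr1 ltr_pM2l ?subr_gt0//.
  rewrite -mulr2n -(mulr_natr _ 2) mulrC ltr_pdivrMr// mul1r ltr_nat//.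
have ad n : a + e n.+1 <= a + e n by rewrite lerD2l.
have bi n : b - e n <= b - e n.+1 by rewrite lerD2l lerN2.
have aben n : a + e n < b - e n by have := e2 n; lra.
suff E : [set` `]a, b[] = \bigcup_n `[a + e n, b - e n]%classic.
  have I (x y z : R) : (x \in `]y, z[) = (y < x < z) by rewrite in_itv.
  have Fij' x : x \in `]a, b[ -> F x \in `]c, d[ by rewrite !I; exact: Fij.
  have Gji' y : (y \in `]c, d[) -> (G y \in `]a, b[) /\ F (G y) = y.
    by rewrite !I; exact: Gji.
  have Fd' x : x \in `]a, b[ -> is_derive x 1 F (dF x) by rewrite I; exact: Fd.
  have cdF' x : x \in `]a, b[ -> {for x, continuous dF} by rewrite I; exact: cdF.
  have dF0' x : x \in `]a, b[ -> 0 < dF x by rewrite I; exact: dF0.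
  exact: (ge0_subst ad bi aben E Fij' Gji' Fd' cdF' dF0' mf f0).
apply/seteqP; split => x /=; rewrite in_itv/=.
  move=> /andP[ax xb].
  pose r := Num.min (x - a) (b - x) / (b - a).
  have r0 : 0 < r by rewrite divr_gt0 ?subr_gt0// lt_min !subr_gt0 ax.
  have [k] := ltr_add_invr r0; rewrite add0r => kr.
  exists k => //=; rewrite in_itv/=.
  have : e k <= Num.min (x - a) (b - x).
    rewrite /e mulrC -ler_pdivlMr ?subr_gt0//; apply/(le_trans _ (ltW kr)).
    by rewrite lef_pV2 ?posrE// ler_nat; exact/leqW/leqW.
  by rewrite le_min => /andP[? ?]; apply/andP; split; lra.
move=> [n _ /=]; rewrite in_itv/= => /andP[? ?]; have := e0 n => ?.
by apply/andP; split; lra.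
Qed.

Lemma ge0_subst_oy (a c : R) :
  (forall x, a < x -> c < F x) ->
  (forall y, c < y -> a < G y /\ F (G y) = y) ->
  (forall x, a < x -> is_derive x 1 F (dF x)) ->
  (forall x, a < x -> {for x, continuous dF}) ->
  (forall x, a < x -> 0 < dF x) ->
  measurable_fun setT f -> (forall x, 0 <= f x)%E ->
  (\int[mu]_(y in `]c, +oo[) f y = \int[mu]_(x in `]a, +oo[) (f (F x) * (dF x)%:E))%E.
Proof.
move=> Fij Gji Fd cdF dF0 mf f0.
have E (x y : R) : (y \in `]x, +oo[) = (x < y) by rewrite in_itv/= andbT.
pose e (n : nat) : R := n.+2%:R^-1.
have e0 n : 0 < e n by rewrite invr_gt0.
have e1 n : e n < 1 by rewrite invf_lt1// ltr1n.
have ad n : a + e n.+1 <= a + e n by rewrite lerD2l lef_pV2 ?posrE// ler_nat.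
have bi n : a + n.+1%:R <= a + n.+2%:R by rewrite lerD2l ler_nat.
have aben n : a + e n < a + n.+1%:R.
  by rewrite ltrD2l (lt_le_trans (e1 n))// ler1n.
suff iE : [set` `]a, +oo[] = \bigcup_n `[a + e n, a + n.+1%:R]%classic.
  have Fij' x : x \in `]a, +oo[ -> F x \in `]c, +oo[ by rewrite !E; exact: Fij.
  have Gji' y : y \in `]c, +oo[ -> G y \in `]a, +oo[ /\ F (G y) = y.
    by rewrite !E; exact: Gji.
  have Fd' x : x \in `]a, +oo[ -> is_derive x 1 F (dF x).
    by rewrite !E; exact: Fd.
  have cdF' x : x \in `]a, +oo[ -> {for x, continuous dF}.
    by rewrite !E; exact: cdF.
  have dF0' x : x \in `]a, +oo[ -> 0 < dF x by rewrite !E; exact: dF0.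
  exact: (ge0_subst ad bi aben iE Fij' Gji' Fd' cdF' dF0' mf f0).
apply/seteqP; split => x /=; rewrite E.
    move=> ax; have xa : 0 < x - a by rewrite subr_gt0.
    have [k] := ltr_add_invr xa; rewrite add0r => kr.
    pose N := maxn k (Num.bound (x - a)).
    exists N => //=; rewrite in_itv/=; apply/andP; split.
      rewrite -lerBrDl; apply: le_trans (ltW kr).
      by rewrite lef_pV2 ?posrE// ler_nat ltnS leqW// leq_maxl.
    rewrite -lerBlDl; apply: (le_trans (ltW (archi_boundP (ltW xa)))).
    by rewrite ler_nat leqW// leq_maxr.
  move=> [n _ /=]; rewrite in_itv/= => /andP[? ?]; have := e0 n => ?.
  lra.
Qed.

End subst_cor.

(** * Null sets and integrals on product spaces *)

Lemma measurable_invr (R : realType) : measurable_fun setT (@GRing.inv R).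
Proof.
rewrite (_ : @GRing.inv R = fun x => x * (x ^+ 2) `^ (-1)).
  apply: measurable_funM => //.
  exact: (measurableT_comp (measurable_powR _) (exprn_measurable _)).
apply/funext => x; rewrite powR_inv1 ?sqr_ge0//.
have [->|x0] := eqVneq x 0; first by rewrite invr0 mul0r.
by rewrite expr2 invfM mulrA mulfV// mul1r.
Qed.

(** Decides the measurability of an expression by its syntax; the variables that
    stand for functions are left as goals. *)
Ltac mfun_step :=
  lazymatch goal with
  | |- measurable_fun _ (fun x => (@?f x + @?g x)%R) => apply: (@measurable_funD _ _ _ _ f g)
  | |- measurable_fun _ (fun x => (- @?f x)%R) => refine (measurableT_comp (g := f) (@oppr_measurable _ _) _)
  | |- measurable_fun _ (fun x => (@?f x * @?g x)%R) => apply: (@measurable_funM _ _ _ _ f g)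
  | |- measurable_fun _ (fun x => (@?f x ^+ ?n)%R) => apply: (@measurable_funX _ _ _ _ f n)
  | |- measurable_fun _ (fun x => (@?f x `^ ?a)%R) => refine (measurableT_comp (g := f) (measurable_powR a) _)
  | |- measurable_fun _ (fun x => ((@?f x)^-1)%R) => refine (measurableT_comp (g := f) (@measurable_invr _) _)
  | |- measurable_fun _ (fun x => expR (@?f x)) => refine (measurableT_comp (g := f) (@measurable_expR _) _)
  | |- measurable_fun _ (fun x => sin (@?f x)) => refine (measurableT_comp (g := f) (continuous_measurable_fun (@continuous_sin _)) _)
  | |- measurable_fun _ (fun x => cos (@?f x)) => refine (measurableT_comp (g := f) (continuous_measurable_fun (@continuous_cos _)) _)
  | |- measurable_fun _ (fun x => Num.sqrt (@?f x)) => refine (measurableT_comp (g := f) (continuous_measurable_fun (@sqrt_continuous _)) _)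
  | |- measurable_fun _ (fun x => (@?f x)%:E) => apply/(@measurable_EFinP _ _ _ _ f)
  | |- measurable_fun _ (fun x => (@?f x * @?g x)%E) => apply: (@emeasurable_funM _ _ _ _ f g)
  | |- measurable_fun _ (fun x => (`| @?f x |)%R) => refine (measurableT_comp (g := f) (@normr_measurable _ _) _)
  | |- measurable_fun _ (fun x => \1__ (@?f x)) => refine (measurableT_comp (g := f) (measurable_indic _) _)
  | |- measurable_fun _ (fun x => x) => exact: measurable_id
  | |- measurable_fun _ (fun x => x.1) => exact: measurable_fst
  | |- measurable_fun _ (fun x => x.2) => exact: measurable_snd
  | |- measurable_fun _ (fun x => (x.1).1) => exact: (measurableT_comp measurable_fst measurable_fst)
  | |- measurable_fun _ (fun x => (x.1).2) => exact: (measurableT_comp measurable_snd measurable_fst)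
  | |- measurable_fun _ (fun x => (x.2).1) => exact: (measurableT_comp measurable_fst measurable_snd)
  | |- measurable_fun _ (fun x => (x.2).2) => exact: (measurableT_comp measurable_snd measurable_snd)
  | |- measurable_fun _ (fun x => ?c) => exact: measurable_cst
  end.
Ltac mfun := repeat mfun_step.

Section null_sets.
Local Open Scope ereal_scope.
Context d (T : measurableType d) (R : realType).
Variables (mu : {measure set T -> \bar R}) (N : set T).
Hypotheses (mN : measurable N) (N0 : mu N = 0).

Lemma ge0_integral_null_ext (f g : T -> \bar R) :
  (forall x, 0 <= f x) -> (forall x, 0 <= g x) ->
  (forall x, ~ N x -> f x = g x) -> \int[mu]_x f x = \int[mu]_x g x.
Proof.
move=> f0 g0 fg; wlog suff : f g f0 g0 fg / \int[mu]_x f x <= \int[mu]_x g x.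
  move=> le; apply/eqP; rewrite eq_le !le// => x Nx.
  by rewrite fg.
rewrite ge0_integralTE// ge0_integralTE//.
apply: ge_ereal_sup => _ [h /= hf <-].
apply: ereal_sup_ubound; exists (proj_nnsfun h (measurableC mN)) => /=.
  move=> x; rewrite mindicE; have [xN|xN] := boolP (x \in ~` N).
    by rewrite mulr1 -fg//; rewrite inE in xN.
  by rewrite mulr0.
rewrite -(mrestrict h (measurableC mN)) -integral_nnsfun; last exact: measurableC.
rewrite -integralT_nnsfun (@ge0_negligible_integral _ _ _ mu setT N)//.
- by rewrite setTD.
- exact/measurable_EFinP.
- by move=> x _; rewrite lee_fin.
Qed.

(** The integral of a nonnegative function is a supremum over the simple functions
    below it, and cutting these off on a null set does not change their integrals;
    so no regularity enters. *)
Lemma integral_null_ext (D : set T) (f g : T -> \bar R) :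
  (forall x, D x -> ~ N x -> f x = g x) ->
  \int[mu]_(x in D) f x = \int[mu]_(x in D) g x.
Proof.
move=> fg; rewrite integral_mkcond [RHS]integral_mkcond.
have {}fg x : ~ N x -> (f \_ D) x = (g \_ D) x.
  move=> Nx; rewrite !patchE; case: ifPn => // /[!inE] Dx; exact: fg.
rewrite integralE [RHS]integralE; congr (_ - _); apply: ge0_integral_null_ext => // x Nx.
  by rewrite !funeposE fg.
by rewrite !funenegE fg.
Qed.

Lemma Rintegral_null_ext (D : set T) (f g : T -> R) :
  (forall x, D x -> ~ N x -> f x = g x) ->
  (\int[mu]_(x in D) f x = \int[mu]_(x in D) g x)%R.
Proof.
by move=> fg; congr fine; apply: integral_null_ext => x Dx Nx; rewrite fg.
Qed.

End null_sets.

Section integral_tools.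
Local Open Scope ereal_scope.
Context d (T : measurableType d) (R : realType).
Variables (mu : {measure set T -> \bar R}).

Lemma integral_indicT (D : set T) (f : T -> \bar R) :
  \int[mu]_(x in D) f x = \int[mu]_x (f x * (\1_D x)%:E).
Proof.
rewrite integral_mkcond; apply: eq_integral => x _.
by rewrite patchE indicE; case: ifPn => _; rewrite ?mule1 ?mule0.
Qed.

Lemma le_abs_Rintegral (D : set T) (f : T -> R) :
  measurable D -> measurable_fun D f ->
  (`|\int[mu]_(x in D) f x|%R)%:E <= \int[mu]_(x in D) `|f x|%:E.
Proof.
move=> mD mf.
have [fo|] := ltP (\int[mu]_(x in D) `|f x|%:E) +oo; last first.
  by rewrite leye_eq => /eqP ->; rewrite leey.
have fi : mu.-integrable D (EFin \o f).
  by apply/integrableP; split; [exact/measurable_EFinP|].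
rewrite EFin_normr_Rintegral//; apply: le_abse_integral => //.
exact/measurable_EFinP.
Qed.

End integral_tools.

Lemma integral_fine d (T : measurableType d) (R : realType)
    (m : {measure set T -> \bar R}) (F : T -> \bar R) :
  m.-integrable setT F ->
  (\int[m]_x (fine (F x))%:E = \int[m]_x F x)%E.
Proof.
move=> iF; have mF := measurable_int _ iF.
apply: ae_eq_integral => //.
  by apply/measurable_EFinP; exact: (measurableT_comp (fine_measurable measurableT)).
have := integrable_ae measurableT iF; apply: filterS => x /= h xT.
by rewrite fineK// h.
Qed.

(** Straight from the supremum that defines the integral, hence available for
    iterated integrals before their measurability is known. *)
Lemma le_ge0_integral d (T : measurableType d) (R : realType)
    (mu : {measure set T -> \bar R}) (D : set T) (f h : T -> \bar R) :
  (forall x, D x -> 0 <= f x)%E -> (forall x, D x -> f x <= h x)%E ->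
  (\int[mu]_(x in D) f x <= \int[mu]_(x in D) h x)%E.
Proof.
move=> f0 fh.
have h0 x : D x -> (0 <= h x)%E by move=> Dx; exact: le_trans (f0 _ Dx) (fh _ Dx).
rewrite integral_mkcond [leRHS]integral_mkcond.
have F0 x : (0 <= (f \_ D) x)%E by rewrite patchE; case: ifPn => // /[!inE]; exact: f0.
have H0 x : (0 <= (h \_ D) x)%E by rewrite patchE; case: ifPn => // /[!inE]; exact: h0.
rewrite ge0_integralTE// ge0_integralTE//; apply: le_ereal_sup => _ [k /= kf <-].
exists k => // x; apply: le_trans (kf x) _; rewrite !patchE.
by case: ifPn => // /[!inE]; exact: fh.
Qed.

(** The translation is defined with a closed range of angles.  At the ends the
    third side may vanish, so that the point leaves the open orthant; those two
    angles are removed here. *)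
Lemma Rintegral_0pi_open (R : realType) (f : R -> R) :
  \int[@lebesgue_measure R]_(x in `[0, pi]) f x = \int[@lebesgue_measure R]_(x in `]0, pi[) f x.
Proof.
pose N := [set 0; pi : R] : set (measurableTypeR R).
have mN : measurable N by apply: measurableU; exact: measurable_set1.
have N0 : @lebesgue_measure R N = 0%E.
  apply/eqP; rewrite -measure_le0; apply: le_trans (measureU2 _ _ _) _.
  - exact: measurable_set1.
  - exact: measurable_set1.
  - have S (b : R) : @lebesgue_measure R [set b] = 0%E by exact: lebesgue_measure_set1.
    have S' (b : R) : (@lebesgue_measure R [set b] <= 0)%E by rewrite S.
    by rewrite -[leRHS](adde0 0%E); apply: leeD; exact: S'.
rewrite Rintegral_mkcond [RHS]Rintegral_mkcond.
apply: (Rintegral_null_ext mN N0) => x _ Nx.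
rewrite !patchE !mem_setE !in_itv/=.
suff -> : (0 <= x <= pi) = (0 < x < pi) by [].
rewrite !le_eqVlt; have [xpi|xpi] := eqVneq x pi; first by case: Nx; right.
have [x0|x0] := eqVneq 0 x; first by case: Nx; left.
by [].
Qed.

Section Rintegral_scale.
Context d (T : measurableType d) (R : realType).
Variables (mu : {measure set T -> \bar R}) (D : set T).
Hypothesis mD : measurable D.

Lemma RintegralN (f : T -> R) : \int[mu]_(x in D) (- f x) = - \int[mu]_(x in D) f x.
Proof.
rewrite /Rintegral integralE [in RHS]integralE.
have -> : ((fun x => (- f x)%:E)^\+ = (fun x => (f x)%:E)^\-)%E.
  by apply/funext => x; rewrite funeposE funenegE.
have -> : ((fun x => (- f x)%:E)^\- = (fun x => (f x)%:E)^\+)%E.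
  by apply/funext => x; rewrite funeposE funenegE -EFinN opprK.
have := @integral_ge0 _ _ _ mu D _ (fun x _ => funepos_ge0 (fun x => (f x)%:E) x).
have := @integral_ge0 _ _ _ mu D _ (fun x _ => funeneg_ge0 (fun x => (f x)%:E) x).
move: (integral _ _ _) => a; move: (integral _ _ _) => b.
by move: a b => [a| |] [b| |]//= _ _; rewrite ?oppr0 ?opprB.
Qed.

(** A divergent integral counts as 0 on both sides. *)
Lemma RintegralMl (r : R) (f : T -> R) : measurable_fun D f ->
  \int[mu]_(x in D) (r * f x) = r * \int[mu]_(x in D) f x.
Proof.
move=> mf; wlog r0 : r / 0 <= r.
  move=> H; have [|r0] := leP 0 r; first exact: H.
  rewrite -[r]opprK [RHS]mulNr -H ?oppr_ge0 ?(ltW r0)// -RintegralN.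
  by apply: eq_Rintegral => x _; rewrite mulNr.
have [->|rn0] := eqVneq r 0.
  by rewrite mul0r; under eq_Rintegral do rewrite mul0r; rewrite /Rintegral integral0.
have mE : measurable_fun D (fun x => (f x)%:E) by exact/measurable_EFinP.
rewrite /Rintegral integralE [in RHS]integralE.
have P h : (forall x, 0 <= h x)%E -> measurable_fun D h ->
    (\int[mu]_(x in D) (r%:E * h x) = r%:E * \int[mu]_(x in D) h x)%E.
  by move=> h0 mh; apply: ge0_integralZl.
have -> : ((fun x => (r * f x)%:E)^\+ = fun x => r%:E * ((fun x => (f x)%:E)^\+ x))%E.
  by apply/funext => x; rewrite !funeposE maxe_pMr// mule0.
have -> : ((fun x => (r * f x)%:E)^\- = fun x => r%:E * ((fun x => (f x)%:E)^\- x))%E.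
  by apply/funext => x; rewrite !funenegE maxe_pMr// mule0 EFinM muleN.
rewrite !P//; first last.
- exact: measurable_funepos.
- exact: measurable_funeneg.
move: (integral _ _ _) => a; move: (integral _ _ _) => b.
have r1 : 0 < r by rewrite lt_neqAle eq_sym rn0.
have roo : (r%:E * +oo = +oo)%E by rewrite mulry gtr0_sg// mul1e.
have rNoo : (r%:E * -oo = -oo)%E by rewrite mulrNy gtr0_sg// mul1e.
by move: a b => [a| |] [b| |]//=; rewrite ?roo ?rNoo ?mulr0//= mulrBr.
Qed.

End Rintegral_scale.

Section product_tools.
Local Open Scope ereal_scope.
Context d1 d2 (T1 : measurableType d1) (T2 : measurableType d2) (R : realType).
Variables (m1 : {sigma_finite_measure set T1 -> \bar R})
  (m2 : {sigma_finite_measure set T2 -> \bar R}).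
Variables (D1 : set T1) (D2 : set T2).
Hypotheses (mD1 : measurable D1) (mD2 : measurable D2).

Lemma measurable_ge0_integral (f : T1 * T2 -> \bar R) :
  measurable_fun setT f -> (forall z, 0 <= f z) ->
  measurable_fun setT (fun x => \int[m2]_(y in D2) f (x, y)).
Proof.
move=> mf f0.
under eq_fun do rewrite integral_indicT.
apply: (measurable_fun_fubini_tonelli_F (fun z => f z * (\1_D2 z.2)%:E)).
  apply: emeasurable_funM => //; apply/measurable_EFinP.
  exact: measurableT_comp.
by move=> z; rewrite mule_ge0// lee_fin indicE.
Qed.

Lemma integral_setX (f : T1 * T2 -> \bar R) :
  \int[m1]_(x in D1) \int[m2]_(y in D2) f (x, y) =
  \int[m1]_x \int[m2]_y (f \_ (D1 `*` D2)) (x, y).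
Proof.
rewrite integral_mkcond; apply: eq_integral => x _; rewrite patchE; case: ifPn => xD.
  rewrite integral_mkcond; apply: eq_integral => y _; rewrite !patchE.
  by rewrite in_setX xD.
rewrite integral0_eq// => y _; rewrite patchE.
by rewrite in_setX (negbTE xD).
Qed.

Lemma integral_setX_sym (f : T1 * T2 -> \bar R) :
  \int[m2]_(y in D2) \int[m1]_(x in D1) f (x, y) =
  \int[m2]_y \int[m1]_x (f \_ (D1 `*` D2)) (x, y).
Proof.
rewrite integral_mkcond; apply: eq_integral => y _; rewrite patchE; case: ifPn => yD.
  rewrite integral_mkcond; apply: eq_integral => x _; rewrite !patchE.
  by rewrite in_setX yD andbT.
rewrite integral0_eq// => x _; rewrite patchE.
by rewrite in_setX (negbTE yD) andbF.
Qed.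

Lemma ge0_integral_swap (f : T1 * T2 -> \bar R) :
  measurable_fun setT f -> (forall z, 0 <= f z) ->
  \int[m1]_(x in D1) \int[m2]_(y in D2) f (x, y) =
  \int[m2]_(y in D2) \int[m1]_(x in D1) f (x, y).
Proof.
move=> mf f0; rewrite integral_setX integral_setX_sym.
apply: (fubini_tonelli (f \_ (D1 `*` D2))).
  apply/(measurable_restrictT f); first exact: measurableX.
  exact: measurable_funTS.
by move=> z; rewrite patchE; case: ifPn.
Qed.

Lemma measurable_Rintegral (f : T1 * T2 -> R) :
  measurable_fun setT f ->
  measurable_fun setT (fun x => \int[m2]_(y in D2) f (x, y))%R.
Proof.
move=> mf; rewrite /Rintegral.
apply: (measurableT_comp (fine_measurable measurableT)).
under eq_fun do rewrite integralE.
have mE : measurable_fun setT (EFin \o f) by exact/measurable_EFinP.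
apply: emeasurable_funB.
- rewrite (_ : (fun _ => _) =
      fun x => \int[m2]_(y in D2) ((EFin \o f)^\+ (x, y))); last first.
    by apply/funext => x; apply: eq_integral => y _; rewrite !funeposE.
  apply: measurable_ge0_integral => //.
  exact: measurable_funepos.
- rewrite (_ : (fun _ => _) =
      fun x => \int[m2]_(y in D2) ((EFin \o f)^\- (x, y))); last first.
    by apply/funext => x; apply: eq_integral => y _; rewrite !funenegE.
  apply: measurable_ge0_integral => //.
  exact: measurable_funeneg.
Qed.

(** Reduces identities between iterated integrals of a signed function to
    identities between iterated integrals of nonnegative ones. *)
Lemma Rintegral_posneg (f : T1 * T2 -> R) :
  measurable_fun setT f ->
  \int[m1]_(x in D1) \int[m2]_(y in D2) `|f (x, y)|%:E < +oo ->
  (\int[m1]_(x in D1) \int[m2]_(y in D2) f (x, y) =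
   fine (\int[m1]_(x in D1) \int[m2]_(y in D2) (Num.max (f (x, y)) 0)%:E) -
   fine (\int[m1]_(x in D1) \int[m2]_(y in D2) (Num.max (- f (x, y)) 0)%:E))%R.
Proof.
move=> mf foo.
pose h : T1 * T2 -> R := f \_ (D1 `*` D2).
have mh : measurable_fun setT h.
  apply/(measurable_restrictT f); first exact: measurableX.
  exact: measurable_funTS.
have ih : (m1 \x m2).-integrable setT (EFin \o h).
  apply/integrable12ltyP; first exact/measurable_EFinP.
  rewrite (_ : (fun _ => _) = fun x => \int[m2]_y
      (((fun z => `|f z|%:E) \_ (D1 `*` D2)) (x, y))); last first.
    apply/funext => x; apply: eq_integral => y _.
    by rewrite /h /= !patchE; case: ifPn; rewrite ?normr0.
  by rewrite -(integral_setX (fun z => `|f z|%:E)).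
transitivity (\int[m1]_x \int[m2]_y h (x, y))%R.
  rewrite Rintegral_mkcond; apply: eq_Rintegral => x _; rewrite patchE; case: ifPn => xD.
    rewrite Rintegral_mkcond; apply: eq_Rintegral => y _; rewrite /h !patchE.
    by rewrite in_setX xD.
  rewrite /Rintegral integral0_eq// => y _; rewrite /h patchE.
  by rewrite in_setX (negbTE xD).
transitivity (fine (\int[m1 \x m2]_z (h z)%:E)).
  rewrite /Rintegral; congr fine.
  rewrite (integral_fine (integrable_fubini_F ih)).
  exact: (integral12_prod_meas1 ih).
rewrite (integral_setX (fun z => (Num.max (f z) 0)%:E)).
rewrite (integral_setX (fun z => (Num.max (- f z) 0)%:E)).
have E1 : (fun z => (Num.max (f z) 0)%:E) \_ (D1 `*` D2) = (EFin \o h)^\+.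
  apply/funext => z; rewrite funeposE /h /= !patchE.
  by case: ifPn => _; rewrite ?EFin_max ?maxxx.
have E2 : (fun z => (Num.max (- f z) 0)%:E) \_ (D1 `*` D2) = (EFin \o h)^\-.
  apply/funext => z; rewrite funenegE /h /= !patchE.
  by case: ifPn => _; rewrite -EFin_max// oppr0 maxxx.
have mE : measurable_fun setT (EFin \o h) by exact/measurable_EFinP.
rewrite E1 E2 -(@fubini_tonelli1 _ _ _ _ _ m1 m2 _ (measurable_funepos mE) (funepos_ge0 _)).
rewrite -(@fubini_tonelli1 _ _ _ _ _ m1 m2 _ (measurable_funeneg mE) (funeneg_ge0 _)).
rewrite integralE fineB//.
  exact: integrable_pos_fin_num.
exact: integrable_neg_fin_num.
Qed.

Lemma ge0_le_integral2 (f h : T1 * T2 -> \bar R) :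
  measurable_fun setT f -> measurable_fun setT h -> (forall z, 0 <= f z) ->
  (forall x y, D1 x -> D2 y -> f (x, y) <= h (x, y)) ->
  \int[m1]_(x in D1) \int[m2]_(y in D2) f (x, y) <=
  \int[m1]_(x in D1) \int[m2]_(y in D2) h (x, y).
Proof.
move=> mf mh f0 fh.
have mh' : measurable_fun setT (h \_ (D1 `*` D2)).
  by apply/(measurable_restrictT h); [exact: measurableX|exact: measurable_funTS].
have h0 z : 0 <= (h \_ (D1 `*` D2)) z.
  case: z => x y; rewrite patchE; case: ifPn => //.
  by rewrite inE => -[/= D1x D2y]; apply: le_trans (fh _ _ D1x D2y).
have mf' : measurable_fun setT (f \_ (D1 `*` D2)).
  by apply/(measurable_restrictT f); [exact: measurableX|exact: measurable_funTS].
have f'0 z : 0 <= (f \_ (D1 `*` D2)) z by rewrite patchE; case: ifPn.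
rewrite (integral_setX f) (integral_setX h).
rewrite -(@fubini_tonelli1 _ _ _ _ _ m1 m2 _ mf' f'0) -(@fubini_tonelli1 _ _ _ _ _ m1 m2 _ mh' h0).
apply: ge0_le_integral => // -[x y] _; rewrite !patchE; case: ifPn => //.
by rewrite inE => -[/= D1x D2y]; exact: fh.
Qed.

Lemma ge0_integralZl2 (k : R) (f : T1 * T2 -> \bar R) : (0 <= k)%R ->
  measurable_fun setT f -> (forall z, 0 <= f z) ->
  \int[m1]_(x in D1) \int[m2]_(y in D2) (k%:E * f (x, y)) =
  k%:E * \int[m1]_(x in D1) \int[m2]_(y in D2) f (x, y).
Proof.
move=> k0 mf f0.
have mF : measurable_fun D1 (fun x => \int[m2]_(y in D2) f (x, y)).
  by apply: measurable_funTS; exact: measurable_ge0_integral.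
rewrite -ge0_integralZl//.
- apply: eq_integral => x _; rewrite ge0_integralZl//.
  by apply: measurable_funTS; exact: (measurableT_comp mf (pair1_measurable x)).
- by move=> x _; exact: integral_ge0.
Qed.

(** The form in which the hypothesis of [Rintegral_swap] is checked below. *)
Lemma separated_bound_fin (f : T1 * T2 -> R) (a : T1 -> R) (b : T2 -> R) :
  measurable_fun setT f -> measurable_fun setT a -> measurable_fun setT b ->
  (forall x, 0 <= a x)%R -> (forall y, 0 <= b y)%R ->
  (forall x y, D1 x -> D2 y -> `|f (x, y)| <= a x * b y)%R ->
  \int[m1]_(x in D1) (a x)%:E < +oo -> \int[m2]_(y in D2) (b y)%:E < +oo ->
  \int[m1]_(x in D1) \int[m2]_(y in D2) `|f (x, y)|%:E < +oo.
Proof.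
move=> mf ma mb a0 b0 fab ia ib.
have ma1 : measurable_fun setT (fun z : T1 * T2 => a z.1) by exact: measurableT_comp.
have mb2 : measurable_fun setT (fun z : T1 * T2 => b z.2) by exact: measurableT_comp.
have mf' : measurable_fun setT (fun z : T1 * T2 => `|f z|%:E) by mfun.
have mab : measurable_fun setT (fun z : T1 * T2 => (a z.1 * b z.2)%:E) by mfun.
have f0 (z : T1 * T2) : 0 <= `|f z|%:E by rewrite lee_fin.
have fab' x y : D1 x -> D2 y -> `|f (x, y)|%:E <= (a x * b y)%:E.
  by move=> Dx Dy; rewrite lee_fin; exact: fab.
apply: le_lt_trans (ge0_le_integral2 mf' mab f0 fab') _ => /=.
have ib0 : 0 <= \int[m2]_(y in D2) (b y)%:E by apply: integral_ge0 => y _; rewrite lee_fin.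
have Eb x : \int[m2]_(y in D2) (a x * b y)%:E = (\int[m2]_(y in D2) (b y)%:E) * (a x)%:E.
  rewrite muleC -ge0_integralZl//.
  - by apply: measurable_funTS; mfun.
  - by move=> y _; rewrite lee_fin.
  - by rewrite lee_fin.
under eq_integral do rewrite Eb.
rewrite ge0_integralZl//.
- rewrite lte_mul_pinfty//; by rewrite ge0_fin_numE.
- by apply: measurable_funTS; mfun.
- by move=> x _; rewrite lee_fin.
Qed.

End product_tools.

Lemma Rintegral_swap d1 d2 (T1 : measurableType d1) (T2 : measurableType d2) (R : realType)
    (m1 : {sigma_finite_measure set T1 -> \bar R})
    (m2 : {sigma_finite_measure set T2 -> \bar R}) (D1 : set T1) (D2 : set T2)
    (mD1 : measurable D1) (mD2 : measurable D2) (f : T1 * T2 -> R) :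
  measurable_fun setT f ->
  (\int[m1]_(x in D1) \int[m2]_(y in D2) `|f (x, y)|%:E < +oo)%E ->
  \int[m1]_(x in D1) \int[m2]_(y in D2) f (x, y) =
  \int[m2]_(y in D2) \int[m1]_(x in D1) f (x, y).
Proof.
move=> mf foo.
have mf' : measurable_fun setT (fun z : T2 * T1 => f (z.2, z.1)).
  exact: (measurableT_comp mf (@measurable_swap _ _ T2 T1)).
have swap (h : R -> R) : measurable_fun setT h -> (forall r, 0 <= h r) ->
    (\int[m1]_(x in D1) \int[m2]_(y in D2) (h (f (x, y)))%:E =
     \int[m2]_(y in D2) \int[m1]_(x in D1) (h (f (x, y)))%:E)%E.
  move=> mh h0.
  have mhf : measurable_fun setT (fun z => (h (f z))%:E).
    by apply/measurable_EFinP; exact: measurableT_comp.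
  exact: (@ge0_integral_swap _ _ _ _ _ m1 m2 _ _ mD1 mD2 _ mhf (fun z => h0 _)).
have foo' : (\int[m2]_(y in D2) \int[m1]_(x in D1) `|f (x, y)|%:E < +oo)%E.
  by rewrite -(swap (fun r => `|r|)).
have max0 (r : R) : 0 <= Num.max r 0 by rewrite le_max lexx orbT.
rewrite (@Rintegral_posneg _ _ _ _ _ m1 m2 _ _ mD1 mD2 _ mf foo).
rewrite (@Rintegral_posneg _ _ _ _ _ m2 m1 _ _ mD2 mD1 _ mf' foo') /=.
rewrite (swap (fun r => Num.max r 0))//; last exact: measurable_maxr.
rewrite (swap (fun r => Num.max (- r) 0))//.
by apply: measurable_maxr => //; mfun.
Qed.

(** * The Gamma function *)

Lemma ge0_integralMl d (T : measurableType d) (R : realType)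
    (mu : {measure set T -> \bar R}) (D : set T) (k : R) (f : T -> R) :
  measurable D -> measurable_fun D f -> (forall x, D x -> 0 <= f x) -> 0 <= k ->
  (\int[mu]_(x in D) (k * f x)%:E = k%:E * \int[mu]_(x in D) (f x)%:E)%E.
Proof.
move=> mD mf f0 k0; under eq_integral do rewrite EFinM.
rewrite ge0_integralZl//; first exact/measurable_EFinP.
Qed.

Section triangle.
Context {R : realType}.
Local Notation mu := (@lebesgue_measure R).

Lemma measurable_set_lt : measurable [set z : R * R | z.1 < z.2].
Proof.
have := @measurable_fun_ltr _ _ R setT fst snd measurable_fst measurable_snd
  measurableT [set true].
rewrite setTI; apply => //; exact: measurable_set1.
Qed.

(** Both sides integrate over [0 < t < u]. *)
Lemma ge0_integral_triangle (f : R * R -> \bar R) :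
  measurable_fun setT f -> (forall z, 0 <= f z)%E ->
  (\int[mu]_(t in `]0%R, +oo[) \int[mu]_(u in `]t, +oo[) f (t, u) =
   \int[mu]_(u in `]0%R, +oo[) \int[mu]_(t in `]0%R, u[) f (t, u))%E.
Proof.
move=> mf f0.
pose D := [set z : R * R | z.1 < z.2].
have mfD : measurable_fun setT (f \_ D).
  apply/(measurable_restrictT f); first exact: measurable_set_lt.
  exact: measurable_funTS.
have fD0 z : (0 <= (f \_ D) z)%E by rewrite patchE; case: ifPn.
have m0 : measurable (`]0%R, +oo[%classic : set R) by exact: measurable_itv.
have E1 := @ge0_integral_swap _ _ _ _ _ mu mu _ _ m0 m0 _ mfD fD0.
transitivity (\int[mu]_(t in `]0%R, +oo[) \int[mu]_(u in `]0%R, +oo[) (f \_ D) (t, u))%E.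
  apply: eq_integral => t; rewrite inE/= in_itv/= andbT => t0.
  rewrite integral_mkcond [RHS]integral_mkcond; apply: eq_integral => u _.
  rewrite !patchE (_ : (t, u) \in D = (t < u)); last by apply/idP/idP; rewrite inE.
  rewrite !mem_setE !in_itv/= !andbT; case: ltP => tu.
    by rewrite (lt_trans t0 tu).
  by rewrite if_same.
rewrite [LHS]E1; apply: eq_integral => u; rewrite inE/= in_itv/= andbT => u0.
rewrite integral_mkcond [RHS]integral_mkcond; apply: eq_integral => t _.
rewrite !patchE (_ : (t, u) \in D = (t < u)); last by apply/idP/idP; rewrite inE.
by rewrite !mem_setE !in_itv/= !andbT; case: ltP => tu; rewrite ?andbF ?andbT ?if_same.
Qed.

End triangle.

Section gamma.
Context {R : realType}.
Local Notation mu := (@lebesgue_measure R).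
Implicit Types s a b c : R.

(** By [ln y <= y - 1] at [y = t c / p]. *)
Lemma powR_le_expR (p c : R) : 0 <= p -> 0 < c ->
  exists2 C, 0 < C & forall t, 0 < t -> t `^ p <= C * expR (c * t).
Proof.
rewrite le_eqVlt => /predU1P[<- c0|p0 c0].
  exists 1 => // t t0; rewrite powRr0 mul1r -expR0 ler_expR mulr_ge0 ?ltW//.
exists (expR (p * ln (p / c))); first exact: expR_gt0.
move=> t t0; rewrite /powR gt_eqF// -expRD ler_expR.
have pc : 0 < p / c by rewrite divr_gt0.
have -> : ln t = ln (p / c) + ln (t / (p / c)).
  by rewrite -lnM ?posrE ?divr_gt0// mulrCA divff ?mulr1// gt_eqF.
rewrite mulrDr lerD2l.
have := le_ln1Dx (x := t / (p / c) - 1); rewrite addrCA subrr addr0 => h.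
have {}h : ln (t / (p / c)) <= t / (p / c) - 1 by apply: h; rewrite ltrBrDl subrr divr_gt0.
apply: (@le_trans _ _ (p * (t / (p / c)))).
  by rewrite ler_pM2l//; apply: (le_trans h); rewrite gerBl.
by rewrite invf_div mulrCA (mulrCA p) divff ?gt_eqF// mulr1 mulrC.
Qed.

Lemma integral_expRN (t : R) :
  (\int[mu]_(u in `]t, +oo[) (expR (- u))%:E = (expR (- t))%:E)%E.
Proof.
have cf : continuous (fun u : R => expR (- u)).
  by move=> u; apply: continuous_comp; [exact: opp_continuous|exact: continuous_expR].
rewrite integral_itv_obnd_cbnd; last first.
  by apply: measurable_funTS; mfun.
have dF x : is_derive x (1:R) (fun u : R => - expR (- u)) (expR (- x)).
  by apply: is_derive_eq; rewrite mulrN1 opprK.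
rewrite (@ge0_continuous_FTC2y _ _ (fun u : R => - expR (- u)) _ 0)//.
- by rewrite sub0e EFinN oppeK.
- by apply: continuous_subspaceT => x; exact: cf.
- by rewrite -oppr0; apply: cvgN; exact: cvgr_expR.
- by apply: cvg_at_right_filter; apply: cvgN; exact: cf.
- by move=> x _; rewrite derive1E derive_val.
Qed.

Lemma integral_powR (s u : R) : 0 < s -> 0 < u ->
  (\int[mu]_(t in `]0%R, u[) (t `^ (s - 1))%:E = (u `^ s / s)%:E)%E.
Proof.
move=> s0 u0.
have P0 (x : R) : 0 < x < u -> 0 < x by case/andP.
have H1 (x : R) : 0 < x < u -> 0 < x `^ s < u `^ s.
  by move=> /andP[x0 xu]; rewrite powR_gt0//= gt0_ltr_powR// nnegrE ltW.
have H2 (y : R) : 0 < y < u `^ s -> 0 < y `^ s^-1 < u /\ (y `^ s^-1) `^ s = y.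
  move=> /andP[y0 yu]; split; last by rewrite -powRrM mulVf ?gt_eqF// powRr1// ltW.
  rewrite powR_gt0//= -[ltRHS](powRr1 (ltW u0)) -(mulfV (lt0r_neq0 s0)).
  by rewrite powRrM gt0_ltr_powR ?invr_gt0// ?nnegrE ?ltW ?powR_gt0.
have H3 (x : R) : 0 < x < u -> is_derive x 1 (fun t => t `^ s) (s * x `^ (s - 1)).
  by move=> /P0 x0; exact: is_derive1_powR.
have H4 (x : R) : 0 < x < u -> {for x, continuous (fun t : R => s * t `^ (s - 1))}.
  move=> /P0 x0; apply: continuousM; first exact: cst_continuous.
  apply/differentiable_continuous/derivable1_diffP.
  by apply: derivable_powR; rewrite in_itv/= x0.
have H5 (x : R) : 0 < x < u -> 0 < s * x `^ (s - 1).
  by move=> /P0 x0; rewrite mulr_gt0// powR_gt0.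
have mc : measurable_fun setT (cst (s^-1)%:E : R -> \bar R) by exact: measurable_cst.
have c0 (x : R) : (0 <= (s^-1)%:E)%E by rewrite lee_fin invr_ge0 ltW.
have := ge0_subst_oo u0 H1 H2 H3 H4 H5 mc c0.
rewrite integral_cst/=; last exact: measurable_itv.
rewrite lebesgue_measure_itv/= lte_fin powR_gt0// -EFinB subr0 -EFinM mulrC => ->.
by apply: eq_integral => t _; rewrite /cst/= -EFinM mulrA mulVf ?mul1r// gt_eqF.
Qed.

(** The integral of Gamma in extended reals, where Tonelli's theorem applies before
    convergence is known. *)
Definition gammaE (s : R) : \bar R :=
  (\int[mu]_(t in `]0%R, +oo[) (t `^ (s - 1) * expR (- t))%:E)%E.

Lemma gammaE_ge0 s : (0 <= gammaE s)%E.
Proof. by apply: integral_ge0 => t _; rewrite lee_fin mulr_ge0 ?powR_ge0 ?expR_ge0. Qed.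

(** Integration by parts in Tonelli form: [t^s] is the integral of [s u^(s-1)] over
    [0 < u < t]. *)
Lemma gammaE_rec s : 0 < s -> gammaE (s + 1) = (s%:E * gammaE s)%E.
Proof.
move=> s0; rewrite /gammaE addrK.
transitivity (\int[mu]_(t in `]0%R, +oo[) \int[mu]_(u in `]t, +oo[)
   (s * t `^ (s - 1) * expR (- u))%:E)%E; last first.
  rewrite -ge0_integralZl//=; last 3 first.
  - by apply: measurable_funTS; mfun.
  - by move=> t _; rewrite lee_fin mulr_ge0 ?powR_ge0 ?expR_ge0.
  - by rewrite lee_fin ltW.
  apply: eq_integral => t _.
  under eq_integral do rewrite EFinM.
  rewrite ge0_integralZl//=; first by rewrite integral_expRN -!EFinM mulrA.
  - by apply: measurable_funTS; mfun.
  - by rewrite lee_fin mulr_ge0 ?powR_ge0 ?ltW.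
rewrite (ge0_integral_triangle (f := fun z => (s * z.1 `^ (s - 1) * expR (- z.2))%:E)); last 2 first.
- by mfun.
- by move=> z; rewrite lee_fin !mulr_ge0 ?powR_ge0 ?expR_ge0 ?ltW.
apply: eq_integral => u; rewrite inE/= in_itv/= andbT => u0.
under eq_integral do rewrite mulrAC EFinM.
rewrite ge0_integralZl//=; last 3 first.
- by apply: measurable_funTS; mfun.
- by move=> t _; rewrite lee_fin powR_ge0.
- by rewrite lee_fin mulr_ge0 ?expR_ge0 ?ltW.
rewrite integral_powR// -!EFinM; congr EFin.
by rewrite [RHS]mulrC mulrA divfK ?gt_eqF.
Qed.

Lemma gammaE_ge1_fin s : 1 <= s -> (gammaE s < +oo)%E.
Proof.
move=> s1; have sp : 0 <= s - 1 by rewrite subr_ge0.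
have h2 : 0 < 2^-1 :> R by rewrite invr_gt0.
have [C C0 HC] := powR_le_expR sp h2.
apply: (@le_lt_trans _ _ (\int[mu]_(t in `]0%R, +oo[) ((C * 2)%:E * (2^-1 * expR (- (t / 2)))%:E))%E).
  apply: ge0_le_integral => //=.
  - by move=> t _; rewrite lee_fin mulr_ge0 ?powR_ge0 ?expR_ge0.
  - by apply: measurable_funTS; mfun.
  - by apply: measurable_funTS; mfun.
  - move=> t; rewrite in_itv/= andbT => t0; rewrite lee_fin.
    rewrite -mulrA mulVKf// (_ : - t = 2^-1 * - t + - (t / 2)); last by field.
    rewrite expRD mulrA ler_pM2r ?expR_gt0//.
    apply: (le_trans (ler_wpM2r (expR_ge0 _) (HC t t0))).
    by rewrite -mulrA -expRD mulrN subrr expR0 mulr1.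
rewrite ge0_integralZl//=; first last.
- by rewrite lee_fin mulr_ge0 ?ltW.
- by apply: measurable_funTS; mfun.
have H1 (x : R) : 0 < x -> 0 < x / 2 by move=> ?; lra.
have H2 (y : R) : 0 < y -> 0 < y * 2 /\ (y * 2) / 2 = y by move=> ?; split; [lra|field].
have H3 (x : R) : 0 < x -> is_derive x 1 (fun t : R => t / 2) 2^-1.
  by move=> _; apply: is_derive_eq; rewrite /GRing.scale/=; ring.
have H4 (x : R) : 0 < x -> {for x, continuous (cst (2^-1 : R))}.
  by move=> _; exact: cst_continuous.
have H5 (x : R) : 0 < x -> 0 < cst (2^-1 : R) x by [].
have mf : measurable_fun setT (fun t : R => (expR (- t))%:E) by mfun.
have f0 (t : R) : (0 <= (expR (- t))%:E)%E by rewrite lee_fin expR_ge0.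
have := ge0_subst_oy H1 H2 H3 H4 H5 mf f0.
under [in X in _ = X]eq_integral do rewrite -EFinM mulrC.
by rewrite integral_expRN => <-; rewrite -EFinM ltry.
Qed.

(** For [1 <= s] the integrand is dominated by an exponential; the recurrence brings
    the other exponents to this case. *)
Lemma gammaE_fin s : 0 < s -> (gammaE s < +oo)%E.
Proof.
move=> s0; rewrite ltey; apply/eqP => E.
have := @gammaE_ge1_fin (s + 1); rewrite gammaE_rec// E gt0_muley ?lte_fin//.
by rewrite lerDr ltW// => /(_ erefl).
Qed.

Lemma gammaE_gt0 s : 0 < s -> (0 < gammaE s)%E.
Proof.
move=> s0; suff h : (0 < gammaE (s + 1))%E.
  move: h; rewrite gammaE_rec// lt_neqAle eq_sym => /andP[h _].
  by rewrite lt_neqAle gammaE_ge0 andbT; apply: contra h => /eqP <-; rewrite mule0.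
apply: (@lt_le_trans _ _ (\int[mu]_(t in `]1%R, +oo[) (expR (- t))%:E)%E).
  by rewrite integral_expRN lte_fin expR_gt0.
apply: (@le_trans _ _ (\int[mu]_(t in `]1%R, +oo[) (t `^ (s + 1 - 1) * expR (- t))%:E)%E).
  apply: ge0_le_integral => //=.
  - by apply: measurable_funTS; mfun.
  - by apply: measurable_funTS; mfun.
  - move=> t; rewrite in_itv/= andbT => t1; rewrite lee_fin addrK.
    rewrite ler_peMl ?expR_ge0// -(powRr0 t) ler_powR ?ltW//.
apply: ge0_subset_integral => //=.
- by apply: measurable_funTS; mfun.
- by move=> t _; rewrite lee_fin mulr_ge0 ?powR_ge0 ?expR_ge0.
- by move=> t /=; rewrite !in_itv/= !andbT; exact: lt_trans.
Qed.

Lemma GammaE s : 0 < s -> (Gamma s)%:E = gammaE s.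
Proof.
move=> s0; rewrite /Gamma /Rintegral fineK// ge0_fin_numE ?gammaE_fin//.
exact: gammaE_ge0.
Qed.

Lemma Gamma_gt0 s : 0 < s -> 0 < Gamma s.
Proof. by move=> s0; rewrite -lte_fin GammaE// gammaE_gt0. Qed.

Lemma Gamma_rec s : 0 < s -> Gamma (s + 1) = s * Gamma s.
Proof.
move=> s0; apply: EFin_inj; rewrite EFinM !GammaE ?addr_gt0//.
exact: gammaE_rec.
Qed.

End gamma.

(** * Beta integrals and the moments of the angular weight *)

Section affine_subst.
Context {R : realType}.
Local Notation mu := (@lebesgue_measure R).
Variable f : R -> \bar R.
Hypotheses (mf : measurable_fun setT f) (f0 : forall x, (0 <= f x)%E).

Lemma ge0_integral_shift_oy (a : R) :
  (\int[mu]_(y in `]0%R, +oo[) f y = \int[mu]_(x in `]a, +oo[) f (x - a)%R)%E.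
Proof.
have H1 (x : R) : a < x -> 0 < x - a by rewrite subr_gt0.
have H2 (y : R) : 0 < y -> a < y + a /\ (y + a) - a = y.
  by move=> y0; rewrite ltrDr addrK.
have H3 (x : R) : a < x -> is_derive x 1 (fun x : R => x - a) 1.
  by move=> _; apply: is_derive_eq; ring.
have H4 (x : R) : a < x -> {for x, continuous (cst (1 : R))}.
  by move=> _; exact: cst_continuous.
have H5 (x : R) : a < x -> 0 < cst (1 : R) x by [].
rewrite (ge0_subst_oy H1 H2 H3 H4 H5 mf f0).
by apply: eq_integral => x _; rewrite mule1.
Qed.

Lemma ge0_integral_shift_oo (a b c : R) : a < b ->
  (\int[mu]_(y in `](a + c)%R, (b + c)%R[) f y = \int[mu]_(x in `]a, b[) f (x + c)%R)%E.
Proof.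
move=> ab.
have H1 (x : R) : a < x < b -> a + c < x + c < b + c by rewrite !ltrD2r.
have H2 (y : R) : a + c < y < b + c -> a < y - c < b /\ (y - c) + c = y.
  by rewrite ltrBrDr ltrBlDr subrK.
have H3 (x : R) : a < x < b -> is_derive x 1 (fun x : R => x + c) 1.
  by move=> _; apply: is_derive_eq; ring.
have H4 (x : R) : a < x < b -> {for x, continuous (cst (1 : R))}.
  by move=> _; exact: cst_continuous.
have H5 (x : R) : a < x < b -> 0 < cst (1 : R) x by [].
rewrite (ge0_subst_oo ab H1 H2 H3 H4 H5 mf f0).
by apply: eq_integral => x _; rewrite mule1.
Qed.

Lemma ge0_integral_scale_oy (c : R) : 0 < c ->
  (\int[mu]_(y in `]0%R, +oo[) f y = \int[mu]_(x in `]0%R, +oo[) (f (c * x)%R * c%:E))%E.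
Proof.
move=> c0.
have H1 (x : R) : 0 < x -> 0 < c * x by move=> x0; rewrite mulr_gt0.
have H2 (y : R) : 0 < y -> 0 < c^-1 * y /\ c * (c^-1 * y) = y.
  by move=> y0; rewrite mulr_gt0 ?invr_gt0// mulVKf ?gt_eqF.
have H3 (x : R) : 0 < x -> is_derive x 1 (fun x : R => c * x) c.
  by move=> _; apply: is_derive_eq; rewrite /GRing.scale/=; ring.
have H4 (x : R) : 0 < x -> {for x, continuous (cst c)}.
  by move=> _; exact: cst_continuous.
have H5 (x : R) : 0 < x -> 0 < cst c x by [].
exact: (ge0_subst_oy H1 H2 H3 H4 H5 mf f0).
Qed.

Lemma ge0_integral_scale_oo (c b : R) : 0 < c -> 0 < b ->
  (\int[mu]_(y in `]0%R, (c * b)%R[) f y = \int[mu]_(x in `]0%R, b[) (f (c * x)%R * c%:E))%E.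
Proof.
move=> c0 b0.
have H1 (x : R) : 0 < x < b -> 0 < c * x < c * b.
  by move=> /andP[x0 xb]; rewrite mulr_gt0// ltr_pM2l.
have H2 (y : R) : 0 < y < c * b -> 0 < c^-1 * y < b /\ c * (c^-1 * y) = y.
  move=> /andP[y0 yb]; rewrite mulr_gt0 ?invr_gt0// mulVKf ?gt_eqF//=.
  by rewrite mulrC ltr_pdivrMr// mulrC.
have H3 (x : R) : 0 < x < b -> is_derive x 1 (fun x : R => c * x) c.
  by move=> _; apply: is_derive_eq; rewrite /GRing.scale/=; ring.
have H4 (x : R) : 0 < x < b -> {for x, continuous (cst c)}.
  by move=> _; exact: cst_continuous.
have H5 (x : R) : 0 < x < b -> 0 < cst c x by [].
exact: (ge0_subst_oo b0 H1 H2 H3 H4 H5 mf f0).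
Qed.

Lemma ge0_integral_oppr (D : set R) : measurable D ->
  (\int[mu]_(x in D) f x = \int[mu]_(x in -%R @^-1` D) f (- x)%R)%E.
Proof.
move=> mD.
have mN : measurable_fun setT (-%R : measurableTypeR R -> measurableTypeR R).
  exact: oppr_measurable.
rewrite -(@ge0_integral_pushforward _ _ _ _ R _ mN mu D f)//; last exact: measurable_funTS.
apply: eq_measure_integral => A mA _; exact/esym/lebesgue_measureN.
Qed.

End affine_subst.

Lemma ge0_integral_reflect (R : realType) (f : R -> \bar R) (c : R) :
  measurable_fun setT f -> (forall x, 0 <= f x)%E -> 0 < c ->
  (\int[@lebesgue_measure R]_(x in `]0%R, c[) f (c - x)%R =
   \int[@lebesgue_measure R]_(x in `]0%R, c[) f x)%E.
Proof.
move=> mf f0 c0; have Nc : - c < 0 by rewrite oppr_lt0.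
have := ge0_integral_shift_oo mf f0 c Nc; rewrite addNr add0r => ->.
have mfc : measurable_fun setT (fun x : R => f (x + c)).
  by apply: (measurableT_comp mf); mfun.
have mD : measurable (`]- c, 0%R[%classic : set R) by exact: measurable_itv.
rewrite (ge0_integral_oppr mfc _ mD)//.
rewrite (_ : -%R @^-1` _ = `]0%R, c[%classic).
  by apply: eq_integral => x _; rewrite addrC.
apply/seteqP; split => x /=; rewrite !in_itv/= => /andP[? ?]; apply/andP; split; lra.
Qed.

Section beta.
Context {R : realType}.
Local Notation mu := (@lebesgue_measure R).

Definition betaE (a b : R) : \bar R :=
  (\int[mu]_(u in `]0%R, 1%R[) (u `^ (a - 1) * (1 - u) `^ (b - 1))%:E)%E.

(** The product of the two integrals is an integral over the quadrant; put
    [z = x + y], then [x = z u]. *)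
Lemma gammaE_mul (a b : R) : 0 < a -> 0 < b ->
  (gammaE a * gammaE b = gammaE (a + b) * betaE a b)%E.
Proof.
move=> a0 b0; have P0 (x y : R) : 0 <= x `^ y by exact: powR_ge0.
pose f (z : R * R) := (z.1 `^ (a - 1) * (z.2 - z.1) `^ (b - 1) * expR (- z.2))%:E.
have mf : measurable_fun setT f by rewrite /f; mfun.
have f0 z : (0 <= f z)%E by rewrite lee_fin !mulr_ge0 ?expR_ge0.
transitivity (\int[mu]_(x in `]0%R, +oo[) \int[mu]_(z in `]x, +oo[) f (x, z))%E.
  have gb : gammaE b \is a fin_num by rewrite ge0_fin_numE ?gammaE_fin ?gammaE_ge0.
  rewrite -(fineK gb) muleC -ge0_integralMl; last 4 first.
  - exact: measurable_itv.
  - by apply: measurable_funTS; mfun.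
  - by move=> x _; rewrite mulr_ge0 ?expR_ge0.
  - by rewrite fine_ge0// gammaE_ge0.
  apply: eq_integral => x; rewrite inE/= in_itv/= andbT => x0.
  rewrite mulrC EFinM fineK// /gammaE -ge0_integralMl; last 4 first.
  - exact: measurable_itv.
  - by apply: measurable_funTS; mfun.
  - by move=> y _; rewrite mulr_ge0 ?expR_ge0.
  - by rewrite mulr_ge0 ?expR_ge0.
  rewrite (ge0_integral_shift_oy _ _ x); last 2 first.
  - by mfun.
  - by move=> y; rewrite lee_fin !mulr_ge0 ?expR_ge0.
  apply: eq_integral => z _; rewrite /f/=; congr EFin.
  rewrite mulrACA -expRD; congr (_ * expR _); ring.
rewrite ge0_integral_triangle// /gammaE.
rewrite -ge0_integralZr//=; last 3 first.
- by apply: measurable_funTS; mfun.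
- by move=> x _; rewrite lee_fin mulr_ge0 ?expR_ge0.
- by apply: integral_ge0 => u _; rewrite lee_fin mulr_ge0.
apply: eq_integral => z; rewrite inE/= in_itv/= andbT => z0.
rewrite -[X in `]0%R, X[](mulr1 z) (ge0_integral_scale_oo _ _ z0 ltr01)//; last first.
  exact: (measurableT_comp mf (pair2_measurable z)).
rewrite /betaE -ge0_integralMl; last 4 first.
- exact: measurable_itv.
- by apply: measurable_funTS; mfun.
- by move=> x _; rewrite mulr_ge0.
- by rewrite mulr_ge0 ?expR_ge0.
apply: eq_integral => u; rewrite inE/= in_itv/= => /andP[u0 u1].
rewrite /f/= -EFinM; congr EFin.
have zz : z `^ (a + b - 1) = z `^ (a - 1) * z `^ (b - 1) * z.
  rewrite -{4}(powRr1 (ltW z0)) -!powRD ?(gt_eqF z0) ?implybT//.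
  congr (_ `^ _); ring.
rewrite zz powRM ?(ltW z0) ?(ltW u0)// -{2}(mulr1 z) -mulrBr powRM ?(ltW z0) ?subr_ge0 ?(ltW u1)//.
ring.
Qed.

Definition sincosE (a b : R) : \bar R :=
  (\int[mu]_(x in `]0%R, (pi / 2)%R[) (sin x `^ a * cos x `^ b)%:E)%E.

(** Substitute [u = sin^2 x]. *)
Lemma betaE_sincos (a b : R) : betaE a b = (2%:E * sincosE (2 * a - 1) (2 * b - 1))%E.
Proof.
have pi2 : 0 < pi / 2 :> R by rewrite divr_gt0// pi_gt0.
have S x : 0 < x < pi / 2 -> 0 < sin x :> R by exact: sin_gt0_pihalf.
have C x : 0 < x < pi / 2 -> 0 < cos x :> R.
  by move=> /andP[x0 x1]; apply: cos_gt0_pihalf; rewrite x1 andbT; lra.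
have H1 (x : R) : 0 < x < pi / 2 -> 0 < sin x ^+ 2 < 1.
  move=> xx; rewrite exprn_gt0 ?S//= sin2cos2 ltrBlDr ltrDl exprn_gt0//; exact: C.
have H2 (y : R) : 0 < y < 1 -> 0 < asin (Num.sqrt y) < pi / 2 /\
    sin (asin (Num.sqrt y)) ^+ 2 = y.
  move=> /andP[y0 y1].
  have sy : -1 <= Num.sqrt y <= 1.
    rewrite (le_trans _ (sqrtr_ge0 _))//= -sqrtr1 ler_wsqrtr// ltW//.
  have E : sin (asin (Num.sqrt y)) = Num.sqrt y by apply: asinK.
  rewrite E sqr_sqrtr ?ltW//; split => //.
  have sy1 : Num.sqrt y < 1 by rewrite -sqrtr1 ltr_sqrt.
  rewrite asin_ltpi2 ?andbT; last by case/andP: sy => ->.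
  rewrite ltNge; apply/negP => h; have : 0 < Num.sqrt y by rewrite sqrtr_gt0.
  rewrite -E -oppr_lt0 -sinN ltNge sin_ge0_pi// oppr_ge0 h/=.
  have [/andP[h1 _] _] := asin_def sy; have := @pi_gt0 R; lra.
have H3 (x : R) : 0 < x < pi / 2 -> is_derive x 1 (fun x : R => sin x ^+ 2) (2 * (sin x * cos x)).
  by move=> _; apply: is_derive_eq; rewrite /GRing.scale/=; ring.
have H4 (x : R) : 0 < x < pi / 2 -> {for x, continuous (fun x => 2 * (sin x * cos x))}.
  move=> _; apply: continuousM; first exact: cst_continuous.
  by apply: continuousM; [exact: continuous_sin|exact: continuous_cos].
have H5 (x : R) : 0 < x < pi / 2 -> 0 < 2 * (sin x * cos x).
  by move=> xx; rewrite !mulr_gt0 ?S ?C.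
rewrite /betaE (ge0_subst_oo pi2 H1 H2 H3 H4 H5); last 2 first.
- by mfun.
- by move=> x; rewrite lee_fin mulr_ge0 ?powR_ge0.
rewrite /sincosE -ge0_integralMl; last 4 first.
- exact: measurable_itv.
- by apply: measurable_funTS; mfun.
- by move=> x _; rewrite mulr_ge0 ?powR_ge0.
- by [].
apply: eq_integral => x; rewrite inE/= in_itv/= => xx.
rewrite -EFinM; congr EFin; rewrite -cos2sin2.
have P (y c : R) : 0 < y -> (y ^+ 2) `^ (c - 1) * y = y `^ (2 * c - 1).
  move=> y0; rewrite -powR_mulrn ?(ltW y0)// -powRrM -{2}(powRr1 (ltW y0)).
  rewrite -powRD ?(gt_eqF y0) ?implybT//; congr (_ `^ _); ring.
rewrite -(P _ a (S x xx)) -(P _ b (C x xx)); ring.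
Qed.

End beta.

Section angular_moments.
Context {R : realType}.
Local Notation mu := (@lebesgue_measure R).

Lemma ge0_integral_sym_0pi (f : R -> \bar R) :
  measurable_fun setT f -> (forall x, 0 <= f x)%E ->
  (forall x, f (pi - x) = f x) ->
  (\int[mu]_(x in `]0%R, pi[) f x = 2%:E * \int[mu]_(x in `]0%R, (pi / 2)%R[) f x)%E.
Proof.
move=> mf f0 fsym; have pi0 := @pi_gt0 R; have pi2 : 0 < pi / 2 :> R by lra.
have E : `]0%R, pi[%classic = `]0, pi / 2[ `|` `[pi / 2, pi[ :> set R.
  apply/seteqP; split => x /=; rewrite !in_itv/=; last first.
    by move=> [|] /andP[? ?]; apply/andP; split; lra.
  by case/andP => ? ?; case: (ltP x (pi / 2)) => ?; [left|right]; apply/andP; split.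
rewrite E ge0_integral_setU//; last 2 first.
- exact: measurable_funTS.
- rewrite disj_set2E; apply/eqP/seteqP; split => x //=; rewrite !in_itv/=.
  by case=> /andP[_ h] /andP[]; rewrite leNgt h.
rewrite -[X in (_ + X)%E]integral_itv_obnd_cbnd; last exact: measurable_funTS.
have := ge0_integral_shift_oo mf f0 (pi / 2) pi2.
rewrite add0r -splitr => ->.
have mfr : measurable_fun setT (fun x : R => f (x + pi / 2)).
  by apply: (measurableT_comp mf); mfun.
rewrite -(ge0_integral_reflect mfr)//.
rewrite [X in (_ + X)%E](_ : _ = \int[mu]_(x in `]0%R, (pi / 2)%R[) f x)%E.
  by rewrite -mule2n -mule_natl.
apply: eq_integral => x _; rewrite -fsym; congr (f _); by field.
Qed.

(** The moments of the weight of the Bessel translation, in extended reals. *)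
Definition angular_moment (g : R) (m : nat) : \bar R :=
  (\int[mu]_(x in `]0%R, pi[) (cos x ^+ m * sin x `^ (2 * g))%:E)%E.

(** Symmetry about [pi / 2] makes the moment a beta integral. *)
Lemma angular_moment_even (g : R) (k : nat) : -1/2 < g ->
  (gammaE (g + 1/2) * gammaE (k%:R + 1/2) = gammaE (g + k%:R + 1) * angular_moment g (2 * k))%E.
Proof.
move=> g0; have h1 : 0 < g + 1 / 2 by lra.
have h2 : 0 < k%:R + 1 / 2 :> R by rewrite ltr_wpDl.
have E : g + 1 / 2 + (k%:R + 1 / 2) = g + k%:R + 1 by field.
have M : angular_moment g (2 * k) = (2%:E * sincosE (2 * (g + 1 / 2) - 1) (2 * (k%:R + 1 / 2) - 1))%E.
  rewrite /angular_moment ge0_integral_sym_0pi.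
  - have -> // : (\int[mu]_(x in `]0%R, (pi / 2)%R[)
        (cos x ^+ (2 * k) * sin x `^ (2 * g))%:E)%E =
      sincosE (2 * (g + 1 / 2) - 1) (2 * (k%:R + 1 / 2) - 1).
    apply: eq_integral => x; rewrite inE/= in_itv/= => /andP[x0 x1].
    have c0 : 0 < cos x by apply: cos_gt0_pihalf; rewrite x1 andbT; lra.
    have -> : 2 * (k%:R + 1 / 2) - 1 = (2 * k)%:R :> R by rewrite natrM; field.
    have -> : 2 * (g + 1 / 2) - 1 = 2 * g by field.
    by rewrite powR_mulrn ?(ltW c0)// mulrC.
  - by mfun.
  - by move=> x; rewrite lee_fin mulr_ge0 ?powR_ge0// exprM exprn_ge0 ?sqr_ge0.
  - move=> x; have -> : sin (pi - x) = sin x by rewrite sinB sinpi cospi; ring.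
    have -> // : cos (pi - x) ^+ (2 * k) = cos x ^+ (2 * k).
    by rewrite cosB sinpi cospi !exprM; congr (_ ^+ _); ring.
by rewrite M -betaE_sincos -E; exact: gammaE_mul.
Qed.

Lemma momE0_fin (g : R) : -1/2 < g -> (angular_moment g 0 < +oo)%E.
Proof.
move=> g0; have := angular_moment_even 0 g0; rewrite muln0 mulr0n.
have h1 : (0 < gammaE (g + 0%:R + 1))%E by apply: gammaE_gt0; rewrite addr0; lra.
move=> E; rewrite ltey; apply/eqP => M; move: E; rewrite M gt0_muley// => E.
have : (gammaE (g + 1 / 2) * gammaE (0 + 1 / 2) < +oo)%E.
  by rewrite lte_mul_pinfty ?gammaE_ge0 ?ge0_fin_numE ?gammaE_fin ?gammaE_ge0//; lra.
by rewrite E.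
Qed.

End angular_moments.

Section pochhammer.
Context {R : realType}.

(** The rising factorial [c (c + 1) ... (c + k - 1)]. *)
Definition poch (c : R) (k : nat) : R := \prod_(i < k) (c + i%:R).

Lemma poch0 c : poch c 0 = 1. Proof. by rewrite /poch big_ord0. Qed.

Lemma pochS c k : poch c k.+1 = poch c k * (c + k%:R).
Proof. by rewrite /poch big_ord_recr. Qed.

Lemma poch_gt0 c k : 0 < c -> 0 < poch c k.
Proof. by move=> c0; apply: prodr_gt0 => i _; rewrite ltr_wpDr. Qed.

Lemma pochSl c k : poch c k.+1 = c * poch (c + 1) k.
Proof.
rewrite /poch big_ord_recl addr0; congr (_ * _); apply: eq_bigr => i _.
by rewrite lift0 -natr1; ring.
Qed.

Lemma Gamma_poch c k : 0 < c -> Gamma (c + k%:R) = poch c k * Gamma c.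
Proof.
move=> c0; elim: k => [|k IH]; first by rewrite addr0 poch0 mul1r.
have ck : 0 < c + k%:R by rewrite ltr_wpDr.
by rewrite -natr1 addrA (Gamma_rec ck) IH pochS mulrA (mulrC (c + _)).
Qed.

Lemma poch_fact k : poch 1 k = k`!%:R.
Proof.
elim: k => [|k IH]; first by rewrite poch0.
by rewrite pochS IH factS natrM mulrC -natr1 addrC.
Qed.

(** Duplication: the odd factors of [(2k)!] make [poch (1/2) k], up to powers of 2. *)
Lemma poch_half k : poch (1 / 2) k * 4 ^+ k * k`!%:R = (2 * k)`!%:R.
Proof.
elim: k => [|k IH]; first by rewrite poch0 !mul1r.
rewrite pochS exprS factS natrM (_ : (2 * k.+1 = (2 * k).+2)%N); last by rewrite mulnS.
rewrite !factS !natrM -IH -!natr1 natrM; by field.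
Qed.

Lemma Gamma1 : Gamma (1 : R) = 1.
Proof.
apply: EFin_inj; rewrite GammaE// /gammaE subrr.
under eq_integral do rewrite powRr0 mul1r.
by rewrite integral_expRN oppr0 expR0.
Qed.

(** Substitute [t = x^2]. *)
Lemma gammaE_sq (s : R) : gammaE s =
  (2%:E * \int[lebesgue_measure]_(x in `]0%R, +oo[)
    (x `^ (2 * s - 1) * expR (- x ^+ 2))%:E)%E.
Proof.
rewrite /gammaE.
have H1 (x : R) : 0 < x -> 0 < x ^+ 2 by move=> x0; rewrite exprn_gt0.
have H2 (y : R) : 0 < y -> 0 < Num.sqrt y /\ Num.sqrt y ^+ 2 = y.
  by move=> y0; rewrite sqrtr_gt0 sqr_sqrtr ?ltW.
have H3 (x : R) : 0 < x -> is_derive x 1 (fun x : R => x ^+ 2) (2 * x).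
  by move=> _; apply: is_derive_eq; rewrite /GRing.scale/=; ring.
have H4 (x : R) : 0 < x -> {for x, continuous (fun x : R => 2 * x)}.
  by move=> _; apply: continuousM; [exact: cst_continuous|].
have H5 (x : R) : 0 < x -> 0 < 2 * x by move=> x0; rewrite mulr_gt0.
rewrite (ge0_subst_oy H1 H2 H3 H4 H5); last 2 first.
- by mfun.
- by move=> x; rewrite lee_fin mulr_ge0 ?powR_ge0 ?expR_ge0.
rewrite -ge0_integralMl; last 4 first.
- exact: measurable_itv.
- by apply: measurable_funTS; mfun.
- by move=> x _; rewrite mulr_ge0 ?powR_ge0 ?expR_ge0.
- by [].
apply: eq_integral => x; rewrite inE/= in_itv/= andbT => x0.
rewrite -EFinM; congr EFin.
have -> : x `^ (2 * s - 1) = (x ^+ 2) `^ (s - 1) * x.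
  rewrite -powR_mulrn ?(ltW x0)// -powRrM -{3}(powRr1 (ltW x0)).
  rewrite -powRD ?(gt_eqF x0) ?implybT//; congr (_ `^ _); ring.
ring.
Qed.

Lemma Gamma_half : Gamma (1 / 2 : R) = Num.sqrt pi.
Proof.
have h : 0 < 1 / 2 :> R by [].
apply: EFin_inj; rewrite GammaE// gammaE_sq.
transitivity (2%:E * \int[@lebesgue_measure R]_(x in `]0%R, +oo[) (gauss_fun (x : R))%:E)%E.
  have -> : 2 * (1 / 2) - 1 = 0 :> R by field.
  by under eq_integral do rewrite powRr0 mul1r.
rewrite integral_itv_obnd_cbnd; last first.
  by apply/measurable_EFinP/measurable_funTS; exact: measurable_gauss_fun.
by rewrite integral0y_gauss -EFinM mulrC divfK.
Qed.

End pochhammer.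

Section moments.
Context {R : realType}.
Local Notation mu := (@lebesgue_measure R).
Variable g : R.
Hypothesis g0 : -1 / 2 < g.

(** The factor that makes [sin^(2g)] a probability density on [[0, pi]]; it is the
    constant in [translation1]. *)
Definition angular_cst : R := Gamma (g + 1) / (Num.sqrt pi * Gamma (g + 1 / 2)).

Let g1 : 0 < g + 1. Proof. by have := g0; lra. Qed.
Let gh : 0 < g + 1 / 2. Proof. by have := g0; lra. Qed.

Lemma angular_cst_gt0 : 0 < angular_cst.
Proof. by rewrite divr_gt0 ?mulr_gt0 ?Gamma_gt0 ?sqrtr_gt0 ?pi_gt0. Qed.

Lemma integral_0pi_oo (f : R -> R) : measurable_fun setT f ->
  (\int[mu]_(x in `[0%R, pi]) (f x)%:E = \int[mu]_(x in `]0%R, pi[) (f x)%:E)%E.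
Proof.
move=> mf; rewrite integral_itv_bndoo//.
exact/measurable_EFinP/measurable_funTS.
Qed.

Lemma integrable_sin : mu.-integrable `[0%R, pi] (fun x => (sin x `^ (2 * g))%:E).
Proof.
apply/integrableP; split; first by apply: measurable_funTS; mfun.
under eq_integral do rewrite gee0_abs ?lee_fin ?powR_ge0//.
rewrite integral_0pi_oo; last by mfun.
have := momE0_fin g0; rewrite /angular_moment.
by under eq_integral do rewrite expr0 mul1r.
Qed.

Lemma integrable_bnd_sin (f : R -> R) (M : R) : measurable_fun setT f ->
  (forall x, `|f x| <= M) ->
  mu.-integrable `[0%R, pi] (fun x => (f x * sin x `^ (2 * g))%:E).
Proof.
move=> mf fM; have M0 : 0 <= M by exact: le_trans (fM 0).
have mI : measurable (`[0, pi]%classic : set (measurableTypeR R)) by exact: measurable_itv.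
have := integrableZl mI M integrable_sin.
apply: le_integrable => //.
  by apply: measurable_funTS; mfun.
move=> x _; rewrite /= lee_fin !normrM ler_wpM2r// (le_trans (fM x))//.
exact: ler_norm.
Qed.

Let moment_algebra (A B Q S P I : R) : 0 < A -> 0 < B -> 0 < Q -> 0 < S ->
  B * (P * S) = Q * A * I -> A / (S * B) * I = P / Q.
Proof.
move=> A0 B0 Q0 S0 h; have -> : I = B * (P * S) / (Q * A).
  by rewrite h; field; rewrite !gt_eqF.
by field; rewrite !gt_eqF.
Qed.

Lemma moment_even (k : nat) :
  angular_cst * \int[mu]_(x in `[0%R, pi]) (cos x ^+ (2 * k) * sin x `^ (2 * g)) =
  poch (1 / 2) k / poch (g + 1) k.
Proof.
set I := Rintegral _ _ _.
have EI : I%:E = angular_moment g (2 * k).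
  rewrite /I /angular_moment -integral_0pi_oo; last by mfun.
  rewrite fineK//; apply: integrable_fin_num => //.
  apply: (@integrable_bnd_sin _ 1) => //; first by mfun.
  by move=> x; rewrite normrX exprn_ile1// ler_norml cos_geN1 cos_le1.
have := angular_moment_even k g0; rewrite -EI -!GammaE//; last first.
  by rewrite addrAC ltr_wpDr.
rewrite -!EFinM => -[]; rewrite (_ : g + k%:R + 1 = g + 1 + k%:R); last by ring.
rewrite (addrC k%:R) !Gamma_poch// Gamma_half /angular_cst => h.
have S0 : 0 < Num.sqrt pi :> R by rewrite sqrtr_gt0 pi_gt0.
exact: (moment_algebra (Gamma_gt0 g1) (Gamma_gt0 gh) (poch_gt0 k g1) S0 h).
Qed.

(** [cos] changes sign under reflection about [pi / 2], [sin] does not. *)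
Lemma moment_odd (k : nat) : odd k ->
  \int[mu]_(x in `[0%R, pi]) (cos x ^+ k * sin x `^ (2 * g)) = 0.
Proof.
move=> ok; rewrite /Rintegral integral_0pi_oo; last by mfun.
rewrite integralE.
set f := (fun x => (cos x ^+ k * sin x `^ (2 * g))%:E).
have mf : measurable_fun setT f by rewrite /f; mfun.
rewrite -(@ge0_integral_reflect _ (f^\+)%E pi)//; last 2 first.
- exact: measurable_funepos.
- exact: pi_gt0.
have -> : (\int[mu]_(x in `]0%R, pi[) (f^\+)%E (pi - x)%R = \int[mu]_(x in `]0%R, pi[) f^\- x)%E.
  apply: eq_integral => x _; rewrite funeposE funenegE; congr maxe.
  rewrite /f -EFinN -mulNr; congr (_ * _ `^ _)%:E; last first.
    by rewrite sinB sinpi cospi; ring.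
  by rewrite cosB sinpi cospi mul0r addr0 mulN1r exprNn -signr_odd ok expr1 mulN1r.
have [->|] := eqVneq (\int[mu]_(x in `]0%R, pi[) f^\- x)%E +oo%E; first by [].
by move=> h; rewrite subee// ge0_fin_numE ?ltey//; exact: integral_ge0.
Qed.

Lemma angular_cst_mass : angular_cst * \int[mu]_(x in `[0%R, pi]) (sin x `^ (2 * g)) = 1.
Proof.
have := moment_even 0; rewrite muln0 !poch0 divr1 => E; rewrite -[RHS]E; congr (_ * _).
by apply: eq_Rintegral => x _; rewrite expr0 mul1r.
Qed.

End moments.

(** * The Bessel function as a power series *)

Section bessel_series.
Context {R : realType}.
Variable g : R.
Hypothesis g0 : -1 / 2 < g.
Let g1 : 0 < g + 1. Proof. by have := g0; lra. Qed.

(** The [k]-th term of the series of [bessel_j], with rising factorials in place of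
    the quotients of Gamma functions. *)
Definition bessel_term (z : R) (k : nat) : R :=
  (-1) ^+ k * (z / 2) ^+ (2 * k) / (k`!%:R * poch (g + 1) k).

Lemma bessel_jE z : bessel_j g z = limn (series (bessel_term z)).
Proof.
rewrite /bessel_j; congr (limn (series _)); apply/funext => k.
have -> : k%:R + g + 1 = (g + 1) + k%:R by ring.
rewrite (Gamma_poch k g1) (addrC k%:R) (Gamma_poch k (ltr01 : 0 < (1 : R))).
rewrite Gamma1 mulr1 poch_fact /bessel_term.
move: (Gamma (g + 1)) (Gamma_gt0 g1) (poch_gt0 k g1) => G G0.
move: (poch _ _) => P P0; field.
by rewrite !gt_eqF//= pnatr_eq0 -lt0n fact_gt0.
Qed.

Lemma poch_le (c d : R) k : 0 < c -> c <= d -> poch c k <= poch d k.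
Proof.
move=> c0 cd; apply: ler_prod => i _.
by rewrite lerD2r cd andbT addr_ge0// ltW.
Qed.

(** Since [g + 1 >= 1/2], the terms are bounded by those at [g = -1/2], which are
    those of the series of [cosh]. *)
Lemma bessel_term_le z k : `|bessel_term z k| <= `|z| ^+ (2 * k) / (2 * k)`!%:R.
Proof.
rewrite /bessel_term normrM normrM normrX normrN1 expr1n mul1r normrX normrM.
have f0 : 0 < k`!%:R :> R by rewrite ltr0n fact_gt0.
have F0 : 0 < (2 * k)`!%:R :> R by rewrite ltr0n fact_gt0.
have P0 := poch_gt0 k g1.
rewrite (_ : `|2^-1| = 2^-1 :> R); last by rewrite ger0_norm.
rewrite expr_div_n -mulrA ler_wpM2l ?exprn_ge0//.
rewrite [X in _ * X]ger0_norm; last by rewrite invr_ge0 mulr_ge0// ltW.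
rewrite -invfM.
rewrite lef_pV2 ?posrE// ?mulr_gt0 ?exprn_gt0//.
rewrite -poch_half exprM (_ : 2 ^+ 2 = 4 :> R); last by ring.
rewrite [leRHS](_ : _ = poch (g + 1) k * (4 ^+ k * k`!%:R)); last by ring.
rewrite -mulrA; apply: ler_wpM2r.
  by rewrite mulr_ge0 ?exprn_ge0.
by apply: poch_le => //; have := g0; lra.
Qed.

Lemma even_exp_sum_le (x : R) n : 0 <= x ->
  \sum_(0 <= k < n) x ^+ (2 * k) / (2 * k)`!%:R <= expR x.
Proof.
move=> x0; apply: (@le_trans _ _ (series (exp_coeff x) (2 * n)%N)).
  rewrite /series/=; elim: n => [|n IH]; first by rewrite !big_geq.
  rewrite mulnS big_nat_recr//= 2?big_nat_recr//= -addrA lerD//.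
  by rewrite /exp_coeff/= lerDl divr_ge0 ?exprn_ge0.
apply: nondecreasing_cvgn_le; last exact: is_cvg_series_exp_coeff.
by apply: nondecreasing_series => i _ _; exact: exp_coeff_ge0.
Qed.

Lemma bessel_term_psum_le z n : \sum_(0 <= k < n) `|bessel_term z k| <= expR `|z|.
Proof.
apply: (le_trans _ (even_exp_sum_le n (normr_ge0 z))).
by apply: ler_sum => k _; exact: bessel_term_le.
Qed.

Lemma is_cvg_bessel_term z : cvgn (series (bessel_term z)).
Proof.
apply: normed_cvg; apply: nondecreasing_is_cvgn.
  by apply: nondecreasing_series => k _ _; exact: normr_ge0.
by exists (expR `|z|) => _ [n _ <-]; exact: bessel_term_psum_le.
Qed.

Lemma cvg_bessel_term z : series (bessel_term z) @ \oo --> bessel_j g z.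
Proof. by rewrite bessel_jE; exact: is_cvg_bessel_term. Qed.

(** For [k >= m] one has [|z|^(2k) <= 16^(-m) (4|z|)^(2k)]: the geometric gain is
    paid by dilating the argument of the exponential series. *)
Lemma bessel_term_tail_sum z m n : (m <= n)%N ->
  \sum_(m <= k < n) `|bessel_term z k| <= 16^-1 ^+ m * expR (4 * `|z|).
Proof.
move=> mn; have i0 : 0 <= 16^-1 :> R by [].
apply: (@le_trans _ _ (\sum_(m <= k < n) 16^-1 ^+ m * ((4 * `|z|) ^+ (2 * k) / (2 * k)`!%:R))).
  rewrite !big_nat; apply: ler_sum => k /andP[mk _].
  apply: (le_trans (bessel_term_le z k)); rewrite exprMn !mulrA ler_wpM2r//.
  rewrite -[leLHS]mul1r ler_wpM2r ?exprn_ge0// exprM (_ : 4 ^+ 2 = 16 :> R); last by ring.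
  rewrite -(subnK mk) exprD mulrCA -exprMn mulVf// expr1n mulr1.
  by apply: exprn_ege1; rewrite ler1n.
rewrite -mulr_sumr ler_wpM2l ?exprn_ge0//.
apply: (le_trans _ (even_exp_sum_le n (mulr_ge0 (ler0n R 4) (normr_ge0 z)))).
rewrite [leRHS](big_cat_nat (leq0n m) mn)/= lerDr.
by apply: sumr_ge0 => k _; rewrite divr_ge0 ?exprn_ge0 ?mulr_ge0.
Qed.

Lemma bessel_term_le_geo z k : `|bessel_term z k| <= 16^-1 ^+ k * expR (4 * `|z|).
Proof. by have := bessel_term_tail_sum z (leqnSn k); rewrite big_nat1. Qed.

(** The quantitative form of the entireness of [bessel_j].  Any geometric ratio is
    available; [16^-1] leaves [4^-1] per degree, as the [n]-th partial sum has degree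
    [2n - 2]. *)
Lemma bessel_term_tail z n :
  `|bessel_j g z - series (bessel_term z) n| <= 16^-1 ^+ n * expR (4 * `|z|).
Proof.
have h : (fun m => `|series (bessel_term z) m - series (bessel_term z) n|) @ \oo -->
    `|bessel_j g z - series (bessel_term z) n|.
  by apply: cvg_norm; apply: cvgB; [exact: cvg_bessel_term|exact: cvg_cst].
rewrite -(cvg_lim _ h)//; apply: limr_le; first by apply/cvg_ex; eexists; exact: h.
exists n => // m /= nm; rewrite sub_series_geq//.
by apply: (le_trans (ler_norm_sum _ _ _)); exact: bessel_term_tail_sum.
Qed.

Lemma series_bessel_term_le z n : `|series (bessel_term z) n| <= expR `|z|.
Proof. by apply: (le_trans (ler_norm_sum _ _ _)); exact: bessel_term_psum_le. Qed.

Lemma measurable_bessel_term k : measurable_fun setT (fun z => bessel_term z k).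
Proof. by rewrite /bessel_term; mfun. Qed.

Lemma measurable_bessel_j : measurable_fun setT (bessel_j g).
Proof.
apply: (@measurable_fun_cvg _ _ _ setT (fun n z => series (bessel_term z) n)) => //.
  by move=> n; rewrite /series/=; apply: measurable_sum => k; exact: measurable_bessel_term.
by move=> z _; exact: cvg_bessel_term.
Qed.

End bessel_series.

Section Rintegral_series.
Context d (T : measurableType d) (R : realType).
Variables (mu : {measure set T -> \bar R}) (D : set T) (mD : measurable D).
Variables (c : nat -> T -> R) (S H : T -> R).
Hypothesis mc : forall k, measurable_fun D (c k).
Hypothesis cS : forall x, D x -> series (fun k => c k x) @ \oo --> S x.
Hypothesis cH : forall x n, D x -> `|series (fun k => c k x) n| <= H x.
Hypothesis iH : mu.-integrable D (EFin \o H).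

Let ms n : measurable_fun D (fun x => series (fun k => c k x) n).
Proof. by rewrite /series/=; apply: measurable_sum => k; exact: mc. Qed.

Lemma integrable_term k : mu.-integrable D (EFin \o c k).
Proof.
have := integrableZl mD 2 iH; apply: le_integrable => //.
  exact/measurable_EFinP.
move=> x Dx /=; rewrite lee_fin.
have -> : c k x = series (fun k => c k x) k.+1 - series (fun k => c k x) k.
  by rewrite seriesSB.
apply: (le_trans (ler_normB _ _)); rewrite normrM.
have h1 := cH k.+1 Dx; have h2 := cH k Dx.
have h3 : H x <= `|H x| := ler_norm _.
by rewrite normr_nat; lra.
Qed.

(** Termwise integration, by dominated convergence of the partial sums. *)
Lemma Rintegral_series :
  series (fun k => \int[mu]_(x in D) c k x) @ \oo --> \int[mu]_(x in D) S x.
Proof.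
have mS : measurable_fun D S.
  exact: (@measurable_fun_cvg _ _ _ D (fun n x => series (fun k => c k x) n)).
have mE n : measurable_fun D (fun x => (series (fun k => c k x) n)%:E).
  exact/measurable_EFinP.
have mSE : measurable_fun D (EFin \o S) by exact/measurable_EFinP.
have hcv : {ae mu, forall x, D x ->
    (fun n => (series (fun k => c k x) n)%:E) @ \oo --> (S x)%:E}.
  by apply: aeW => x Dx; apply: cvg_EFin; [exact: nearW|exact: cS].
have hH : {ae mu, forall x n, D x -> (`|(series (fun k => c k x) n)%:E| <= (H x)%:E)%E}.
  by apply: aeW => x n Dx; rewrite lee_fin; exact: cH.
have [iS _ h] := dominated_convergence mD mE mSE hcv iH hH.
move: h; rewrite -(fineK (integrable_fin_num mD iS)) => /fine_cvg.
set u := (X in X @ \oo --> _) => hu.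
rewrite (_ : series _ = u)//; apply/funext => n; rewrite /u /=.
elim: n => [|n IH].
  rewrite /series/= big_geq//; apply/esym; rewrite (_ : (fun x => _) = cst 0%E).
    by rewrite integral0.
  by apply/funext => x; rewrite big_geq.
rewrite seriesSr IH -[in RHS]/(Rintegral _ _ _).
transitivity (\int[mu]_(x in D) (series (fun k => c k x) n + c n x)).
  rewrite RintegralD//; last exact: integrable_term.
  apply: (@le_integrable _ _ _ mu D mD _ (EFin \o H)); [exact: mE| |exact: iH].
  move=> x Dx /=; rewrite lee_fin.
  by apply: (le_trans (cH n Dx)); exact: ler_norm.
by congr fine; apply: eq_integral => x _; rewrite seriesSr.
Qed.

End Rintegral_series.

(** The Cauchy product, for series whose terms and tails decay geometrically.  The
    partial sum of the product differs from [A B] through at most [n] products of a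
    term and a tail, each of size [r^n]; [4 r <= 1] absorbs the factor [n]. *)
Lemma series_cauchy_geo (R : realType) (a b : nat -> R) (A B M r : R) :
  0 <= r -> 4 * r <= 1 -> 
  (forall k, `|a k| <= r ^+ k * M) ->
  (forall n, `|B - series b n| <= r ^+ n * M) ->
  series a @ \oo --> A ->
  series (fun n => \sum_(i < n.+1) a i * b (n - i)%N) @ \oo --> A * B.
Proof.
move=> r0 r4 ha hb aA.
have M0 : 0 <= M by have := ha 0%N; rewrite expr0 mul1r; exact: le_trans.
have E n : series (fun n => \sum_(i < n.+1) a i * b (n - i)%N) n =
    \sum_(0 <= k < n) a k * series b (n - k)%N.
  elim: n => [|n IH]; first by rewrite /series/= !big_geq.
  rewrite seriesSr IH.
  have -> : \sum_(0 <= k < n.+1) a k * series b (n.+1 - k)%N =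
      \sum_(0 <= k < n.+1) (a k * series b (n - k)%N + a k * b (n - k)%N).
    rewrite !big_nat; apply: eq_bigr => k /andP[_ kn].
    by rewrite subSn// seriesSr mulrDr.
  rewrite big_split/=.
  congr (_ + _); last by rewrite big_mkord.
  rewrite big_nat_recr//= subnn (_ : series b 0%N = 0) ?mulr0 ?addr0//.
  by rewrite /series/= big_geq.
have lim1 : (fun n => series a n * B) @ \oo --> A * B.
  by apply: cvgM => //; exact: cvg_cst.
rewrite (_ : A * B = A * B - 0); last by rewrite subr0.
rewrite (_ : series _ = fun n => series a n * B -
   \sum_(0 <= k < n) a k * (B - series b (n - k)%N)); last first.
  apply/funext => n; rewrite E /series/= mulr_suml -sumrB.
  by apply: eq_bigr => k _; ring.
apply: cvgB => //.
apply/norm_cvg0P; apply: (@squeeze_cvgr _ _ _ _ (cst 0) (fun n => M * M * (1 / 2) ^+ n)).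
- near=> n; rewrite normr_ge0/=.
  apply: (le_trans (ler_norm_sum _ _ _)).
  apply: (@le_trans _ _ (\sum_(0 <= k < n) M * M * r ^+ n)).
    rewrite !big_nat; apply: ler_sum => k /andP[_ kn].
    rewrite normrM; apply: (le_trans (ler_pM (normr_ge0 _) (normr_ge0 _) (ha k) (hb (n - k)%N))).
    by rewrite mulrACA -exprD (subnKC (ltnW kn)) mulrC.
  rewrite sumr_const_nat subn0 -[_ *+ n]mulr_natr -mulrA.
  apply: ler_wpM2l; first by rewrite mulr_ge0.
  apply: (@le_trans _ _ (4^-1 ^+ n * 2 ^+ n)).
    apply: ler_pM; rewrite ?exprn_ge0//.
      by apply: lerXn2r; rewrite ?nnegrE//; lra.
    by rewrite -natrX ler_nat ltnW// ltn_expl.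
  by rewrite -exprMn (_ : 4^-1 * 2 = 1 / 2)//; field.
- exact: cvg_cst.
- rewrite -(mulr0 (M * M)); apply: cvgMr => //.
  apply: cvg_expr; rewrite ger0_norm//; lra.
Unshelve. all: by end_near. Qed.

(** * An expansion of Chu-Vandermonde type *)

Section chu_vandermonde.
Context {R : realType}.

Lemma sum_triangle (H : nat -> nat -> R) N :
  \sum_(0 <= n < N) \sum_(0 <= m < n.+1) H m (n - m)%N =
  \sum_(0 <= m < N) \sum_(0 <= i < N - m) H m i.
Proof.
elim: N => [|N IH]; first by rewrite !big_geq.
rewrite big_nat_recr//= IH.
have -> : \sum_(0 <= m < N.+1) \sum_(0 <= i < N.+1 - m) H m i =
   \sum_(0 <= m < N.+1) (\sum_(0 <= i < N - m) H m i + H m (N - m)%N).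
  by rewrite !big_nat; apply: eq_bigr => m /andP[_ mN]; rewrite subSn// big_nat_recr.
rewrite big_split/=; congr (_ + _).
by rewrite [RHS]big_nat_recr//= subnn [X in _ + X]big_geq// addr0.
Qed.

Lemma sum_even_odd (f : nat -> R) n :
  \sum_(0 <= l < 2 * n) f l = \sum_(0 <= m < n) (f (2 * m)%N + f (2 * m).+1).
Proof.
elim: n => [|n IH]; first by rewrite muln0 !big_geq.
rewrite mulnS add2n big_nat_recr//= big_nat_recr//= [RHS]big_nat_recr//= IH.
by rewrite addrA.
Qed.

(** The terminating hypergeometric sum 2F1(-i, -j; c; 1). *)
Definition vandermonde_sum (c : R) (i j : nat) : R :=
  \sum_(0 <= m < i.+1) ('C(i, m) * 'C(j, m) * m`!)%:R / poch c m.

(** Pascal's rule on ['C(i.+1, m)]; it lowers [i] at the cost of shifting [c]. *)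
Lemma vandermonde_sumS c i j : 0 < c ->
  vandermonde_sum c i.+1 j.+1 = vandermonde_sum c i j.+1 + j.+1%:R / c * vandermonde_sum (c + 1) i j.
Proof.
move=> c0; rewrite /vandermonde_sum big_nat_recl//.
have -> : \sum_(0 <= m < i.+1) ('C(i, m) * 'C(j.+1, m) * m`!)%:R / poch c m =
  ('C(i, 0) * 'C(j.+1, 0) * 0`!)%:R / poch c 0 +
  \sum_(0 <= m < i.+1) ('C(i, m.+1) * 'C(j.+1, m.+1) * m.+1`!)%:R / poch c m.+1.
  rewrite -(big_nat_recl _ _ (fun m => ('C(i, m) * 'C(j.+1, m) * m`!)%:R / poch c m))//.
  by rewrite [RHS]big_nat_recr//= (bin_small (ltnSn i)) !mul0n mul0r addr0.
rewrite -addrA; congr (_ + _).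
  by rewrite !bin0.
rewrite mulr_sumr -big_split/=; apply: eq_bigr => m _.
rewrite binS mulnDl mulnDl natrD mulrDl; congr (_ + _).
rewrite pochSl.
have E : ('C(i, m) * 'C(j.+1, m.+1) * m.+1`!)%N = (j.+1 * ('C(i, m) * 'C(j, m) * m`!))%N.
  have /= h := mul_bin_diag j.+1 m.
  rewrite factS (mulnC m.+1) mulnA -(mulnA _ _ m`!) (mulnC _ m`!) mulnA -mulnA.
  by rewrite (mulnC _ m.+1) -h; ring.
rewrite E natrM invfM; ring.
Qed.

(** The Chu-Vandermonde identity, by induction on [i] along the recurrence. *)
Lemma vandermonde_sumE c i j : 0 < c -> vandermonde_sum c i j = poch c (i + j) / (poch c i * poch c j).
Proof.
elim: i c j => [|i IH] c j c0.
  rewrite /vandermonde_sum big_nat1 !bin0 !poch0 add0n mul1r divr1 divff//.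
  by rewrite gt_eqF// poch_gt0.
case: j => [|j].
  rewrite /vandermonde_sum big_nat_recl// big1_seq ?addr0 => [|m _]; last first.
    by rewrite bin0n muln0 mul0n mul0r.
  by rewrite !bin0 !poch0 addn0 mulr1 divr1 divff// gt_eqF// poch_gt0.
rewrite vandermonde_sumS// !IH ?addr_gt0//.
have c1 : 0 < c + 1 by rewrite addr_gt0.
have P1 := poch_gt0 i c1. have P2 := poch_gt0 j c1.
have P3 := poch_gt0 i c0. have P4 := poch_gt0 j c0.
rewrite addSn addnS [poch c (i + j).+2]pochS [poch c (i + j).+1]pochSl.
have E1 : poch c i.+1 = c * poch (c + 1) i by rewrite pochSl.
have E2 : poch c i.+1 = poch c i * (c + i%:R) by rewrite pochS.
have E3 : poch c j.+1 = c * poch (c + 1) j by rewrite pochSl.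
rewrite E3 [poch c i.+1]E1.
have E4 : poch (c + 1) i = poch c i * (c + i%:R) / c.
  by rewrite -E2 E1; field; rewrite gt_eqF.
rewrite E4 -!natr1 natrD.
have ci : 0 < c + i%:R by rewrite ltr_wpDr.
by field; rewrite !gt_eqF.
Qed.

Lemma bin_factR (n m : nat) : (m <= n)%N ->
  'C(n, m)%:R = n`!%:R / (m`!%:R * (n - m)`!%:R) :> R.
Proof.
move=> mn; rewrite -(bin_fact mn) !natrM mulfK//.
Qed.

Lemma trinomial_coef (k i m : nat) : (i <= k)%N -> (m <= i)%N ->
  'C(k, 2 * m)%:R * 'C(k - 2 * m, i - m)%:R * (4 ^+ m * poch (1 / 2) m) =
  'C(k, i)%:R * ('C(i, m) * 'C(k - i, m) * m`!)%:R :> R.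
Proof.
move=> ik mi; have [mk|mk] := leqP m (k - i); last first.
  rewrite (bin_small mk) muln0 mul0n mulr0.
  have [h|h] := leqP (2 * m) k; last by rewrite (bin_small h) !mul0r.
  by rewrite (@bin_small (k - 2 * m)) ?mulr0 ?mul0r//; lia.
have h2 : (2 * m <= k)%N by lia.
rewrite (bin_factR h2) bin_factR; last lia.
rewrite !natrM (bin_factR ik) (bin_factR mi) (bin_factR mk).
have -> : (k - 2 * m - (i - m) = k - i - m)%N by lia.
rewrite -(@poch_half R m).
have F n : n`!%:R != 0 :> R by rewrite pnatr_eq0 -lt0n fact_gt0.
have P : poch (1 / 2) m != 0 :> R by rewrite gt_eqF// poch_gt0.
have Q : 4 ^+ m != 0 :> R by rewrite expf_neq0.
by field; rewrite !F P Q.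
Qed.

(** The left-hand side is the mean of [(x + y + 2 sqrt(x y) cos)^k] against the
    normalised weight [sin^(2g)], with [c = g + 1] and the moments inserted.
    Expanding [(x + y)^(k - 2m)] and collecting the powers of [x] leaves a
    Chu-Vandermonde sum for each coefficient. *)
Lemma trinomial_mean_expansion (c x y : R) (k : nat) : 0 < c ->
  \sum_(0 <= m < k.+1) 'C(k, 2 * m)%:R * (x + y) ^+ (k - 2 * m) * (4 * x * y) ^+ m
     * (poch (1 / 2) m / poch c m) =
  \sum_(0 <= i < k.+1) 'C(k, i)%:R * poch c k / (poch c i * poch c (k - i)) * x ^+ i * y ^+ (k - i).
Proof.
move=> c0.
pose H m i : R := 'C(k, 2 * m)%:R * 'C(k - 2 * m, i)%:R * x ^+ (i + m) * y ^+ (k - (i + m))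
   * (4 ^+ m * poch (1 / 2) m / poch c m).
transitivity (\sum_(0 <= m < k.+1) \sum_(0 <= i < k.+1 - m) H m i).
  rewrite !big_nat; apply: eq_bigr => m /andP[_ mk].
  have [h|h] := leqP (2 * m) k; last first.
    rewrite (bin_small h) !mul0r big1// => i _.
    by rewrite /H (bin_small h) !mul0r.
  have -> : \sum_(0 <= i < k.+1 - m) H m i = \sum_(0 <= i < (k - 2 * m).+1) H m i.
    rewrite (@big_cat_nat _ _ _ (k - 2 * m).+1)//=; last lia.
    rewrite [X in _ + X]big_nat [X in _ + X]big1 ?addr0// => i /andP[h1 _].
    by rewrite /H (@bin_small (k - 2 * m))// mulr0 !mul0r.
  rewrite addrC exprDn -(big_mkord xpredT (fun i => y ^+ (k - 2 * m - i) * x ^+ i *+ 'C(k - 2 * m, i))).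
  rewrite mulr_sumr !mulr_suml !big_nat; apply: eq_bigr => i /andP[_ ik].
  rewrite /H -[_ *+ 'C(_, _)]mulr_natr exprD !exprMn.
  have -> : (k - (i + m) = (k - 2 * m - i) + m)%N by lia.
  rewrite exprD; ring.
rewrite -sum_triangle !big_nat; apply: eq_bigr => i /andP[_ ik].
transitivity ('C(k, i)%:R * vandermonde_sum c i (k - i) * x ^+ i * y ^+ (k - i)); last first.
  rewrite vandermonde_sumE// subnKC//; ring.
rewrite /vandermonde_sum mulr_sumr !mulr_suml !big_nat; apply: eq_bigr => m /andP[_ mi].
rewrite /H subnK//.
have := @trinomial_coef k i m ik mi.
set A := 'C(k, 2 * m)%:R; set B := 'C(k - _, _)%:R => E.
transitivity ((A * B * (4 ^+ m * poch (1 / 2) m)) * x ^+ i * y ^+ (k - i) / poch c m); first by ring.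
by rewrite E; ring.
Qed.

End chu_vandermonde.

(** * The Hankel transform of the Gaussian *)

Lemma Rintegral_sum d (T : measurableType d) (R : realType)
    (mu : {measure set T -> \bar R}) (D : set T) (c : nat -> T -> R) (n : nat) :
  measurable D -> (forall k, mu.-integrable D (EFin \o c k)) ->
  \int[mu]_(x in D) (\sum_(0 <= k < n) c k x) = \sum_(0 <= k < n) \int[mu]_(x in D) c k x.
Proof.
move=> mD ic; elim: n => [|n IH].
  rewrite big_geq//; under eq_Rintegral do rewrite big_geq//.
  by rewrite /Rintegral integral0.
rewrite big_nat_recr//= -IH -RintegralD//.
  by apply: eq_Rintegral => x _; rewrite big_nat_recr.
have := @integrable_sum _ T R mu D mD _ (index_iota 0 n) xpredT (fun k => EFin \o c k) (fun k _ => ic k).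
by apply: eq_integrable => // x _ /=; rewrite sumEFin.
Qed.

Section weight.
Context {R : realType}.
Local Notation mu := (@lebesgue_measure R).
Variable g : R.
Hypothesis g0 : -1 / 2 < g.
Let g1 : 0 < g + 1. Proof. by have := g0; lra. Qed.

(** The weight of the orthonormal polynomials. *)
Definition gauss_weight (x : R) : R := expR (- x ^+ 2) * x `^ (2 * g + 1).

Lemma gauss_weight_ge0 x : 0 <= gauss_weight x. Proof. by rewrite mulr_ge0 ?expR_ge0 ?powR_ge0. Qed.

Lemma measurable_gauss_weight : measurable_fun setT gauss_weight. Proof. by rewrite /gauss_weight; mfun. Qed.

(** [x^p <= C e^x] and completing the square: the Gaussian absorbs every
    exponential. *)
Lemma gauss_weight_bound b : exists2 C, 0 < C & forall x, 0 < x -> expR (b * x) * gauss_weight x <= C * expR (- x).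
Proof.
have p0 : 0 <= 2 * g + 1 by have := g0; lra.
have [C C0 HC] := powR_le_expR p0 (ltr01 : 0 < (1 : R)).
exists (C * expR ((b + 2) ^+ 2 / 4)); first by rewrite mulr_gt0 ?expR_gt0.
move=> x x0; rewrite /gauss_weight mulrA -expRD.
apply: (le_trans (ler_wpM2l (expR_ge0 _) (HC x x0))).
rewrite mulrCA -expRD -mulrA -expRD ler_wpM2l ?(ltW C0)// ler_expR.
have : 0 <= (x - (b + 2) / 2) ^+ 2 by exact: sqr_ge0.
rewrite !expr2; nra.
Qed.

Let m0 : measurable (`]0, +oo[%classic : set (measurableTypeR R)).
Proof. exact: measurable_itv. Qed.

Lemma integrable_gauss_weight b : mu.-integrable `]0, +oo[ (fun x => (expR (b * x) * gauss_weight x)%:E).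
Proof.
have [C C0 HC] := gauss_weight_bound b.
have iE : mu.-integrable `]0, +oo[ (fun x => (C * expR (- x))%:E).
  apply/integrableP; split; first by apply: measurable_funTS; mfun.
  under eq_integral do rewrite gee0_abs ?lee_fin ?mulr_ge0 ?expR_ge0 ?(ltW C0)//.
  rewrite ge0_integralMl//; last 2 first.
  - by apply: measurable_funTS; mfun.
  - exact: ltW.
  by rewrite integral_expRN -EFinM ltry.
apply: le_integrable iE => //.
  by apply: measurable_funTS; rewrite /gauss_weight; mfun.
move=> x; rewrite /= in_itv/= andbT => x0; rewrite lee_fin !ger0_norm.
- exact: HC.
- by rewrite mulr_ge0 ?expR_ge0 ?(ltW C0).
- by rewrite mulr_ge0 ?expR_ge0 ?gauss_weight_ge0.
Qed.

Lemma integrable_bnd_gauss_weight (h : R -> R) (C b : R) : measurable_fun setT h ->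
  (forall x, 0 < x -> `|h x| <= C * expR (b * x)) ->
  mu.-integrable `]0, +oo[ (fun x => (h x * gauss_weight x)%:E).
Proof.
move=> mh hC; have := integrableZl m0 C (integrable_gauss_weight b).
apply: le_integrable => //.
  by apply: measurable_funTS; rewrite /gauss_weight; mfun.
move=> x; rewrite /= in_itv/= andbT => x0; rewrite lee_fin; move: (gauss_weight x) => W; rewrite mulrA.
rewrite [leLHS]normrM [leRHS]normrM; apply: ler_wpM2r => //.
by apply: (le_trans (hC x x0)); exact: ler_norm.
Qed.

Lemma integrable_expn_gauss_weight (n : nat) :
  mu.-integrable `]0, +oo[ (fun x => (x ^+ n * gauss_weight x)%:E).
Proof.
have [C C0 HC] := powR_le_expR (ler0n R n) (ltr01 : 0 < (1 : R)).
apply: (@integrable_bnd_gauss_weight _ C 1); first by mfun.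
by move=> x x0; rewrite ger0_norm ?exprn_ge0 ?(ltW x0)// -powR_mulrn ?(ltW x0)// HC.
Qed.

(** A Gamma integral after [t = x^2]. *)
Lemma moment_gauss_weight k : \int[mu]_(x in `]0, +oo[) (x ^+ (2 * k) * gauss_weight x) =
  poch (g + 1) k * Gamma (g + 1) / 2.
Proof.
have gk : 0 < g + 1 + k%:R by rewrite ltr_wpDr.
have := gammaE_sq (g + 1 + k%:R); rewrite -GammaE// (Gamma_poch k g1).
rewrite /Rintegral => h.
have -> : (\int[mu]_(x in `]0%R, +oo[) (x ^+ (2 * k) * gauss_weight x)%:E =
   \int[mu]_(x in `]0%R, +oo[) (x `^ (2 * (g + 1 + k%:R) - 1) * expR (- x ^+ 2))%:E)%E.
  apply: eq_integral => x; rewrite inE/= in_itv/= andbT => x0; congr EFin.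
  rewrite /gauss_weight mulrCA mulrC -powR_mulrn ?(ltW x0)// -powRD ?(gt_eqF x0) ?implybT//.
  by congr (_ `^ _ * _); rewrite natrM; ring.
move: h; set I := (\int[mu]_(x in _) _)%E => h.
have : I = (poch (g + 1) k * Gamma (g + 1) / 2)%:E.
  have I0 : (0 <= I)%E by apply: integral_ge0 => x _; rewrite lee_fin mulr_ge0 ?powR_ge0 ?expR_ge0.
  case: I I0 h => [r _ [->]| _ |//].
    by congr EFin; field.
  by rewrite mulry gtr0_sg// mul1e.
by move=> ->.
Qed.

(** Integrating the Bessel series termwise, the rising factorial in the moment
    cancels the one in the term and the exponential series of [-s^2/4] remains. *)
Lemma gauss_transform (s : R) :
  2 / Gamma (g + 1) * \int[mu]_(x in `]0, +oo[) (bessel_j g (s * x) * gauss_weight x) =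
  expR (- (s ^+ 2 / 4)).
Proof.
have G0 := Gamma_gt0 g1.
have h := @Rintegral_series _ _ R mu `]0, +oo[%classic m0
  (fun k x => bessel_term g (s * x) k * gauss_weight x) (fun x => bessel_j g (s * x) * gauss_weight x)
  (fun x => expR (`|s| * x) * gauss_weight x).
have {}h : series (fun k => \int[mu]_(x in `]0, +oo[) (bessel_term g (s * x) k * gauss_weight x)) @ \oo -->
   \int[mu]_(x in `]0, +oo[) (bessel_j g (s * x) * gauss_weight x).
  have E x n : series (fun k => bessel_term g (s * x) k * gauss_weight x) n = series (bessel_term g (s * x)) n * gauss_weight x.
    by rewrite /series/= mulr_suml.
  apply: h.
  - by move=> k; apply: measurable_funTS; rewrite /gauss_weight /bessel_term; mfun.
  - move=> x _; rewrite (_ : series _ = fun n => series (bessel_term g (s * x)) n * gauss_weight x).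
      by apply: cvgMl; exact: (@cvg_bessel_term _ g g0).
    by apply/funext => n; exact: E.
  - move=> x n; rewrite /= in_itv/= andbT => x0.
    rewrite E normrM (ger0_norm (gauss_weight_ge0 x)) ler_wpM2r ?gauss_weight_ge0//.
    apply: (le_trans (@series_bessel_term_le _ g g0 _ _)).
    by rewrite normrM (gtr0_norm x0).
  - exact: integrable_gauss_weight.
have E k : \int[mu]_(x in `]0, +oo[) (bessel_term g (s * x) k * gauss_weight x) =
    Gamma (g + 1) / 2 * exp_coeff (- (s ^+ 2 / 4)) k.
  transitivity (\int[mu]_(x in `]0, +oo[)
     ((-1) ^+ k * (s / 2) ^+ (2 * k) / (k`!%:R * poch (g + 1) k) * (x ^+ (2 * k) * gauss_weight x))).
    apply: eq_Rintegral => x _; rewrite /bessel_term (mulrAC s) [(s / 2 * x) ^+ _]exprMn; ring.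
  rewrite RintegralZl//; last exact: integrable_expn_gauss_weight.
  rewrite moment_gauss_weight /exp_coeff/= (_ : - (s ^+ 2 / 4) = -1 * (s / 2) ^+ 2); last by field.
  rewrite [(-1 * _) ^+ k]exprMn exprM; move: (poch_gt0 k g1) => P0.
  have F0 : k`!%:R != 0 :> R by rewrite pnatr_eq0 -lt0n fact_gt0.
  move: (Gamma _) (poch _ _) P0 (_ ^+ k) (_ ^+ k) F0 => G P P0 X Y F0.
  by field; rewrite F0 gt_eqF.
have h2 : series (fun k => \int[mu]_(x in `]0, +oo[) (bessel_term g (s * x) k * gauss_weight x)) @ \oo -->
    Gamma (g + 1) / 2 * expR (- (s ^+ 2 / 4)).
  rewrite (_ : series _ = fun n => Gamma (g + 1) / 2 * series (exp_coeff (- (s ^+ 2 / 4))) n).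
    by apply: cvgMr; exact: is_cvg_series_exp_coeff.
  by apply/funext => n; rewrite /series/= mulr_sumr; apply: eq_bigr => k _; exact: E.
have := cvg_unique _ h h2 => ->//.
by move: (Gamma _) G0 (expR _) => G G0 e; field; rewrite gt_eqF.
Qed.

End weight.

(** * Poisson's integral and the product formula *)

Lemma sum_even_support (R : realType) (k : nat) (F : nat -> R) :
  (forall l, (k < l)%N -> F l = 0) -> (forall l, odd l -> F l = 0) ->
  \sum_(0 <= l < k.+1) F l = \sum_(0 <= m < k.+1) F (2 * m)%N.
Proof.
move=> F1 F2; have -> : \sum_(0 <= m < k.+1) F (2 * m)%N =
    \sum_(0 <= m < k.+1) (F (2 * m)%N + F (2 * m).+1).
  by apply: eq_bigr => m _; rewrite (F2 (2 * m).+1) ?addr0//= mul2n odd_double.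
rewrite -sum_even_odd (@big_cat_nat _ _ _ k.+1 0%N (2 * k.+1)%N)//=; last lia.
by rewrite [X in _ + X]big_nat [X in _ + X]big1 ?addr0// => l /andP[h _]; exact: F1.
Qed.

Section angular.
Context {R : realType}.
Local Notation mu := (@lebesgue_measure R).
Variable g : R.
Hypothesis g0 : -1 / 2 < g.
Let g1 : 0 < g + 1. Proof. by have := g0; lra. Qed.
Let mI : measurable (`[0, pi]%classic : set (measurableTypeR R)).
Proof. exact: measurable_itv. Qed.
Local Notation sn x := (sin x `^ (2 * g)).

Lemma angular_cst_cos_moment (l : nat) (a : R) :
  angular_cst g * \int[mu]_(x in `[0, pi]) ((a * cos x) ^+ l * sn x) =
  if odd l then 0 else a ^+ l * (poch (1 / 2) l./2 / poch (g + 1) l./2).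
Proof.
have E : \int[mu]_(x in `[0, pi]) ((a * cos x) ^+ l * sn x) =
    a ^+ l * \int[mu]_(x in `[0, pi]) (cos x ^+ l * sn x).
  rewrite -RintegralZl//.
    by apply: eq_Rintegral => x _; rewrite exprMn mulrA.
  apply: (@integrable_bnd_sin _ g g0 _ 1); first by mfun.
  by move=> x; rewrite normrX exprn_ile1// ler_norml cos_geN1 cos_le1.
rewrite E; case: ifP => ol; first by rewrite moment_odd// !mulr0.
rewrite mulrCA -(moment_even g0); congr (_ * (_ * _)).
apply: eq_Rintegral => x _; congr (_ ^+ _ * _).
by rewrite mul2n even_halfK// ol.
Qed.

(** Poisson's integral: expand the cosine and integrate termwise. *)
Lemma poisson (z : R) :
  angular_cst g * \int[mu]_(x in `[0, pi]) (cos (z * cos x) * sn x) = bessel_j g z.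
Proof.
set I := \int[mu]_(x in _) _.
pose C k := \int[mu]_(x in `[0, pi]) (cos_coeff' (z * cos x) k * sn x).
have h : series C @ \oo --> I.
  have E x n : series (fun k => cos_coeff' (z * cos x) k * sn x) n =
      series (cos_coeff' (z * cos x)) n * sn x.
    by rewrite /series/= mulr_suml.
  apply: (@Rintegral_series _ _ _ mu `[0, pi]%classic mI _ _ (fun x => expR `|z| * sn x)).
  - by move=> k; apply: measurable_funTS; rewrite /cos_coeff'; mfun.
  - move=> x _; rewrite (_ : series _ = fun n => series (cos_coeff' (z * cos x)) n * sn x).
      by apply: cvgMl; exact: cvg_cos_coeff'.
    by apply/funext => n; exact: E.
  - move=> x n _; rewrite E normrM (ger0_norm (powR_ge0 _ _)) ler_wpM2r ?powR_ge0//.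
    apply: (le_trans (ler_norm_sum _ _ _)).
    apply: (@le_trans _ _ (expR `|z * cos x|)).
      apply: (le_trans _ (even_exp_sum_le n (normr_ge0 _))).
      apply: ler_sum => k _; rewrite /cos_coeff'/= !normrM normrX normrN1 expr1n mul1r.
      by rewrite normfV normr_nat normrX normrM mul2n.
    rewrite ler_expR normrM -[leRHS]mulr1 ler_wpM2l//.
    by rewrite ler_norml cos_geN1 cos_le1.
  - apply: (@integrable_bnd_sin _ g g0 _ (expR `|z|)); first by mfun.
    by move=> x; rewrite ger0_norm ?expR_ge0.
have {}h : (fun n => angular_cst g * series C n) @ \oo --> angular_cst g * I.
  by apply: cvgM => //; exact: cvg_cst.
apply: (cvg_unique _ h) => //.
rewrite (_ : (fun _ => _) = series (bessel_term g z)); first exact: (cvg_bessel_term g0).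
apply/funext => n; rewrite /series/= mulr_sumr; apply: eq_bigr => k _.
transitivity ((-1) ^+ k / (2 * k)`!%:R * (angular_cst g * \int[mu]_(x in `[0, pi]) ((z * cos x) ^+ (2 * k) * sn x))).
  rewrite [RHS]mulrCA -[in RHS]RintegralZl//; last first.
    apply: (@integrable_bnd_sin _ g g0 _ (`|z| ^+ (2 * k))); first by mfun.
    move=> x; rewrite normrX lerXn2r ?nnegrE// normrM -[leRHS]mulr1 ler_wpM2l//.
    by rewrite ler_norml cos_geN1 cos_le1.
  congr (_ * _); apply: eq_Rintegral => x _; rewrite /cos_coeff' /= mul2n.
  by rewrite [RHS]mulrA; congr (_ * _); rewrite mulrAC.
rewrite angular_cst_cos_moment mul2n odd_double doubleK -mul2n /bessel_term -(@poch_half R k).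
have F : k`!%:R != 0 :> R by rewrite pnatr_eq0 -lt0n fact_gt0.
have P : poch (1 / 2) k != 0 :> R by rewrite gt_eqF// poch_gt0.
have Q : 4 ^+ k != 0 :> R by rewrite expf_neq0.
have P1 : poch (g + 1) k != 0 :> R by rewrite gt_eqF// poch_gt0.
rewrite [(z / 2) ^+ _]exprMn (_ : 2^-1 ^+ (2 * k) = (4 ^+ k)^-1); last first.
  by rewrite exprM exprVn (_ : 2 ^+ 2 = 4 :> R) ?exprVn//; ring.
move: (poch _ _) P (poch _ _) P1 (4 ^+ k) Q (z ^+ _) => p1 P p2 P1 q Q Z.
by field; rewrite F P1 Q P.
Qed.

(** [bessel_j] is a mean of cosines. *)
Lemma bessel_j_le1 (z : R) : `|bessel_j g z| <= 1.
Proof.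
have k0 := angular_cst_gt0 g0.
have i1 := @integrable_bnd_sin _ g g0 (fun x => cos (z * cos x)) 1.
rewrite -poisson normrM (gtr0_norm k0) -[leRHS](angular_cst_mass g0) ler_pM2l//.
have {}i1 : mu.-integrable `[0, pi] (fun x => (cos (z * cos x) * sn x)%:E).
  by apply: i1; [mfun|move=> x; rewrite ler_norml cos_geN1 cos_le1].
apply: (le_trans (le_normr_Rintegral mI i1)).
apply: le_Rintegral => //; [exact: integrable_norm|exact: (integrable_sin g0)|].
move=> x _; rewrite normrM (ger0_norm (powR_ge0 _ _)) -[leRHS]mul1r ler_wpM2r ?powR_ge0//.
by rewrite ler_norml cos_geN1 cos_le1.
Qed.

(** The square of the third side of a triangle with sides [s], [t] and angle [x]. *)
Definition cos_law (s t x : R) : R := s ^+ 2 + t ^+ 2 - 2 * s * t * cos x.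

Lemma cos_law_ge0 s t x : 0 <= cos_law s t x.
Proof.
have := cos2Dsin2 x; have := cos_le1 x; have := cos_geN1 x; rewrite /cos_law => h1 h2 h3.
rewrite (_ : _ - _ = (s - t * cos x) ^+ 2 + (t * sin x) ^+ 2).
  by rewrite addr_ge0 ?sqr_ge0.
rewrite (_ : t ^+ 2 = t ^+ 2 * (cos x ^+ 2 + sin x ^+ 2)); first by ring.
by rewrite h3 mulr1.
Qed.

Lemma cos_law_le s t x : 0 <= s -> 0 <= t -> cos_law s t x <= (s + t) ^+ 2.
Proof.
move=> s0 t0; have h := cos_geN1 x; rewrite /cos_law.
have : 0 <= s * t * (1 + cos x) by rewrite !mulr_ge0//; lra.
rewrite !expr2; lra.
Qed.

(** Expand in powers of [2 s t cos x]; the odd moments vanish and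
    [trinomial_mean_expansion] sums the even ones. *)
Lemma cos_law_power_mean (k : nat) s t : 0 <= s -> 0 <= t ->
  angular_cst g * \int[mu]_(x in `[0, pi]) (cos_law s t x ^+ k * sn x) =
  \sum_(0 <= i < k.+1) 'C(k, i)%:R * poch (g + 1) k / (poch (g + 1) i * poch (g + 1) (k - i))
     * s ^+ (2 * i) * t ^+ (2 * (k - i)).
Proof.
move=> s0 t0.
transitivity (\sum_(0 <= l < k.+1) 'C(k, l)%:R * (s ^+ 2 + t ^+ 2) ^+ (k - l) *
    (if odd l then 0 else (- (2 * s * t)) ^+ l * (poch (1 / 2) l./2 / poch (g + 1) l./2))).
  transitivity (angular_cst g * \int[mu]_(x in `[0, pi]) (\sum_(0 <= l < k.+1)
      ('C(k, l)%:R * (s ^+ 2 + t ^+ 2) ^+ (k - l)) * ((- (2 * s * t) * cos x) ^+ l * sn x))).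
    congr (_ * _); apply: eq_Rintegral => x _.
    rewrite /cos_law -mulNr exprDn mulr_suml big_mkord; apply: eq_bigr => l _.
    by rewrite -[_ *+ 'C(_, _)]mulr_natr; ring.
  have icos l : mu.-integrable `[0, pi] (fun x => ((- (2 * s * t) * cos x) ^+ l * sn x)%:E).
    apply: (@integrable_bnd_sin _ g g0 _ (`|2 * s * t| ^+ l)); first by mfun.
    move=> x; rewrite normrX lerXn2r ?nnegrE// normrM normrN -[leRHS]mulr1 ler_wpM2l//.
    by rewrite ler_norml cos_geN1 cos_le1.
  rewrite Rintegral_sum//; last first.
    move=> l; have := integrableZl mI ('C(k, l)%:R * (s ^+ 2 + t ^+ 2) ^+ (k - l)) (icos l).
    exact: eq_integrable.
  rewrite mulr_sumr; apply: eq_bigr => l _; rewrite RintegralZl//; last exact: icos.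
  by rewrite mulrCA angular_cst_cos_moment.
rewrite sum_even_support.
- rewrite -[RHS](_ : \sum_(0 <= i < k.+1) 'C(k, i)%:R * poch (g + 1) k / (poch (g + 1) i * poch (g + 1) (k - i)) * (s ^+ 2) ^+ i * (t ^+ 2) ^+ (k - i) = _); last first.
    by apply: eq_bigr => i _; rewrite !exprM.
  rewrite -(trinomial_mean_expansion _ _ _ g1); apply: eq_bigr => m _.
  rewrite mul2n odd_double doubleK -mul2n exprM.
  rewrite (_ : (- (2 * s * t)) ^+ 2 = 4 * s ^+ 2 * t ^+ 2); last by ring.
  by rewrite !mulrA.
- by move=> l kl; rewrite bin_small// !mul0r.
- by move=> l ->; rewrite mulr0.
Qed.

(** Expand the left-hand side in powers of [tau].  The means of the powers of the
    third side are the coefficients of the Cauchy product of the two series. *)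
Lemma product_formula (tau s t : R) : 0 <= s -> 0 <= t ->
  angular_cst g * \int[mu]_(x in `[0, pi]) (bessel_j g (tau * Num.sqrt (cos_law s t x)) * sn x) =
  bessel_j g (tau * s) * bessel_j g (tau * t).
Proof.
move=> s0 t0.
have sq x : Num.sqrt (cos_law s t x) <= s + t.
  rewrite -(ler_pXn2r (n := 2)) ?nnegrE ?sqrtr_ge0 ?addr_ge0//.
  by rewrite sqr_sqrtr ?cos_law_ge0 ?cos_law_le.
pose M := expR (`|tau| * (s + t)).
set I := \int[mu]_(x in _) _.
pose C k := \int[mu]_(x in `[0, pi]) (bessel_term g (tau * Num.sqrt (cos_law s t x)) k * sn x).
have h : series C @ \oo --> I.
  have E x n : series (fun k => bessel_term g (tau * Num.sqrt (cos_law s t x)) k * sn x) n =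
      series (bessel_term g (tau * Num.sqrt (cos_law s t x))) n * sn x.
    by rewrite /series/= mulr_suml.
  apply: (@Rintegral_series _ _ _ mu `[0, pi]%classic mI _ _ (fun x => M * sn x)).
  - by move=> k; apply: measurable_funTS; rewrite /bessel_term /cos_law; mfun.
  - move=> x _; rewrite (_ : series _ = fun n => series (bessel_term g (tau * Num.sqrt (cos_law s t x))) n * sn x).
      by apply: cvgMl; exact: (cvg_bessel_term g0).
    by apply/funext => n; exact: E.
  - move=> x n _; rewrite E normrM (ger0_norm (powR_ge0 _ _)) ler_wpM2r ?powR_ge0//.
    apply: (le_trans (series_bessel_term_le g0 _ _)); rewrite ler_expR normrM ler_wpM2l//.
    by rewrite ger0_norm ?sqrtr_ge0.
  - apply: (@integrable_bnd_sin _ g g0 _ M); first by mfun.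
    by move=> x; rewrite ger0_norm ?expR_ge0.
have {}h : (fun n => angular_cst g * series C n) @ \oo --> angular_cst g * I.
  by apply: cvgM => //; exact: cvg_cst.
apply: (cvg_unique _ h) => //.
have hc := @series_cauchy_geo R (bessel_term g (tau * s)) (bessel_term g (tau * t))
  (bessel_j g (tau * s)) (bessel_j g (tau * t))
  (expR (4 * `|tau * s|) + expR (4 * `|tau * t|)) 16^-1.
rewrite (_ : (fun _ => _) = series (fun n =>
   \sum_(i < n.+1) bessel_term g (tau * s) i * bessel_term g (tau * t) (n - i)%N)).
  apply: hc => //; first by lra.
  - move=> k; apply: (le_trans (bessel_term_le_geo g0 _ _)).
    by rewrite ler_wpM2l ?exprn_ge0// lerDl expR_ge0.
  - move=> n; apply: (le_trans (bessel_term_tail g0 _ _)).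
    by rewrite ler_wpM2l ?exprn_ge0// lerDr expR_ge0.
  - exact: (cvg_bessel_term g0).
apply/funext => n; rewrite /series/= mulr_sumr; apply: eq_bigr => k _.
transitivity ((-1) ^+ k * (tau / 2) ^+ (2 * k) / (k`!%:R * poch (g + 1) k) *
   (angular_cst g * \int[mu]_(x in `[0, pi]) (cos_law s t x ^+ k * sn x))).
  rewrite [RHS]mulrCA -[in RHS]RintegralZl//; last first.
    apply: (@integrable_bnd_sin _ g g0 _ (((s + t) ^+ 2) ^+ k)).
      by rewrite /cos_law; mfun.
    move=> x; rewrite normrX (ger0_norm (cos_law_ge0 _ _ _)) lerXn2r ?nnegrE ?cos_law_ge0 ?sqr_ge0//.
    exact: cos_law_le.
  congr (_ * _); apply: eq_Rintegral => x _; rewrite /bessel_term.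
  rewrite (mulrAC tau) [(_ / 2 * _) ^+ _]exprMn [Num.sqrt _ ^+ _]exprM sqr_sqrtr ?cos_law_ge0//; ring.
rewrite cos_law_power_mean// mulr_sumr big_mkord; apply: eq_bigr => i _.
have ik : (i <= k)%N by rewrite -ltnS.
rewrite bin_factR// /bessel_term.
have F n' : n'`!%:R != 0 :> R by rewrite pnatr_eq0 -lt0n fact_gt0.
have P n' : poch (g + 1) n' != 0 :> R by rewrite gt_eqF// poch_gt0.
have -> : (-1) ^+ k = (-1) ^+ i * (-1) ^+ (k - i) :> R by rewrite -exprD subnKC.
have -> : (tau / 2) ^+ (2 * k) = (tau / 2) ^+ (2 * i) * (tau / 2) ^+ (2 * (k - i)).
  by rewrite -exprD -mulnDr subnKC.
rewrite (mulrAC tau s) (mulrAC tau t) [(tau / 2 * s) ^+ _]exprMn [(tau / 2 * t) ^+ _]exprMn.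
move: (F k) (F i) (F (k - i)%N) (P k) (P i) (P (k - i)%N).
move: (_`!%:R) (_`!%:R) (_`!%:R) (poch _ _) (poch _ _) (poch _ _) => f1 f2 f3 p1 p2 p3 F1 F2 F3 P1 P2 P3.
by field; rewrite F1 F2 F3 P1 P2 P3.
Qed.

End angular.

(** * Symmetry of the Bessel translation *)

Section translation_symmetry.
Context {R : realType}.
Local Notation mu := (@lebesgue_measure R).
Variable g : R.
Hypothesis g0 : -1 / 2 < g.

(** Sixteen times the squared area of the triangle with sides [s], [t], [r]. *)
Definition heron (s t r : R) : R := ((s + t) ^+ 2 - r ^+ 2) * (r ^+ 2 - (s - t) ^+ 2).

Lemma heron_sym s t r : heron s t r = heron r t s.
Proof. by rewrite /heron; ring. Qed.

(** The triangle inequality, in the form that turns the range of the third side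
    into the support of the kernel. *)
Lemma heron_gt0 s t r : 0 < s -> 0 < t -> 0 < r -> (0 < heron s t r) = (`|s - t| < r < s + t).
Proof.
move=> s0 t0 r0.
have st : 0 < s + t by lra.
rewrite /heron; apply/idP/andP => [h|[h1 h2]].
  have h3 : (s - t) ^+ 2 < (s + t) ^+ 2 by rewrite !expr2; nra.
  have [h4|h4] := ltP 0 ((s + t) ^+ 2 - r ^+ 2); last first.
    have : r ^+ 2 - (s - t) ^+ 2 < 0.
      by rewrite -(@nmulr_rgt0 _ ((s + t) ^+ 2 - r ^+ 2))// lt_neqAle h4 andbT;
        apply: contraTneq h => ->; rewrite mul0r ltxx.
    by lra.
  have h5 : 0 < r ^+ 2 - (s - t) ^+ 2 by rewrite -(pmulr_rgt0 _ h4).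
  split.
    rewrite -(ltr_pXn2r (n := 2)) ?nnegrE//; last exact: ltW.
    by rewrite real_normK ?num_real//; lra.
  by rewrite -(ltr_pXn2r (n := 2)) ?nnegrE ?ltW//; lra.
rewrite mulr_gt0// subr_gt0.
  by rewrite ltr_pXn2r ?nnegrE ?ltW.
rewrite -[ltLHS]real_normK ?num_real//; rewrite ltr_pXn2r ?nnegrE//; exact: ltW.
Qed.

Lemma heron_cos_law s t x : heron s t (Num.sqrt (cos_law s t x)) = 4 * s ^+ 2 * t ^+ 2 * sin x ^+ 2.
Proof. by rewrite /heron sqr_sqrtr ?cos_law_ge0// /cos_law sin2cos2; ring. Qed.

Section fixed.
Variables (s t : R).
Hypotheses (s0 : 0 < s) (t0 : 0 < t).

Lemma cos_law_gt0 x : 0 < x < pi -> 0 < cos_law s t x.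
Proof.
move=> xx; have sx := sin_gt0_pi xx.
rewrite lt_neqAle cos_law_ge0 andbT eq_sym; apply/eqP => h.
have := heron_cos_law s t x; rewrite h sqrtr0 /heron => E.
have : 0 < 4 * s ^+ 2 * t ^+ 2 * sin x ^+ 2 by rewrite !mulr_gt0 ?exprn_gt0.
by rewrite -E expr0n/= subr0 sub0r mulrN oppr_gt0 ltNge mulr_ge0 ?sqr_ge0.
Qed.

Lemma is_derive_sqrt_cos_law x : 0 < x < pi ->
  is_derive x 1 (fun x => Num.sqrt (cos_law s t x)) (s * t * sin x / Num.sqrt (cos_law s t x)).
Proof.
move=> xx; have T0 := cos_law_gt0 xx.
have d1 : is_derive x 1 (fun x => cos_law s t x) (2 * s * t * sin x).
  by rewrite /cos_law; apply: is_derive_eq; rewrite /GRing.scale/=; ring.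
have d2 := is_derive1_sqrt T0.
have := @is_derive1_comp _ Num.sqrt (fun x => cos_law s t x) x _ _ d2 d1.

have -> : (2 * Num.sqrt (cos_law s t x))^-1 * (2 * s * t * sin x) =
    s * t * sin x / Num.sqrt (cos_law s t x).
  have : Num.sqrt (cos_law s t x) != 0 by rewrite gt_eqF// sqrtr_gt0.
  by move: (Num.sqrt _) => r r0; field.
by [].
Qed.

Lemma continuous_dsqrt_cos_law x : 0 < x < pi ->
  {for x, continuous (fun x => s * t * sin x / Num.sqrt (cos_law s t x))}.
Proof.
move=> xx; have T0 := cos_law_gt0 xx.
apply: cvgM.
  by apply: cvgM; [exact: cvg_cst|exact: continuous_sin].
apply: cvgV; first by rewrite gt_eqF// sqrtr_gt0.
apply: (@continuous_comp _ _ _ (fun x => cos_law s t x) Num.sqrt).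
  rewrite /cos_law; apply: cvgB; first exact: cvg_cst.
  by apply: cvgM; [exact: cvg_cst|exact: continuous_cos].
exact: sqrt_continuous.
Qed.

Lemma sqrt_cos_law_itv x : 0 < x < pi -> `|s - t| < Num.sqrt (cos_law s t x) < s + t.
Proof.
move=> xx; have sx := sin_gt0_pi xx.
rewrite -heron_gt0//; last by rewrite sqrtr_gt0 cos_law_gt0.
by rewrite heron_cos_law !mulr_gt0// ?exprn_gt0.
Qed.

Lemma acos_cos_law r : `|s - t| < r < s + t ->
  0 < acos ((s ^+ 2 + t ^+ 2 - r ^+ 2) / (2 * s * t)) < pi /\
  Num.sqrt (cos_law s t (acos ((s ^+ 2 + t ^+ 2 - r ^+ 2) / (2 * s * t)))) = r.
Proof.
move=> /andP[h1 h2]; have r0 : 0 < r by exact: le_lt_trans h1.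
have st0 : 0 < 2 * s * t by rewrite !mulr_gt0.
have H1 : (s ^+ 2 + t ^+ 2 - r ^+ 2) / (2 * s * t) < 1.
  rewrite ltr_pdivrMr// mul1r.
  have : (s - t) ^+ 2 < r ^+ 2.
    rewrite -[ltLHS]real_normK ?num_real//; rewrite ltr_pXn2r ?nnegrE//; exact: ltW.
  by rewrite !expr2; lra.
have H2 : -1 < (s ^+ 2 + t ^+ 2 - r ^+ 2) / (2 * s * t).
  rewrite ltr_pdivlMr// mulN1r.
  have : r ^+ 2 < (s + t) ^+ 2.
    rewrite ltr_pXn2r ?nnegrE//; [exact: ltW|apply: ltW; lra].
  by rewrite !expr2; lra.
split.
  by rewrite acos_gt0 ?acos_ltpi ?H1 ?H2 ?ltW.
rewrite /cos_law acosK; last by rewrite in_itv/= !ltW.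
rewrite (_ : _ - _ = r ^+ 2) ?sqrtr_sqr ?gtr0_norm//.
by field; rewrite !gt_eqF.
Qed.

End fixed.

Let K (s t r : R) := \1_(`]0, +oo[%classic : set (measurableTypeR R)) (heron s t r) *
  heron s t r `^ (g - 1 / 2) * `|s * r|.

Let K_ge0 s t r : 0 <= K s t r.
Proof. by rewrite /K indicE !mulr_ge0// powR_ge0. Qed.

Local Open Scope ereal_scope.

Let translation_kernel s t (F : R -> \bar R) : (0 < s)%R -> (0 < t)%R ->
  measurable_fun setT F -> (forall x, 0 <= F x) ->
  \int[mu]_(x in `]0%R, pi[) (F (Num.sqrt (cos_law s t x)) *
     (sin x `^ (2 * g) * s `^ (2 * g + 1))%:E) =
  \int[mu]_(r in `]0%R, +oo[) (F r * (K s t r * ((4 * t ^+ 2) `^ (1 / 2 - g) / t))%:E).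
Proof.
move=> s0 t0 mF F0.
set c := (_ / t)%R.
have c0 : (0 <= c)%R by rewrite divr_ge0 ?powR_ge0// ltW.
have mK : measurable_fun setT (fun r : R => F r * (K s t r * c)%:E).
  by apply: emeasurable_funM => //; rewrite /K /heron; mfun.
have f0 r : 0 <= F r * (K s t r * c)%:E by rewrite mule_ge0// lee_fin mulr_ge0// K_ge0.
transitivity (\int[mu]_(r in `]`|s - t|%R, (s + t)%R[) (F r * (K s t r * c)%:E)); last first.
  rewrite integral_mkcond [RHS]integral_mkcond; apply: eq_integral => r _.
  rewrite !patchE !mem_setE !in_itv/= andbT.
  have [r0|r0] := ltP 0%R r; last first.
    case: ifPn => // /andP[h _]; have := le_lt_trans (normr_ge0 _) h.
    by rewrite ltNge r0.
  rewrite -heron_gt0//; case: ifPn => // h; rewrite /K indicE mem_setE in_itv/= andbT.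
  by rewrite (negbTE h) !mul0r mule0.
have H1 := sqrt_cos_law_itv s0 t0.
have H2 := acos_cos_law s0 t0.
have H3 := is_derive_sqrt_cos_law s0 t0.
have H4 := continuous_dsqrt_cos_law s0 t0.
have H5 x : (0 < x < pi)%R -> (0 < s * t * sin x / Num.sqrt (cos_law s t x))%R.
  by move=> xx; rewrite !mulr_gt0// ?sin_gt0_pi// invr_gt0 sqrtr_gt0 cos_law_gt0.
rewrite (@ge0_subst_oo _ _ _ _ _ _ _ _ _ (pi_gt0 R) H1 H2 H3 H4 H5 mK f0).
apply: eq_integral => x; rewrite mem_setE in_itv/= => xx.
rewrite -muleA -EFinM; congr (_ * _%:E).
have T0 := cos_law_gt0 s0 t0 xx; have S0 := sin_gt0_pi xx.
have r0 : (0 < Num.sqrt (cos_law s t x))%R by rewrite sqrtr_gt0.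
rewrite /K heron_cos_law indicE mem_setE in_itv/= andbT.
rewrite /c; move: (Num.sqrt _) r0 => r r0; move: (sin x) S0 => z z0.
have -> /= : (0 < 4 * s ^+ 2 * t ^+ 2 * z ^+ 2)%R by rewrite !mulr_gt0// exprn_gt0.
rewrite mul1r gtr0_norm ?mulr_gt0//.
have -> : (4 * s ^+ 2 * t ^+ 2 * z ^+ 2 = (4 * t ^+ 2) * (s * z) ^+ 2)%R by ring.
have -> : (2^-1 - g = - (g - 2^-1))%R by lra.
set q := (4 * t ^+ 2)%R.
have qq : (0 <= q)%R by rewrite mulr_ge0// sqr_ge0.
rewrite (powRM _ qq (sqr_ge0 _)) powRN.
have q0 : (q `^ (g - 2^-1) != 0)%R.
  by rewrite gt_eqF// powR_gt0// /q mulr_gt0// exprn_gt0.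
rewrite -powR_mulrn ?mulr_ge0 ?(ltW s0) ?(ltW z0)// -powRrM.
have -> : (2 * (g - 2^-1) = 2 * g - 1)%R by lra.
rewrite (powRM (2 * g - 1) (ltW s0) (ltW z0)).
have -> : (z `^ (2 * g) = z `^ (2 * g - 1) * z)%R.
  by rewrite -[X in _ = (_ * X)%R](powRr1 (ltW z0)) -powRD ?subrK// (gt_eqF z0) implybT.
have -> : (s `^ (2 * g + 1) = s `^ (2 * g - 1) * s ^+ 2)%R.
  rewrite -[X in _ = (_ * X)%R](powR_mulrn 2 (ltW s0)) -powRD; first by congr powR; lra.
  by rewrite (gt_eqF s0) implybT.
move: (powR q _) q0 (powR z _) (powR s _) => Q Q0 Z S.
field; by rewrite Q0 !gt_eqF.
Qed.

(** In the variable [r], the third side, the integrand is [F r * G s] times a kernel;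
    up to a factor in [t] alone the kernel is a power of [heron s t r] times [s r]. *)
Lemma translation_symmetric (t : R) (F G : R -> \bar R) : (0 < t)%R ->
  measurable_fun setT F -> (forall x, 0 <= F x) ->
  measurable_fun setT G -> (forall x, 0 <= G x) ->
  let B (F G : R -> \bar R) := \int[mu]_(s in `]0%R, +oo[) \int[mu]_(x in `]0%R, pi[)
     (F (Num.sqrt (cos_law s t x)) * G s * (sin x `^ (2 * g) * s `^ (2 * g + 1))%:E) in
  B F G = B G F.
Proof.
move=> t0 mF F0 mG G0 B.
set c := ((4 * t ^+ 2) `^ (1 / 2 - g) / t)%R.
have c0 : (0 <= c)%R by rewrite divr_ge0 ?powR_ge0// ltW.
have BE F' G' : measurable_fun setT F' -> (forall x, 0 <= F' x) ->
  measurable_fun setT G' -> (forall x, 0 <= G' x) ->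
  B F' G' = \int[mu]_(s in `]0%R, +oo[) \int[mu]_(r in `]0%R, +oo[)
    (F' r * G' s * (K s t r * c)%:E).
  move=> mF' F0' mG' G0'; apply: eq_integral => s; rewrite mem_setE in_itv/= andbT => s0.
  rewrite -translation_kernel//.
  - by apply: emeasurable_funM => //.
  - by move=> r; exact: mule_ge0.
have mF2 : measurable_fun setT (fun z : R * R => F z.2) by exact: measurableT_comp.
have mG1 : measurable_fun setT (fun z : R * R => G z.1) by exact: measurableT_comp.
rewrite (BE F G mF F0 mG G0) (BE G F mG G0 mF F0).
have mI : measurable (`]0%R, +oo[%classic : set (measurableTypeR R)) by exact: measurable_itv.
have mf : measurable_fun setT (fun z : R * R => F z.2 * G z.1 * (K z.1 t z.2 * c)%:E).
  by apply: emeasurable_funM; [exact: emeasurable_funM|rewrite /K /heron; mfun].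
have f0 z : 0 <= F z.2 * G z.1 * (K z.1 t z.2 * c)%:E.
  by rewrite !mule_ge0// lee_fin mulr_ge0// K_ge0.
rewrite (@ge0_integral_swap _ _ _ _ _ mu mu _ _ mI mI _ mf f0).
apply: eq_integral => r _; apply: eq_integral => s _ /=.
by rewrite (muleC (F r)) /K heron_sym (mulrC s r).
Qed.

(** [translation_symmetric] against the constant function 1, whose translate is
    constant. *)
Lemma translation_mass (t : R) (F : R -> \bar R) : (0 < t)%R ->
  measurable_fun setT F -> (forall x, 0 <= F x) ->
  \int[mu]_(s in `]0%R, +oo[) \int[mu]_(x in `]0%R, pi[)
     (F (Num.sqrt (cos_law s t x)) * (sin x `^ (2 * g) * s `^ (2 * g + 1))%:E) =
  (\int[mu]_(x in `]0%R, pi[) (sin x `^ (2 * g))%:E) *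
    \int[mu]_(s in `]0%R, +oo[) (F s * (s `^ (2 * g + 1))%:E).
Proof.
move=> t0 mF F0.
have := @translation_symmetric t F (cst 1) t0 mF F0 (measurable_cst _) (fun=> lee01) => /= E.
transitivity (\int[mu]_(s in `]0%R, +oo[) \int[mu]_(x in `]0%R, pi[)
     (F (Num.sqrt (cos_law s t x)) * 1 * (sin x `^ (2 * g) * s `^ (2 * g + 1))%:E)).
  by apply: eq_integral => s _; apply: eq_integral => x _; rewrite mule1.
rewrite E.
have mS : measurable_fun setT (fun x : R => (sin x `^ (2 * g))%:E) by mfun.
have mp : measurable_fun setT (fun s : R => (s `^ (2 * g + 1))%:E) by mfun.
have mI : measurable (`]0%R, +oo[%classic : set (measurableTypeR R)) by exact: measurable_itv.
have mP : measurable (`]0%R, pi[%classic : set (measurableTypeR R)) by exact: measurable_itv.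
have mFp : measurable_fun (`]0%R, +oo[%classic : set (measurableTypeR R))
    (fun s : R => F s * (s `^ (2 * g + 1))%:E).
  by apply: measurable_funTS; exact: emeasurable_funM.
have Fp0 s : 0 <= F s * (s `^ (2 * g + 1))%:E.
  by apply: mule_ge0; [exact: F0|rewrite lee_fin powR_ge0].
have S0 x : 0 <= (sin x `^ (2 * g))%:E by rewrite lee_fin powR_ge0.
have J0 : 0 <= \int[mu]_(x in `]0%R, pi[) (sin x `^ (2 * g))%:E.
  by apply: integral_ge0 => x _; exact: S0.
have Z := @ge0_integralZl _ _ _ mu _ mI _ mFp _ (fun s _ => Fp0 s) J0.
rewrite -Z; apply: eq_integral => s _.
have mSp := measurable_funTS (D := `]0%R, pi[%classic : set (measurableTypeR R)) mS.
have Z' := @ge0_integralZl _ _ _ mu _ mP _ mSp _ (fun x _ => S0 x) (Fp0 s).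
rewrite [RHS]muleC -Z'; apply: eq_integral => x _.
by rewrite mul1e EFinM (muleC (sin x `^ _)%:E) muleA.
Qed.

End translation_symmetry.

Section signed_symmetry.
Context {R : realType}.
Local Notation mu := (@lebesgue_measure R).
Variable g : R.
Hypothesis g0 : -1 / 2 < g.

Let mI : measurable (`]0, +oo[%classic : set (measurableTypeR R)).
Proof. exact: measurable_itv. Qed.
Let mP : measurable (`]0, pi[%classic : set (measurableTypeR R)).
Proof. exact: measurable_itv. Qed.

Let w (s x : R) : R := sin x `^ (2 * g) * s `^ (2 * g + 1).
Let w0 s x : 0 <= w s x. Proof. by rewrite mulr_ge0// powR_ge0. Qed.

Lemma sin_mass_fin : (\int[mu]_(x in `]0%R, pi[) (sin x `^ (2 * g))%:E < +oo)%E.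
Proof.
have := momE0_fin g0; rewrite /angular_moment.
by under eq_integral do rewrite expr0 mul1r.
Qed.

Lemma measurable_sqrt_cos_law t (F : R -> R) : measurable_fun setT F ->
  measurable_fun setT (fun z : R * R => F (Num.sqrt (cos_law z.1 t z.2))).
Proof. by move=> mF; apply: measurableT_comp => //; rewrite /cos_law; mfun. Qed.

Section main.
Variables (t : R) (F G : R -> R) (C : R).
Hypotheses (t0 : 0 < t) (mF : measurable_fun setT F) (mG : measurable_fun setT G).
Hypotheses (G0 : forall x, 0 <= G x) (GC : forall x, G x <= C).
Hypothesis iF : (\int[mu]_(s in `]0%R, +oo[) (`|F s| * s `^ (2 * g + 1))%:E < +oo)%E.

Let B (F G : R -> R) : \bar R := (\int[mu]_(s in `]0%R, +oo[) \int[mu]_(x in `]0%R, pi[)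
  (F (Num.sqrt (cos_law s t x)) * G s * w s x)%:E)%E.

Let B_sym (H : R -> R) : measurable_fun setT H -> (forall x, 0 <= H x) -> B H G = B G H.
Proof.
move=> mH H0.
have := @translation_symmetric R g t (EFin \o H) (EFin \o G) t0
  ((measurable_EFinP _ _).2 mH) H0 ((measurable_EFinP _ _).2 mG) G0.
by [].
Qed.

Let B_fin : (B (fun x => `|F x|)%R G < +oo)%E.
Proof.
have C0 : 0 <= C by exact: le_trans (GC 0).
have maF : measurable_fun setT (fun x => (`|F x|)%:E) by mfun.
have aF0 x : (0 <= (`|F x|)%:E)%E by rewrite lee_fin.
have := @translation_mass R g t (fun x => (`|F x|)%:E) t0 maF aF0.
set M := (X in _ = (_ * X)%E) => E.
have ME : (M < +oo)%E by [].
have M0 : (0 <= M)%E.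
  by apply: integral_ge0 => s _; rewrite mule_ge0// lee_fin powR_ge0.
have mm := measurable_sqrt_cos_law t mF.
have mG1 : measurable_fun setT (fun z : R * R => G z.1) by exact: measurableT_comp.
have mK : measurable_fun setT (fun z : R * R => (`|F (Num.sqrt (cos_law z.1 t z.2))| * w z.1 z.2)%:E).
  by rewrite /w; mfun.
have mL : measurable_fun setT (fun z : R * R =>
    (`|F (Num.sqrt (cos_law z.1 t z.2))| * G z.1 * w z.1 z.2)%:E).
  by rewrite /w; mfun.
have mCK : measurable_fun setT (fun z : R * R =>
    (C%:E * (`|F (Num.sqrt (cos_law z.1 t z.2))| * w z.1 z.2)%:E)%E).
  by apply: emeasurable_funM => //; exact: measurable_cst.
have L0 z : (0 <= (`|F (Num.sqrt (cos_law z.1 t z.2))| * G z.1 * w z.1 z.2)%:E)%E.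
  by rewrite lee_fin mulr_ge0 ?w0// mulr_ge0.
have K0 z : (0 <= (`|F (Num.sqrt (cos_law z.1 t z.2))| * w z.1 z.2)%:E)%E.
  by rewrite lee_fin mulr_ge0 ?w0.
have LE x y : (((`|F (Num.sqrt (cos_law x t y))| * G x * w x y)%:E) <=
    (C%:E * (`|F (Num.sqrt (cos_law x t y))| * w x y)%:E))%E.
  rewrite -EFinM lee_fin (mulrA C); apply: ler_wpM2r; first exact: w0.
  by rewrite mulrC; apply: ler_wpM2r.
have := @ge0_le_integral2 _ _ _ _ _ mu mu _ _ mI mP _ _ mL mCK L0 (fun x y _ _ => LE x y).
move/le_lt_trans; apply.
rewrite (@ge0_integralZl2 _ _ _ _ _ mu mu _ _ mI mP _ _ C0 mK K0).
rewrite lte_mul_pinfty//.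
rewrite [ltLHS](_ : _ = (\int[mu]_(x in `]0%R, pi[) (sin x `^ (2 * g))%:E * M)%E); last first.
  by rewrite -E; apply: eq_integral => s _; apply: eq_integral => x _; rewrite -EFinM.
rewrite lte_mul_pinfty//.
- by apply: integral_ge0 => x _; rewrite lee_fin powR_ge0.
- rewrite ge0_fin_numE; first exact: sin_mass_fin.
  by apply: integral_ge0 => x _; rewrite lee_fin powR_ge0.
Qed.

(** The symmetry for a signed [F]: a bounded [G] makes both iterated
    integrals absolutely convergent, and the positive and negative parts are treated
    separately. *)
Lemma translation_symmetric_signed :
  \int[mu]_(s in `]0, +oo[) \int[mu]_(x in `]0, pi[)
     (F (Num.sqrt (cos_law s t x)) * G s * w s x) =
  \int[mu]_(s in `]0, +oo[) \int[mu]_(x in `]0, pi[)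
     (G (Num.sqrt (cos_law s t x)) * F s * w s x).
Proof.
have mmF := measurable_sqrt_cos_law t mF.
have mmG := measurable_sqrt_cos_law t mG.
have mG1 : measurable_fun setT (fun z : R * R => G z.1) by exact: measurableT_comp.
have mF1 : measurable_fun setT (fun z : R * R => F z.1) by exact: measurableT_comp.
have mf1 : measurable_fun setT (fun z : R * R => F (Num.sqrt (cos_law z.1 t z.2)) * G z.1 * w z.1 z.2).
  by rewrite /w; mfun.
have mf2 : measurable_fun setT (fun z : R * R => G (Num.sqrt (cos_law z.1 t z.2)) * F z.1 * w z.1 z.2).
  by rewrite /w; mfun.
have mmax (H : R -> R) : measurable_fun setT H ->
    measurable_fun setT (fun x => Num.max (H x) 0).
  by move=> mH; apply: measurable_maxr.
have b1 : (\int[mu]_(s in `]0%R, +oo[) \int[mu]_(x in `]0%R, pi[)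
     (`|F (Num.sqrt (cos_law s t x)) * G s * w s x|)%:E < +oo)%E.
  apply: le_lt_trans B_fin; rewrite le_eqVlt; apply/orP; left; apply/eqP.
  apply: eq_integral => s _; apply: eq_integral => x _.
  by move: (w s x) (w0 s x) => W W0; rewrite !normrM (ger0_norm W0) (ger0_norm (G0 _)).
have b2 : (\int[mu]_(s in `]0%R, +oo[) \int[mu]_(x in `]0%R, pi[)
     (`|G (Num.sqrt (cos_law s t x)) * F s * w s x|)%:E < +oo)%E.
  apply: le_lt_trans B_fin; rewrite B_sym//; last by mfun.
  rewrite le_eqVlt; apply/orP; left; apply/eqP; apply: eq_integral => s _; apply: eq_integral => x _.
  by move: (w s x) (w0 s x) => W W0; rewrite !normrM (ger0_norm W0) (ger0_norm (G0 _)).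
rewrite (@Rintegral_posneg _ _ _ _ _ mu mu _ _ mI mP _ mf1 b1).
rewrite (@Rintegral_posneg _ _ _ _ _ mu mu _ _ mI mP _ mf2 b2) /=.
have H1 : measurable_fun setT (fun x => Num.max (F x) 0) by exact: mmax.
have H2 : measurable_fun setT (fun x => Num.max (- F x) 0) by apply: mmax; mfun.
have P1 x : 0 <= Num.max (F x) 0 by rewrite le_max lexx orbT.
have P2 x : 0 <= Num.max (- F x) 0 by rewrite le_max lexx orbT.
have mx (a b : R) : 0 <= b -> Num.max (a * b) 0 = Num.max a 0 * b.
  by move=> b0; rewrite maxr_pMl// mul0r.
have fsub (a b c d : \bar R) : a = c -> b = d -> fine a - fine b = fine c - fine d.
  by move=> -> ->.
apply: fsub.
  transitivity (B (fun x => Num.max (F x) 0) G).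
    apply: eq_integral => s _; apply: eq_integral => x _.
    by move: (w s x) (w0 s x) => W W0; rewrite -mx// -mx.
  rewrite (B_sym H1 P1); apply: eq_integral => s _; apply: eq_integral => x _.
  by move: (w s x) (w0 s x) => W W0; rewrite !(mulrC (G _)) -mx// -mx.
transitivity (B (fun x => Num.max (- F x) 0) G).
  apply: eq_integral => s _; apply: eq_integral => x _.
  by move: (w s x) (w0 s x) => W W0; rewrite -mx// -mx// !mulNr.
rewrite (B_sym H2 P2); apply: eq_integral => s _; apply: eq_integral => x _.
by move: (w s x) (w0 s x) => W W0; rewrite !(mulrC (G _)) -mx// -mx// !mulNr.
Qed.

End main.
End signed_symmetry.

(** * Convolution with the Gaussian as a Hankel integral *)

Section conv_identity.
Context {R : realType}.
Local Notation mu := (@lebesgue_measure R).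
Variable g : R.
Hypothesis g0 : -1 / 2 < g.

Let mI : measurable (`]0, +oo[%classic : set (measurableTypeR R)).
Proof. exact: measurable_itv. Qed.
Let mP : measurable (`[0, pi]%classic : set (measurableTypeR R)).
Proof. exact: measurable_itv. Qed.

Let mj := @measurable_bessel_j R g g0.
Let c : R := 2 / Gamma (g + 1).

Lemma gauss_weight_mass_fin : (\int[mu]_(x in `]0%R, +oo[) (gauss_weight g x)%:E < +oo)%E.
Proof.
have /integrableP[_] := integrable_gauss_weight g0 0.
by under eq_integral do rewrite mul0r expR0 mul1r gee0_abs ?lee_fin ?gauss_weight_ge0//.
Qed.

(** Write the Gaussian as a Hankel integral and translate under the integral sign. *)
Lemma translation_gauss (s t : R) : 0 <= s -> 0 <= t ->
  angular_cst g * \int[mu]_(x in `[0, pi]) (expR (- (Num.sqrt (cos_law s t x) ^+ 2 / 4)) * sin x `^ (2 * g)) =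
  c * \int[mu]_(tau in `]0, +oo[) (bessel_j g (tau * s) * bessel_j g (tau * t) * gauss_weight g tau).
Proof.
move=> s0 t0.
have mf : measurable_fun setT (fun z : R * R =>
    bessel_j g (Num.sqrt (cos_law s t z.1) * z.2) * gauss_weight g z.2 * sin z.1 `^ (2 * g)).
  apply: measurable_funM; last by mfun.
  apply: measurable_funM; last by rewrite /gauss_weight; mfun.
  by apply: (measurableT_comp mj); rewrite /cos_law; mfun.
have E1 (x : R) : expR (- (Num.sqrt (cos_law s t x) ^+ 2 / 4)) * sin x `^ (2 * g) =
    c * \int[mu]_(tau in `]0, +oo[)
      (bessel_j g (Num.sqrt (cos_law s t x) * tau) * gauss_weight g tau * sin x `^ (2 * g)).
  rewrite -(gauss_transform g0 (Num.sqrt (cos_law s t x))) -/c -mulrA; congr (c * _).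
  rewrite mulrC -RintegralMl//.
    by apply: eq_Rintegral => tau _; rewrite mulrC.
  apply: measurable_funTS; apply: measurable_funM; last by rewrite /gauss_weight; mfun.
  by apply: (measurableT_comp mj); mfun.
under eq_Rintegral do rewrite E1.
rewrite RintegralMl//; last first.
  apply: measurable_funTS.
  exact: (@measurable_Rintegral _ _ _ _ _ mu _ mI _ mf).
rewrite mulrCA; congr (c * _).
have bnd : (\int[mu]_(x in `[0%R, pi]) \int[mu]_(tau in `]0%R, +oo[)
    (`|bessel_j g (Num.sqrt (cos_law s t x) * tau) * gauss_weight g tau * sin x `^ (2 * g)|)%:E < +oo)%E.
  have iS := sin_mass_fin g0; rewrite -integral_0pi_oo in iS; last by mfun.
  have ma : measurable_fun setT (fun x : R => sin x `^ (2 * g)) by mfun.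
  have mh := @measurable_gauss_weight R g.
  have a0 (x : R) : 0 <= sin x `^ (2 * g) by exact: powR_ge0.
  have dom (x y : R) : `[0, pi]%classic x -> `]0, +oo[%classic y ->
      `|bessel_j g (Num.sqrt (cos_law s t x) * y) * gauss_weight g y * sin x `^ (2 * g)| <= sin x `^ (2 * g) * gauss_weight g y.
    move=> _ _; move: (sin x `^ (2 * g)) (a0 x) => S S0.
    move: (gauss_weight g y) (gauss_weight_ge0 g y) => H H0.
    rewrite !normrM (ger0_norm S0) (ger0_norm H0) mulrC ler_wpM2l//.
    by rewrite -[leRHS]mul1r ler_wpM2r// bessel_j_le1.
  exact: (@separated_bound_fin _ _ _ _ _ mu mu _ _ mP mI _ _ _ mf ma mh a0 (gauss_weight_ge0 g) dom iS gauss_weight_mass_fin).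
rewrite (@Rintegral_swap _ _ _ _ _ mu mu _ _ mP mI _ mf bnd).
rewrite -RintegralMl//; last first.
  apply: measurable_funTS.
  have := @measurable_Rintegral _ _ _ _ _ mu _ mP _ (measurableT_comp mf (@measurable_swap _ _ _ _)).
  by apply.
apply: eq_Rintegral => tau; rewrite inE/= in_itv/= andbT => tau0.
rewrite -product_formula//.
transitivity (angular_cst g * (gauss_weight g tau * \int[mu]_(x in `[0, pi])
   (bessel_j g (tau * Num.sqrt (cos_law s t x)) * sin x `^ (2 * g)))); last first.
  by rewrite mulrA mulrAC.
congr (_ * _); rewrite -RintegralMl//.
  by apply: eq_Rintegral => x _; rewrite mulrA (mulrC (gauss_weight _ _)) (mulrC tau).
apply: measurable_funTS; apply: measurable_funM; last by mfun.
by apply: (measurableT_comp mj); rewrite /cos_law; mfun.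
Qed.

Let mO : measurable (`]0, pi[%classic : set (measurableTypeR R)).
Proof. exact: measurable_itv. Qed.

Let w (s x : R) : R := sin x `^ (2 * g) * s `^ (2 * g + 1).

Let translation_out (t : R) (F G : R -> R) :
  measurable_fun setT F -> measurable_fun setT G ->
  \int[mu]_(s in `]0, +oo[) ((angular_cst g * \int[mu]_(x in `[0, pi])
     (F (Num.sqrt (cos_law s t x)) * sin x `^ (2 * g))) * G s * s `^ (2 * g + 1)) =
  angular_cst g * \int[mu]_(s in `]0, +oo[) \int[mu]_(x in `]0, pi[)
     (F (Num.sqrt (cos_law s t x)) * G s * w s x).
Proof.
move=> mF mG.
have mmF := measurable_sqrt_cos_law t mF.
have mG1 : measurable_fun setT (fun z : R * R => G z.1) by exact: measurableT_comp.
have mf : measurable_fun setT (fun z : R * R => F (Num.sqrt (cos_law z.1 t z.2)) * G z.1 * w z.1 z.2).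
  by rewrite /w; mfun.
rewrite -RintegralMl//; last first.
  by apply: measurable_funTS; exact: (@measurable_Rintegral _ _ _ _ _ mu _ mO _ mf).
apply: eq_Rintegral => s _.
have mFs : measurable_fun setT (fun x : R => F (Num.sqrt (cos_law s t x))).
  exact: (measurableT_comp mmF (pair1_measurable s)).
have mFS : measurable_fun setT (fun x : R => F (Num.sqrt (cos_law s t x)) * sin x `^ (2 * g)).
  by mfun.
move: (angular_cst g) => k.
rewrite Rintegral_0pi_open -2!mulrA; congr (k * _).
have E := @RintegralMl _ _ _ mu _ mO (G s * s `^ (2 * g + 1)) _ (measurable_funTS mFS).
rewrite mulrC -E.
apply: eq_Rintegral => x _; rewrite /w.
by move: (F _) (sin x `^ _) (G s) (s `^ _) => a b c' e; ring.
Qed.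

(** The symmetry moves the translation from [F] to the Gaussian; then
    [translation_gauss] and Fubini's theorem let the Hankel transform of [F] appear.
    At [t = 0] the third side is [s] for every angle. *)
Lemma convolution_gauss (F : R -> R) (t : R) : 0 <= t ->
  measurable_fun setT F ->
  (\int[mu]_(s in `]0%R, +oo[) (`|F s| * s `^ (2 * g + 1))%:E < +oo)%E ->
  bessel_convolution g F (fun s => expR (- (s ^+ 2 / 4))) t =
  c * \int[mu]_(tau in `]0, +oo[) (hankel g F tau * bessel_j g (t * tau) * gauss_weight g tau).
Proof.
move=> t0 mF iF; pose G (s : R) := expR (- (s ^+ 2 / 4)).
have mG : measurable_fun setT G by rewrite /G; mfun.
have G0 s : 0 <= G s by exact: expR_ge0.
have G1 s : G s <= 1.
  by rewrite -expR0 ler_expR oppr_le0 divr_ge0// sqr_ge0.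
rewrite /bessel_convolution -/G.
transitivity (angular_cst g * \int[mu]_(s in `]0, +oo[) \int[mu]_(x in `]0, pi[)
     (F (Num.sqrt (cos_law s t x)) * G s * w s x)).
  exact: translation_out.
transitivity (angular_cst g * \int[mu]_(s in `]0, +oo[) \int[mu]_(x in `]0, pi[)
     (G (Num.sqrt (cos_law s t x)) * F s * w s x)).
  congr (_ * _); have [t1|] := ltP 0 t.
    exact: (translation_symmetric_signed g0 t1 mF mG G0 G1 iF).
  move=> t1; have -> : t = 0 by apply/eqP; rewrite eq_le t0 t1.
  apply: eq_Rintegral => s; rewrite inE/= in_itv/= andbT => s0.
  apply: eq_Rintegral => x _.
  rewrite /cos_law mulr0 mul0r expr0n/= addr0 subr0 sqrtr_sqr gtr0_norm//.
  by rewrite (mulrC (F s)).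
rewrite -translation_out//.
have mF1 : measurable_fun setT (fun z : R * R => F z.1) by exact: measurableT_comp.
have mf : measurable_fun setT (fun z : R * R =>
    (F z.1 * z.1 `^ (2 * g + 1)) * (bessel_j g (z.2 * z.1) * bessel_j g (z.2 * t) * gauss_weight g z.2)).
  by rewrite /gauss_weight; mfun => //; apply: (measurableT_comp mj); mfun.
transitivity (c * \int[mu]_(s in `]0, +oo[) \int[mu]_(tau in `]0, +oo[)
    ((F s * s `^ (2 * g + 1)) * (bessel_j g (tau * s) * bessel_j g (tau * t) * gauss_weight g tau))).
  rewrite -RintegralMl//; last first.
    by apply: measurable_funTS; exact: (@measurable_Rintegral _ _ _ _ _ mu _ mI _ mf).
  apply: eq_Rintegral => s; rewrite inE/= in_itv/= andbT => s0.
  rewrite translation_gauss ?(ltW s0)// RintegralMl//.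
    by move: c (F s) (s `^ _) (\int[mu]_(tau in _) _) => c' a b d; ring.
  apply: measurable_funTS.
  by rewrite /gauss_weight; mfun => //; apply: (measurableT_comp mj); mfun.
congr (c * _).
have bnd : (\int[mu]_(s in `]0%R, +oo[) \int[mu]_(tau in `]0%R, +oo[)
    (`|(F s * s `^ (2 * g + 1)) * (bessel_j g (tau * s) * bessel_j g (tau * t) * gauss_weight g tau)|)%:E < +oo)%E.
  have ma : measurable_fun setT (fun s : R => `|F s| * s `^ (2 * g + 1)) by mfun.
  have a0 (s : R) : 0 <= `|F s| * s `^ (2 * g + 1) by rewrite mulr_ge0// powR_ge0.
  have dom (s tau : R) : `]0, +oo[%classic s -> `]0, +oo[%classic tau ->
      `|(F s * s `^ (2 * g + 1)) * (bessel_j g (tau * s) * bessel_j g (tau * t) * gauss_weight g tau)| <=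
      `|F s| * s `^ (2 * g + 1) * gauss_weight g tau.
    move=> _ _; move: (gauss_weight g tau) (gauss_weight_ge0 g tau) => H H0.
    move: (s `^ (2 * g + 1)) (powR_ge0 s (2 * g + 1)) => S S0.
    rewrite !normrM (ger0_norm S0) (ger0_norm H0); apply: ler_wpM2l; first by rewrite mulr_ge0.
    rewrite -[leRHS]mul1r; apply: ler_wpM2r => //.
    by rewrite -[leRHS]mulr1; apply: ler_pM => //; exact: bessel_j_le1.
  exact: (@separated_bound_fin _ _ _ _ _ mu mu _ _ mI mI _ _ _ mf ma (measurable_gauss_weight g) a0 (gauss_weight_ge0 g) dom iF gauss_weight_mass_fin).
rewrite (@Rintegral_swap _ _ _ _ _ mu mu _ _ mI mI _ mf bnd).
apply: eq_Rintegral => tau _ /=; rewrite /hankel.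
have mh : measurable_fun setT (fun s : R => F s * bessel_j g (s * tau) * s `^ (2 * g + 1)).
  by mfun => //; apply: (measurableT_comp mj); mfun.
have E := @RintegralMl _ _ _ mu _ mI (bessel_j g (t * tau) * gauss_weight g tau) _ (measurable_funTS mh).
rewrite -mulrA [RHS]mulrC -E; apply: eq_Rintegral => s _.
rewrite (mulrC tau s) (mulrC tau t); move: (gauss_weight g tau) => H.
by move: (F s) (s `^ _) (bessel_j g _) (bessel_j g _) => a b d e; ring.
Qed.

End conv_identity.

(** * Lebesgue measure on tuples and polar coordinates *)

Section tuples.
Context {R : realType}.
Local Notation mu := (@lebesgue_measure R).
Local Notation tup n := (n.-tuple (measurableTypeR R)).

Lemma tnth_tconsS n (p : measurableTypeR R * tup n) i : tnth (tcons p) (lift ord0 i) = tnth p.2 i.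
Proof. exact: tnthS. Qed.

Lemma measurable_tcons n : measurable_fun setT (@tcons R n).
Proof. exact: measurable_cons. Qed.

Lemma measurable_tcons2 d (T : measurableType d) n (c : T -> measurableTypeR R) (u : T -> tup n) :
  measurable_fun setT c -> measurable_fun setT u -> measurable_fun setT (fun p => tcons (c p, u p)).
Proof. by move=> mc mu'; apply: measurableT_comp (@measurable_tcons n) _; exact: measurable_fun_pair. Qed.

Definition orthant_tuples n : set (tup n) := [set u | orthant (vec u)].

Lemma orthant_tuplesP n (u : tup n) : orthant_tuples u <-> forall i, 0 < tnth u i.
Proof. by split=> h i; have := h i; rewrite mxE. Qed.

Lemma orthant_tcons n (p : measurableTypeR R * tup n) : orthant_tuples (tcons p) <-> 0 < p.1 /\ orthant_tuples p.2.
Proof.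
rewrite !orthant_tuplesP; split=> [h|[h1 h2] i].
  by split=> [|i]; [have := h ord0|have := h (lift ord0 i); rewrite tnth_tconsS].
by case: (unliftP ord0 i) => [j|] ->; rewrite ?tnth_tconsS.
Qed.

Lemma measurable_orthant_tuples n : measurable (@orthant_tuples n).
Proof.
rewrite (_ : orthant_tuples (n := n) = \bigcap_(i : 'I_n) ((fun u : tup n => tnth u i) @^-1` `]0, +oo[)).
  apply: fin_bigcap_measurable => [|i _]; first exact: finite_finset.
  by rewrite -[X in measurable X]setTI; apply: measurable_tnth => //; exact: measurable_itv.
apply/seteqP; split=> u.
  by rewrite orthant_tuplesP => h i _ /=; rewrite in_itv/= h.
by move=> h; rewrite orthant_tuplesP => i; have := h i Logic.I; rewrite /= in_itv/= andbT.
Qed.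

Local Open Scope ereal_scope.

Definition orthant_integral n (H : tup n -> \bar R) : \bar R :=
  \int[lebesgue_tuple n]_(u in @orthant_tuples n) H u.

Lemma orthant_integral0 (H : tup 0 -> \bar R) :
  orthant_integral H = H [tuple].
Proof.
rewrite /orthant_integral /= integral_dirac//.
- rewrite diracE mem_set ?mul1e//.
  by rewrite orthant_tuplesP => -[].
- exact: measurable_orthant_tuples.
- rewrite (_ : H = cst (H [tuple])); first exact: measurable_cst.
  by apply/funext => u; rewrite (tuple0 u).
Qed.

Let mI : measurable (`]0%R, +oo[%classic : set (measurableTypeR R)).
Proof. exact: measurable_itv. Qed.

(** Tonelli's theorem, peeling off the first coordinate: the induction step of the
    results on tuples. *)
Lemma orthant_integralS n (H : tup n.+1 -> \bar R) :
  measurable_fun setT H -> (forall u, 0 <= H u) ->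
  orthant_integral H =
  \int[mu]_(c in `]0%R, +oo[) orthant_integral (fun u => H (tcons (c, u))).
Proof.
move=> mH H0; rewrite /orthant_integral.
rewrite (_ : lebesgue_tuple n.+1 = pushforward (mu \x lebesgue_tuple n) (@tcons R n) :> (set _ -> \bar R))//.
rewrite ge0_integral_pushforward//; first last.
- exact: measurable_funTS.
- exact: measurable_orthant_tuples.
- exact: measurable_tcons.
rewrite (integral_setX mu (lebesgue_tuple n) _ _ (H \o @tcons R n)).
have mHt : measurable_fun setT (H \o @tcons R n).
  by apply: measurableT_comp => //; exact: measurable_tcons.
have mD : measurable (`]0%R, +oo[%classic `*` @orthant_tuples n : set (measurableTypeR R * tup n)).
  by apply: measurableX => //; exact: measurable_orthant_tuples.
rewrite (_ : tcons (n:=n) @^-1` _ = `]0%R, +oo[%classic `*` @orthant_tuples n); last first.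
  apply/seteqP; split=> -[c u] /=.
    by rewrite orthant_tcons/= in_itv/= => -[-> ?].
  by rewrite in_itv/= andbT => -[? ?]; rewrite orthant_tcons.
rewrite integral_mkcond fubini_tonelli1//.
- by apply/(measurable_restrictT (H \o @tcons R n)) => //; exact: measurable_funTS.
- by move=> z; rewrite patchE; case: ifPn => _ /=.
Qed.

Lemma ge0_orthant_integralZr n (H : tup n -> \bar R) (k : R) : measurable_fun setT H ->
  (forall u, 0 <= H u) -> (0 <= k)%R ->
  orthant_integral (fun u => H u * k%:E) = orthant_integral H * k%:E.
Proof.
move=> mH H0 k0; rewrite /orthant_integral ge0_integralZr//.
- exact: measurable_orthant_tuples.
- exact: measurable_funTS.
Qed.

Lemma measurable_orthant_integral d (T : measurableType d) n (H : T * tup n -> \bar R) :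
  measurable_fun setT H -> (forall u, 0 <= H u) ->
  measurable_fun setT (fun x => orthant_integral (fun u => H (x, u))).
Proof.
move=> mH H0; exact: (measurable_ge0_integral (lebesgue_tuple n) (@measurable_orthant_tuples n)).
Qed.

Definition tscale n (t : R) (u : tup n) : tup n := [tuple of [seq t * c | c <- u]]%R.

Lemma tnth_tscale n t (u : tup n) i : tnth (tscale t u) i = (t * tnth u i)%R.
Proof. by rewrite tnth_map. Qed.

Lemma tscale_tcons n t (p : measurableTypeR R * tup n) :
  tscale t (tcons p) = tcons ((t * p.1)%R : measurableTypeR R, tscale t p.2).
Proof. by apply: val_inj. Qed.

Lemma measurable_tscale d (T : measurableType d) n (t : T -> R) (u : T -> tup n) :
  measurable_fun setT t -> measurable_fun setT u ->
  measurable_fun setT (fun p => tscale (t p) (u p)).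
Proof.
move=> mt mu'; apply/measurable_fun_tnthP => i.
rewrite (_ : _ \o _ = fun p => t p * tnth (u p) i)%R; last first.
  by apply/funext => p /=; rewrite tnth_tscale.
apply: measurable_funM => //.
exact: (measurableT_comp (measurable_tnth i) mu').
Qed.

Lemma orthant_integral_scale n (t : R) (H : tup n -> \bar R) : (0 < t)%R ->
  measurable_fun setT H -> (forall u, 0 <= H u) ->
  orthant_integral H = orthant_integral (fun u => H (tscale t u) * (t ^+ n)%:E).
Proof.
move=> t0; elim: n H => [|n IH] H mH H0.
  by rewrite !orthant_integral0 expr0 mule1; congr H; rewrite (tuple0 (tscale _ _)).
have mHt : measurable_fun setT (fun u => H (tscale t u) * (t ^+ n.+1)%:E).
  apply: emeasurable_funM => //; apply: measurableT_comp => //.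
  exact: measurable_tscale.
have Ht0 u : 0 <= H (tscale t u) * (t ^+ n.+1)%:E.
  by rewrite mule_ge0// lee_fin exprn_ge0// ltW.
rewrite (orthant_integralS mHt Ht0) (orthant_integralS mH H0).
pose K (c : R) := orthant_integral (fun u : tup n => H (tcons (c : measurableTypeR R, tscale t u)) * (t ^+ n)%:E).
have mHc : measurable_fun setT (fun p : R * tup n =>
    H (tcons (p.1 : measurableTypeR R, tscale t p.2)) * (t ^+ n)%:E).
  apply: emeasurable_funM => //; apply: measurableT_comp => //.
  by apply: measurable_tcons2 => //; exact: measurable_tscale.
have Hc0 (p : R * tup n) : 0 <= H (tcons (p.1 : measurableTypeR R, tscale t p.2)) * (t ^+ n)%:E.
  by rewrite mule_ge0// lee_fin exprn_ge0// ltW.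
have mK : measurable_fun setT K by exact: (measurable_orthant_integral mHc Hc0).
have K0 c : 0 <= K c by apply: integral_ge0 => u _; exact: (Hc0 (c, u)).
transitivity (\int[mu]_(c in `]0%R, +oo[) K c).
  apply: eq_integral => c _; apply: IH => //.
  by apply: measurableT_comp => //; exact: measurable_tcons2.
rewrite (ge0_integral_scale_oy mK K0 t0); apply: eq_integral => c _.
rewrite /K -ge0_orthant_integralZr//.
- apply: eq_integral => u _.
  by rewrite tscale_tcons -muleA -EFinM -exprSr.
- exact: (measurableT_comp mHc (pair1_measurable _)).
- by move=> u; exact: (Hc0 (_, u)).
- exact: ltW.
Qed.

Definition sq_norm n (u : tup n) : R := (\sum_i tnth u i ^+ 2)%R.

Lemma sq_norm_ge0 n (u : tup n) : (0 <= sq_norm u)%R.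
Proof. by apply: sumr_ge0 => i _; exact: sqr_ge0. Qed.

Lemma sq_norm_tscale n t (u : tup n) : sq_norm (tscale t u) = (t ^+ 2 * sq_norm u)%R.
Proof. by rewrite /sq_norm mulr_sumr; apply: eq_bigr => i _; rewrite tnth_tscale exprMn. Qed.

Lemma measurable_sq_norm n : measurable_fun setT (@sq_norm n).
Proof.
apply: measurable_sum => i; apply: measurable_funX; exact: measurable_tnth.
Qed.

Let pos : R -> R := \1_(`]0%R, +oo[%classic : set (measurableTypeR R)).

Let posE (x : R) : pos x = (0 < x)%R%:R.
Proof. by rewrite /pos indicE mem_setE in_itv/= andbT. Qed.

Let subst_sphere (q : R) (W : R -> \bar R) : (0 <= q)%R ->
  measurable_fun setT W -> (forall c, 0 <= W c) ->
  \int[mu]_(c in `]0%R, +oo[) W c =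
  \int[mu]_(t in `]0%R, +oo[)
    (W (Num.sqrt (t ^+ 2 - q)) * (pos (t ^+ 2 - q)%R * (t / Num.sqrt (t ^+ 2 - q)))%:E).
Proof.
move=> q0 mW W0.
have lt_sq (t : R) : (Num.sqrt q < t)%R -> (0 < t ^+ 2 - q)%R.
  move=> h; have t0 : (0 < t)%R by exact: le_lt_trans (sqrtr_ge0 _) h.
  by rewrite subr_gt0 -[ltLHS](sqr_sqrtr q0) ltr_pXn2r ?nnegrE ?sqrtr_ge0// ltW.
have H1 (t : R) : (Num.sqrt q < t)%R -> (0 < Num.sqrt (t ^+ 2 - q))%R.
  by move=> h; rewrite sqrtr_gt0 lt_sq.
have H2 (y : R) : (0 < y)%R ->
    (Num.sqrt q < Num.sqrt (y ^+ 2 + q))%R /\ (Num.sqrt (Num.sqrt (y ^+ 2 + q) ^+ 2 - q) = y)%R.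
  move=> y0; have q1 : (0 < y ^+ 2 + q)%R by rewrite ltr_wpDr// exprn_gt0.
  split; first by rewrite ltr_sqrt// ltrDr exprn_gt0.
  by rewrite sqr_sqrtr ?(ltW q1)// addrK sqrtr_sqr gtr0_norm.
have H3 (t : R) : (Num.sqrt q < t)%R ->
    is_derive t 1%R (fun t => Num.sqrt (t ^+ 2 - q))%R (t / Num.sqrt (t ^+ 2 - q))%R.
  move=> h; have T0 := lt_sq _ h.
  have d1 : is_derive t 1%R (fun t : R => t ^+ 2 - q)%R (2 * t)%R.
    by apply: is_derive_eq; rewrite /GRing.scale/=; ring.
  have := @is_derive1_comp _ Num.sqrt (fun t : R => t ^+ 2 - q)%R t _ _ (is_derive1_sqrt T0) d1.
  have -> : ((2 * Num.sqrt (t ^+ 2 - q))^-1 * (2 * t) = t / Num.sqrt (t ^+ 2 - q))%R.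
    have : (Num.sqrt (t ^+ 2 - q) != 0)%R by rewrite gt_eqF// sqrtr_gt0.
    by move: (Num.sqrt _) => r r0; field.
  by [].
have H4 (t : R) : (Num.sqrt q < t)%R ->
    {for t, continuous (fun t : R => t / Num.sqrt (t ^+ 2 - q))%R}.
  move=> h; have T0 := lt_sq _ h.
  apply: cvgM; first exact: cvg_id.
  apply: cvgV; first by rewrite gt_eqF// sqrtr_gt0.
  apply: (@continuous_comp _ _ _ (fun t : R => t ^+ 2 - q)%R Num.sqrt).
    by apply: cvgB; [exact: exprn_continuous|exact: cvg_cst].
  exact: sqrt_continuous.
have H5 (t : R) : (Num.sqrt q < t)%R -> (0 < t / Num.sqrt (t ^+ 2 - q))%R.
  by move=> h; rewrite divr_gt0 ?H1//; exact: le_lt_trans (sqrtr_ge0 _) h.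
rewrite (@ge0_subst_oy _ _ _ _ _ _ _ H1 H2 H3 H4 H5 mW W0).
rewrite integral_mkcond [RHS]integral_mkcond; apply: eq_integral => t _.
rewrite !patchE !mem_setE !in_itv/= !andbT posE.
case: ifPn => [h|h].
  by rewrite (le_lt_trans (sqrtr_ge0 _) h) lt_sq// mul1r.
case: ifPn => [t0|//]; rewrite (_ : (0 < t ^+ 2 - q)%R = false) ?mul0r ?mule0//.
apply/negbTE; rewrite -leNgt subr_le0 -[leRHS](sqr_sqrtr q0).
by rewrite ler_pXn2r ?nnegrE ?sqrtr_ge0 ?(ltW t0)// leNgt.
Qed.

Lemma sphere_chartP n (u : tup n) : @sphere_chart R n u <-> orthant_tuples u /\ (sq_norm u < 1)%R.
Proof. by []. Qed.

(** With the last coordinates [u] fixed, put [y_0 = sqrt (t^2 - |u|^2)], so that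
    [dy_0 = t / y_0 dt]; exchange the integrals and dilate [u] by [t].  This matches
    the chart of the sphere as a graph over the ball. *)
Lemma polar_coordinates n (W : tup n.+1 -> \bar R) :
  measurable_fun setT W -> (forall y, 0 <= W y) ->
  orthant_integral W =
  \int[mu]_(t in `]0%R, +oo[) \int[lebesgue_tuple n]_(u in @sphere_chart R n)
    (W (tscale t (tcons (sphere_height u : measurableTypeR R, u))) *
     (t ^+ n / sphere_height u)%:E).
Proof.
move=> mW W0; rewrite (orthant_integralS mW W0) /orthant_integral.
have mWc : measurable_fun setT (W \o @tcons R n).
  by apply: measurableT_comp => //; exact: measurable_tcons.
have mDn := @measurable_orthant_tuples n.
rewrite (@ge0_integral_swap _ _ _ _ _ mu (lebesgue_tuple n) _ _ mI mDn _ mWc (fun z => W0 _)).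
pose V (z : tup n * R) := W (tcons (Num.sqrt (z.2 ^+ 2 - sq_norm z.1) : measurableTypeR R, z.1)) *
   (pos (z.2 ^+ 2 - sq_norm z.1)%R * (z.2 / Num.sqrt (z.2 ^+ 2 - sq_norm z.1)))%:E.
have mq : measurable_fun setT (fun z : tup n * R => sq_norm z.1).
  exact: (measurableT_comp (@measurable_sq_norm n) measurable_fst).
have mV : measurable_fun setT V.
  apply: emeasurable_funM; last by rewrite /pos; mfun.
  by apply: measurableT_comp => //; apply: measurable_tcons2 => //; mfun.
have V0 z : (0 < z.2)%R -> 0 <= V z.
  move=> z0; rewrite mule_ge0// lee_fin; apply: mulr_ge0; first by rewrite posE.
  by rewrite divr_ge0// ?sqrtr_ge0// ltW.
transitivity (\int[lebesgue_tuple n]_(u in @orthant_tuples n) \int[mu]_(t in `]0%R, +oo[) V (u, t)).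
  apply: eq_integral => u _.
  apply: (@subst_sphere (sq_norm u) (fun c => W (tcons (c : measurableTypeR R, u)))) => //.
    exact: sq_norm_ge0.
  by apply: measurableT_comp => //; exact: measurable_tcons2.
pose V' (z : tup n * R) := V z * (pos z.2)%:E.
have mV' : measurable_fun setT V' by apply: emeasurable_funM => //; rewrite /pos; mfun.
have V'0 z : 0 <= V' z.
  rewrite /V' posE; have [z0|z0] := ltP 0%R z.2; first by rewrite mule1 V0.
  by rewrite mule0.
have VE u t : (0 < t)%R -> V (u, t) = V' (u, t).
  by move=> t0; rewrite /V' posE t0 mule1.
transitivity (\int[lebesgue_tuple n]_(u in @orthant_tuples n) \int[mu]_(t in `]0%R, +oo[) V' (u, t)).
  by apply: eq_integral => u _; apply: eq_integral => t; rewrite inE/= in_itv/= andbT; exact: VE.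
rewrite (@ge0_integral_swap _ _ _ _ _ (lebesgue_tuple n) mu _ _ mDn mI _ mV' V'0).
apply: eq_integral => t; rewrite inE/= in_itv/= andbT => t0.
have mVt : measurable_fun setT (fun u => V' (u, t)) by exact: (measurableT_comp mV' (pair2_measurable t)).
have := orthant_integral_scale t0 mVt (fun u => V'0 (u, t)); rewrite /orthant_integral => ->.
rewrite integral_mkcond [RHS]integral_mkcond; apply: eq_integral => u _.
rewrite !patchE; case: ifPn => [up|up]; last first.
  rewrite ifF//; apply/negbTE; apply: contra up; rewrite !inE => /sphere_chartP[]//.
rewrite -VE// /V /= sq_norm_tscale posE.
have tE : (t ^+ 2 - t ^+ 2 * sq_norm u = t ^+ 2 * (1 - sq_norm u))%R by ring.
rewrite tE pmulr_rgt0 ?exprn_gt0// subr_gt0.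
case: ifPn => uc; last first.
  rewrite (_ : (sq_norm u < 1)%R = false) ?mul0r ?mule0 ?mul0e//.
  apply/negbTE; apply: contra uc => u1; rewrite inE; apply/sphere_chartP; split => //.
  by rewrite inE in up.
have u1 : (sq_norm u < 1)%R by move: uc; rewrite inE => /sphere_chartP[].
rewrite u1 mul1r sqrtrM ?sqr_ge0// sqrtr_sqr gtr0_norm// -muleA -EFinM tscale_tcons/=.
congr (_ * _%:E); rewrite /sphere_height -/(sq_norm u).
have : (Num.sqrt (1 - sq_norm u) != 0)%R by rewrite gt_eqF// sqrtr_gt0 subr_gt0.
by move: (Num.sqrt _) => r r0; field; rewrite r0 gt_eqF.
Qed.

End tuples.

(** * Iterated translations *)

Section iterated_translation.
Context {R : realType}.
Local Notation mu := (@lebesgue_measure R).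
Local Notation tup n := (n.-tuple (measurableTypeR R)).

Definition tbehead n (u : tup n.+1) : tup n := [tuple of behead u].

Lemma tuple_consE n (u : tup n.+1) : u = tcons (thead u, tbehead u).
Proof. by rewrite [LHS]tuple_eta; apply: val_inj. Qed.

Definition thead_real n (u : tup n.+1) : R := thead u.

Lemma measurable_thead n : measurable_fun setT (@thead_real n).
Proof. exact: measurable_tnth. Qed.

(** The multidimensional translation, by recursion on the dimension: the first
    coordinate is translated first, hence innermost, and the recursive call acts on
    the remaining ones. *)
Fixpoint iter_translation n : ('I_n -> R) -> tup n -> (tup n -> R) -> tup n -> R :=
  match n with
  | 0 => fun _ _ f x => f x
  | n'.+1 => fun g y f x =>
      iter_translation (g \o lift ord0) (tbehead y)
        (fun z => angular_cst (g ord0) * \int[mu]_(theta in `]0, pi[)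
          (f (tcons (Num.sqrt (cos_law (thead_real x) (thead_real y) theta) : measurableTypeR R, z))
           * sin theta `^ (2 * g ord0)))
        (tbehead x)
  end.

Local Open Scope ereal_scope.

(** The same operator on nonnegative functions, in extended reals: unlike
    [iter_translation], it does not turn divergent integrals into 0. *)
Fixpoint eiter_translation n : ('I_n -> R) -> tup n -> (tup n -> \bar R) -> tup n -> \bar R :=
  match n with
  | 0 => fun _ _ f x => f x
  | n'.+1 => fun g y f x =>
      eiter_translation (g \o lift ord0) (tbehead y)
        (fun z => \int[mu]_(theta in `]0%R, pi[)
          (f (tcons (Num.sqrt (cos_law (thead_real x) (thead_real y) theta) : measurableTypeR R, z))
           * (angular_cst (g ord0) * sin theta `^ (2 * g ord0))%:E))
        (tbehead x)
  end.

Let mP : measurable (`]0%R, pi[%classic : set (measurableTypeR R)).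
Proof. exact: measurable_itv. Qed.
Let mI : measurable (`]0%R, +oo[%classic : set (measurableTypeR R)).
Proof. exact: measurable_itv. Qed.

Lemma angular_cst_ge0 (g : R) : (-1 / 2 < g)%R -> (0 <= angular_cst g)%R.
Proof. by move=> g0; rewrite ltW// angular_cst_gt0. Qed.

Lemma eiter_translation_ge0 n (g : 'I_n -> R) (g0 : forall i, (-1 / 2 < g i)%R) y F x :
  (forall z, 0 <= F z) -> 0 <= eiter_translation g y F x.
Proof.
elim: n g g0 y F x => [|n IH] g g0 y F x F0 //=.
apply: IH => [i|z]; first exact: g0.
apply: integral_ge0 => th _; rewrite mule_ge0// lee_fin; apply: mulr_ge0; last exact: powR_ge0.
exact: angular_cst_ge0.
Qed.

Let measurable_step d (T : measurableType d) n (y : T -> tup n.+1) (x : tup n.+1) :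
  measurable_fun setT y ->
  measurable_fun setT (fun q : (T * tup n) * R =>
    (q.1.1, tcons (Num.sqrt (cos_law (thead_real x) (thead_real (y q.1.1)) q.2) : measurableTypeR R, q.1.2))).
Proof.
move=> my; apply: measurable_fun_pair => /=; first by mfun.
apply: measurable_tcons2; last by mfun.
have m1 : measurable_fun setT (fun q : (T * tup n) * R => thead_real (y q.1.1)).
  apply: (measurableT_comp (@measurable_thead n)); apply: (measurableT_comp my).
  by mfun.
by rewrite /cos_law; mfun.
Qed.

Lemma measurable_eiter_translation d (T : measurableType d) n (g : 'I_n -> R)
    (g0 : forall i, (-1 / 2 < g i)%R) (y : T -> tup n) (F : T * tup n -> \bar R) (x : tup n) :
  measurable_fun setT y -> measurable_fun setT F -> (forall q, 0 <= F q) ->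
  measurable_fun setT (fun p => eiter_translation g (y p) (fun z => F (p, z)) x).
Proof.
move=> my mF F0; elim: n g g0 y F x my mF F0 => [|n IH] g g0 y F x my mF F0 /=.
  exact: (measurableT_comp mF (pair2_measurable x)).
set F' : T * tup n -> \bar R := fun q => \int[mu]_(theta in `]0%R, pi[)
  (F (q.1, tcons (Num.sqrt (cos_law (thead_real x) (thead_real (y q.1)) theta) : measurableTypeR R, q.2))
           * (angular_cst (g ord0) * sin theta `^ (2 * g ord0))%:E).
have mK : measurable_fun setT (fun q : (T * tup n) * R =>
    F (q.1.1, tcons (Num.sqrt (cos_law (thead_real x) (thead_real (y q.1.1)) q.2) : measurableTypeR R, q.1.2))
    * (angular_cst (g ord0) * sin q.2 `^ (2 * g ord0))%:E).
  apply: emeasurable_funM; last by mfun.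
  exact: (measurableT_comp mF (measurable_step x my)).
have K0 (q : (T * tup n) * R) :
    0 <= F (q.1.1, tcons (Num.sqrt (cos_law (thead_real x) (thead_real (y q.1.1)) q.2) : measurableTypeR R, q.1.2))
    * (angular_cst (g ord0) * sin q.2 `^ (2 * g ord0))%:E.
  rewrite mule_ge0// lee_fin; apply: mulr_ge0; last exact: powR_ge0.
  exact: angular_cst_ge0.
have mF' : measurable_fun setT F' by exact: (measurable_ge0_integral mu mP mK K0).
have F'0 q : 0 <= F' q by apply: integral_ge0 => th _; exact: (K0 (q, th)).
apply: (IH (g \o lift ord0) _ (fun p => tbehead (y p)) F') => //.
- by move=> i; exact: g0.
- exact: (measurableT_comp (@measurable_behead _ _ _) my).
Qed.

Lemma measurable_iter_translation d (T : measurableType d) n (g : 'I_n -> R)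
    (y : T -> tup n) (F : T * tup n -> R) (x : tup n) :
  measurable_fun setT y -> measurable_fun setT F ->
  measurable_fun setT (fun p => iter_translation g (y p) (fun z => F (p, z)) x).
Proof.
move=> my mF; elim: n g y F x my mF => [|n IH] g y F x my mF /=.
  exact: (measurableT_comp mF (pair2_measurable x)).
set F' : T * tup n -> R := (fun q => angular_cst (g ord0) * \int[mu]_(theta in `]0, pi[)
  (F (q.1, tcons (Num.sqrt (cos_law (thead_real x) (thead_real (y q.1)) theta) : measurableTypeR R, q.2))
           * sin theta `^ (2 * g ord0)))%R.
have mK : measurable_fun setT (fun q : (T * tup n) * R =>
    F (q.1.1, tcons (Num.sqrt (cos_law (thead_real x) (thead_real (y q.1.1)) q.2) : measurableTypeR R, q.1.2))
    * sin q.2 `^ (2 * g ord0))%R.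
  apply: measurable_funM; last by mfun.
  exact: (measurableT_comp mF (measurable_step x my)).
have mF' : measurable_fun setT F'.
  by apply: measurable_funM => //; exact: (@measurable_Rintegral _ _ _ _ _ mu _ mP _ mK).
apply: (IH (g \o lift ord0) (fun p => tbehead (y p)) F') => //.
exact: (measurableT_comp (@measurable_behead _ _ _) my).
Qed.

Let S0 (g0 : R) : (-1 / 2 < g0)%R -> forall th : R, (0 <= angular_cst g0 * sin th `^ (2 * g0))%R.
Proof. by move=> h th; apply: mulr_ge0; [exact: angular_cst_ge0|exact: powR_ge0]. Qed.

Lemma le_eiter_translation n (g : 'I_n -> R) (g0 : forall i, (-1 / 2 < g i)%R) y (F G : tup n -> \bar R) x :
  (forall z, 0 <= F z) -> (forall z, F z <= G z) -> eiter_translation g y F x <= eiter_translation g y G x.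
Proof.
elim: n g g0 y F G x => [|n IH] g g0 y F G x F0 FG //=.
apply: IH => [i|z|z]; first exact: g0.
  by apply: integral_ge0 => th _; rewrite mule_ge0// lee_fin S0.
apply: le_ge0_integral => th _; first by rewrite mule_ge0// lee_fin S0.
by rewrite lee_wpmul2r// lee_fin S0.
Qed.

(** The inequality survives divergent inner integrals, since these count as 0 on the
    left and as infinity on the right. *)
Lemma abs_iter_translation_le n (g : 'I_n -> R) (g0 : forall i, (-1 / 2 < g i)%R) y (f : tup n -> R) x :
  measurable_fun setT f ->
  `|iter_translation g y f x|%:E <= eiter_translation g y (fun z => `|f z|%:E) x.
Proof.
elim: n g g0 y f x => [|n IH] g g0 y f x mf //=.
have mK : measurable_fun setT (fun q : tup n * R =>
    f (tcons (Num.sqrt (cos_law (thead_real x) (thead_real y) q.2) : measurableTypeR R, q.1))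
    * sin q.2 `^ (2 * g ord0))%R.
  apply: measurable_funM; last by mfun.
  apply: (measurableT_comp mf); apply: measurable_tcons2; last by mfun.
  by rewrite /cos_law; mfun.
have mh : measurable_fun setT (fun z : tup n => angular_cst (g ord0) * \int[mu]_(theta in `]0, pi[)
    (f (tcons (Num.sqrt (cos_law (thead_real x) (thead_real y) theta) : measurableTypeR R, z))
           * sin theta `^ (2 * g ord0)))%R.
  by apply: measurable_funM => //; exact: (@measurable_Rintegral _ _ _ _ _ mu _ mP _ mK).
apply: le_trans (IH _ _ _ _ _ mh) _; first by move=> i; exact: g0.
apply: le_eiter_translation => [i|z|z]; [exact: g0|by rewrite lee_fin|].
have mKz : measurable_fun setT (fun th : R =>
    f (tcons (Num.sqrt (cos_law (thead_real x) (thead_real y) th) : measurableTypeR R, z))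
    * sin th `^ (2 * g ord0))%R by exact: (measurableT_comp mK (pair1_measurable z)).
have k0 := angular_cst_ge0 (g0 ord0).
rewrite normrM (ger0_norm k0) EFinM.
apply: le_trans (lee_wpmul2l _ (le_abs_Rintegral mu mP (measurable_funTS mKz))) _.
  by rewrite lee_fin.
rewrite -ge0_integralZl//.
- apply: le_ge0_integral => th _; first by rewrite -EFinM lee_fin mulr_ge0.
  by rewrite -!EFinM lee_fin normrM (ger0_norm (powR_ge0 _ _)) mulrCA.
- apply: measurable_funTS; apply/measurable_EFinP.
  by apply: measurableT_comp; [exact: normr_measurable|exact: mKz].
Qed.

(** The weight [y^a], with [a_i = 2 g_i + 1]. *)
Definition pow_weight n (g : 'I_n -> R) (y : tup n) : R := (\prod_i tnth y i `^ (2 * g i + 1))%R.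

Lemma pow_weight_ge0 n (g : 'I_n -> R) y : (0 <= pow_weight g y)%R.
Proof. by apply: prodr_ge0 => i _; exact: powR_ge0. Qed.

Lemma pow_weight_tcons n (g : 'I_n.+1 -> R) (p : measurableTypeR R * tup n) :
  pow_weight g (tcons p) = (p.1 `^ (2 * g ord0 + 1) * pow_weight (g \o lift ord0) p.2)%R.
Proof.
rewrite /pow_weight big_ord_recl; congr (_ * _)%R.
by apply: eq_bigr => i _; rewrite tnth_tconsS.
Qed.

Lemma measurable_pow_weight n (g : 'I_n -> R) : measurable_fun setT (pow_weight g).
Proof.
apply: measurable_prod => i _.
exact: (measurableT_comp (measurable_powR _) (measurable_tnth i)).
Qed.

Lemma normalized_translation_mass (g t : R) (F : R -> \bar R) : (-1 / 2 < g)%R -> (0 < t)%R ->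
  measurable_fun setT F -> (forall x, 0 <= F x) ->
  \int[mu]_(s in `]0%R, +oo[) ((\int[mu]_(x in `]0%R, pi[)
     (F (Num.sqrt (cos_law t s x)) * (angular_cst g * sin x `^ (2 * g))%:E)) * (s `^ (2 * g + 1))%:E) =
  \int[mu]_(s in `]0%R, +oo[) (F s * (s `^ (2 * g + 1))%:E).
Proof.
move=> g0 t0 mF F0.
have mt : measurable_fun setT (fun z : R * R => F (Num.sqrt (cos_law z.1 t z.2))).
  by apply: measurableT_comp => //; rewrite /cos_law; mfun.
have k0 := angular_cst_gt0 g0.
pose H (z : R * R) := F (Num.sqrt (cos_law z.1 t z.2)) * (sin z.2 `^ (2 * g) * z.1 `^ (2 * g + 1))%:E.
have mH : measurable_fun setT H by apply: emeasurable_funM => //; mfun.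
have H0 z : 0 <= H z.
  by apply: mule_ge0; [exact: F0|rewrite lee_fin; apply: mulr_ge0; exact: powR_ge0].
transitivity ((angular_cst g)%:E * \int[mu]_(s in `]0%R, +oo[) \int[mu]_(x in `]0%R, pi[) H (s, x)).
  rewrite -(@ge0_integralZl2 _ _ _ _ _ mu mu _ _ mI mP _ _ (ltW k0) mH H0).
  apply: eq_integral => s _.
  have mKs : measurable_fun setT (fun x : R => F (Num.sqrt (cos_law t s x)) * (angular_cst g * sin x `^ (2 * g))%:E).
    by apply: emeasurable_funM; [apply: measurableT_comp => //; rewrite /cos_law|]; mfun.
  have K0 x : 0 <= F (Num.sqrt (cos_law t s x)) * (angular_cst g * sin x `^ (2 * g))%:E.
    by apply: mule_ge0; [exact: F0|rewrite lee_fin S0].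
  have s0 : 0 <= (s `^ (2 * g + 1))%:E by rewrite lee_fin powR_ge0.
  have mKs' := measurable_funTS (D := `]0%R, pi[%classic : set (measurableTypeR R)) mKs.
  rewrite -(@ge0_integralZr _ _ _ mu _ mP _ mKs' _ (fun x _ => K0 x) s0).
  apply: eq_integral => x _; rewrite /H /=.
  have -> : cos_law t s x = cos_law s t x by rewrite /cos_law; ring.
  rewrite muleCA -muleA -!EFinM; congr (_ * _%:E).
  by rewrite mulrA.
have := @translation_mass R g t F t0 mF F0; rewrite /H => ->.
rewrite muleA (_ : (angular_cst g)%:E * _ = 1) ?mul1e//.
have := angular_cst_mass g0; rewrite /Rintegral => E1.
have iS := sin_mass_fin g0.
have i0 : 0 <= \int[mu]_(x in `]0%R, pi[) (sin x `^ (2 * g))%:E.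
  by apply: integral_ge0 => x _; rewrite lee_fin powR_ge0.
rewrite integral_0pi_oo in E1; last by mfun.
by rewrite -[X in _%:E * X]fineK ?ge0_fin_numE// -EFinM E1.
Qed.

(** Induction on the dimension: the recursive call preserves the mass in the last
    coordinates, and [normalized_translation_mass] that in the first one. *)
Lemma eiter_translation_mass n (g : 'I_n -> R) (g0 : forall i, (-1 / 2 < g i)%R) (F : tup n -> \bar R) (x : tup n) :
  orthant_tuples x -> measurable_fun setT F -> (forall z, 0 <= F z) ->
  orthant_integral (fun y => eiter_translation g y F x * (pow_weight g y)%:E) =
  orthant_integral (fun z => F z * (pow_weight g z)%:E).
Proof.
elim: n g g0 F x => [|n IH] g g0 F x px mF F0.
  by rewrite !orthant_integral0/=; congr (F _ * _); rewrite (tuple0 x).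
have x0 : (0 < thead_real x)%R by move/orthant_tuplesP : px => /(_ ord0).
have px' : orthant_tuples (tbehead x) by move: px; rewrite {1}[x]tuple_consE => /orthant_tcons[].
pose g' := g \o lift ord0; have g'0 i : (-1 / 2 < g' i)%R by exact: g0.
have mW m (k : 'I_m -> R) : measurable_fun setT (fun y : tup m => (pow_weight k y)%:E).
  by apply/measurable_EFinP; exact: measurable_pow_weight.
have mFt : measurable_fun setT (fun p : tup n.+1 * tup n.+1 => F p.2) by exact: measurableT_comp.
have mL : measurable_fun setT (fun y : tup n.+1 => eiter_translation g y F x * (pow_weight g y)%:E).
  apply: emeasurable_funM; last exact: mW.
  exact: (@measurable_eiter_translation _ _ _ g g0 id (fun p => F p.2)).
have L0 (y : tup n.+1) : 0 <= eiter_translation g y F x * (pow_weight g y)%:E.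
  by rewrite mule_ge0 ?eiter_translation_ge0// lee_fin pow_weight_ge0.
have mR : measurable_fun setT (fun y : tup n.+1 => F y * (pow_weight g y)%:E).
  by apply: emeasurable_funM => //; exact: mW.
have R0 (y : tup n.+1) : 0 <= F y * (pow_weight g y)%:E.
  by rewrite mule_ge0// lee_fin pow_weight_ge0.
rewrite (orthant_integralS mL L0) (orthant_integralS mR R0).
pose h (c : R) (z : tup n) := \int[mu]_(theta in `]0%R, pi[)
   (F (tcons (Num.sqrt (cos_law (thead_real x) c theta) : measurableTypeR R, z))
           * (angular_cst (g ord0) * sin theta `^ (2 * g ord0))%:E).
have mk : measurable_fun setT (fun q : (R * tup n) * R =>
    F (tcons (Num.sqrt (cos_law (thead_real x) q.1.1 q.2) : measurableTypeR R, q.1.2))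
    * (angular_cst (g ord0) * sin q.2 `^ (2 * g ord0))%:E).
  apply: emeasurable_funM; last by mfun.
  apply: (measurableT_comp mF); apply: measurable_tcons2; last by mfun.
  by rewrite /cos_law; mfun.
have k0 (q : (R * tup n) * R) :
   0 <= F (tcons (Num.sqrt (cos_law (thead_real x) q.1.1 q.2) : measurableTypeR R, q.1.2))
    * (angular_cst (g ord0) * sin q.2 `^ (2 * g ord0))%:E.
  by rewrite mule_ge0// lee_fin S0.
have mh : measurable_fun setT (fun q : R * tup n => h q.1 q.2).
  exact: (measurable_ge0_integral mu mP mk k0).
have h0 c z : 0 <= h c z by apply: integral_ge0 => th _; exact: (k0 ((c, z), th)).
pose H (q : R * tup n) := h q.1 q.2 * (pow_weight g' q.2)%:E * (q.1 `^ (2 * g ord0 + 1))%:E.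
have mH : measurable_fun setT H.
  apply: emeasurable_funM; last by mfun.
  apply: emeasurable_funM => //.
  exact: (measurableT_comp (mW n g') measurable_snd).
have H0 q : 0 <= H q.
  by apply: mule_ge0; [apply: mule_ge0 => //|]; rewrite lee_fin ?pow_weight_ge0 ?powR_ge0.
transitivity (\int[mu]_(c in `]0%R, +oo[) orthant_integral (fun z => H (c, z))).
  apply: eq_integral => c _.
  have mhc : measurable_fun setT (h c) by exact: (measurableT_comp mh (pair1_measurable c)).
  have mA : measurable_fun setT (fun u => eiter_translation g' u (h c) (tbehead x) * (pow_weight g' u)%:E).
    apply: emeasurable_funM; last exact: mW.
    apply: (@measurable_eiter_translation _ _ _ g' g'0 id (fun p => h c p.2)) => //.
    exact: measurableT_comp.
  have A0 u : 0 <= eiter_translation g' u (h c) (tbehead x) * (pow_weight g' u)%:E.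
    by rewrite mule_ge0 ?eiter_translation_ge0// lee_fin pow_weight_ge0.
  have mB : measurable_fun setT (fun u => h c u * (pow_weight g' u)%:E).
    by apply: emeasurable_funM => //; exact: mW.
  have B0 u : 0 <= h c u * (pow_weight g' u)%:E by rewrite mule_ge0// lee_fin pow_weight_ge0.
  have p0 : (0 <= c `^ (2 * g ord0 + 1))%R by exact: powR_ge0.
  rewrite /H (ge0_orthant_integralZr mB B0 p0) -(IH g' g'0 (h c) _ px' mhc (h0 c)).
  rewrite -(ge0_orthant_integralZr mA A0 p0); apply: eq_integral => u _.
  rewrite pow_weight_tcons EFinM -muleA [(pow_weight _ _)%:E * _]muleC; congr (_ * _).
  rewrite /= /h; congr (eiter_translation g' _ _ _).
  by apply: val_inj.
pose H2 (q : R * tup n) :=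
  F (tcons (q.1 : measurableTypeR R, q.2)) * (pow_weight g (tcons (q.1 : measurableTypeR R, q.2)))%:E.
have mH2 : measurable_fun setT H2 by exact: (measurableT_comp mR (@measurable_tcons R n)).
have mDn := @measurable_orthant_tuples R n.
rewrite /orthant_integral.
rewrite (@ge0_integral_swap _ _ _ _ _ mu (lebesgue_tuple n) _ _ mI mDn _ mH H0).
rewrite (@ge0_integral_swap _ _ _ _ _ mu (lebesgue_tuple n) _ _ mI mDn _ mH2 (fun q => R0 _)).
apply: eq_integral => u _.
have mFu : measurable_fun setT (fun c : R => F (tcons (c : measurableTypeR R, u))).
  by apply: (measurableT_comp mF); exact: measurable_tcons2.
have w0 : 0 <= (pow_weight g' u)%:E by rewrite lee_fin pow_weight_ge0.
have E := normalized_translation_mass (g0 ord0) x0 mFu (fun c => F0 _).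
transitivity ((pow_weight g' u)%:E * \int[mu]_(c in `]0%R, +oo[) (h c u * (c `^ (2 * g ord0 + 1))%:E)).
  rewrite -ge0_integralZl//.
  - by apply: eq_integral => c _; rewrite /H /= -muleA muleCA.
  - apply: measurable_funTS; apply: emeasurable_funM; last by mfun.
    exact: (measurableT_comp mh (pair2_measurable u)).
  - by move=> c _; rewrite mule_ge0// lee_fin powR_ge0.
rewrite /h E -ge0_integralZl//.
- by apply: eq_integral => c _; rewrite /H2 pow_weight_tcons/= EFinM -/g' muleCA [(pow_weight _ _)%:E * _]muleC.
- by apply: measurable_funTS; apply: emeasurable_funM => //; mfun.
- by move=> c _; rewrite mule_ge0// lee_fin powR_ge0.
Qed.

Local Close Scope ereal_scope.

(** For positive sides and an angle in the open range the third side is positive,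
    so only values on the orthant are met. *)
Lemma iter_translation_ext n (g : 'I_n -> R) (f f' : tup n -> R) y x :
  orthant_tuples y -> orthant_tuples x -> (forall z, orthant_tuples z -> f z = f' z) ->
  iter_translation g y f x = iter_translation g y f' x.
Proof.
elim: n g f f' y x => [|n IH] g f f' y x py px ff' /=; first exact: ff'.
have x0 : 0 < thead_real x by move/orthant_tuplesP : px => /(_ ord0).
have y0 : 0 < thead_real y by move/orthant_tuplesP : py => /(_ ord0).
apply: IH => [||z pz].
- by move: py; rewrite {1}[y]tuple_consE => /orthant_tcons[].
- by move: px; rewrite {1}[x]tuple_consE => /orthant_tcons[].
congr (_ * _); apply: eq_Rintegral => th; rewrite inE/= in_itv/= => th0.
rewrite ff'//; apply/orthant_tcons; split => //=.
by rewrite sqrtr_gt0; exact: cos_law_gt0.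
Qed.

(** [tcons] for row vectors, the carrier of the points. *)
Definition vcons n (c : R) (z : 'rV[R]_n) : 'rV[R]_n.+1 :=
  \row_i oapp (fun j => z 0 j) c (unlift ord0 i).

Lemma vcons_vec n c (u : tup n) : vcons c (vec u) = vec (tcons (c : measurableTypeR R, u)).
Proof.
apply/rowP => i; rewrite !mxE; case: (unliftP ord0 i) => [j|] -> /=.
  by rewrite mxE tnth_tconsS.
by [].
Qed.

Lemma set_coord_vcons n c (z : 'rV[R]_n) i r :
  set_coord (vcons c z) (lift ord0 i) r = vcons c (set_coord z i r).
Proof.
apply/rowP => j; rewrite !mxE; case: (unliftP ord0 j) => [k|] -> /=.
  by rewrite mxE (inj_eq lift_inj).
by [].
Qed.

Lemma set_coord_vcons0 n c (z : 'rV[R]_n) r : set_coord (vcons c z) ord0 r = vcons r z.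
Proof.
by apply/rowP => j; rewrite !mxE; case: (unliftP ord0 j) => [k|] ->.
Qed.

Lemma foldl_lift n (al : 'I_n.+1 -> R) (y : 'I_n.+1 -> R) (G : 'rV[R]_n.+1 -> R) c z (s : seq 'I_n) :
  foldl (fun h i => coord_translation (al i) i (y i) h) G [seq lift ord0 i | i <- s] (vcons c z) =
  foldl (fun h i => coord_translation (al (lift ord0 i)) i (y (lift ord0 i)) h)
    (fun w => G (vcons c w)) s z.
Proof.
elim: s G z => [|i s IH] G z //=.
rewrite IH; apply: (congr1 (fun F => foldl _ F s z)); apply/funext => w.
rewrite /coord_translation; congr (translation1 _ _ _ _).
  by apply/funext => r; rewrite set_coord_vcons.
by rewrite mxE liftK.
Qed.

Lemma foldl_iter_translation n (al : 'I_n -> R) (y x : tup n) (f : 'rV[R]_n -> R) :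
  foldl (fun h i => coord_translation (al i) i (tnth y i) h) f (enum 'I_n) (vec x) =
  iter_translation al y (f \o @vec R n) x.
Proof.
elim: n al y x f => [|n IH] al y x f /=.
  by rewrite (_ : enum 'I_0 = [::])//; apply: size0nil; rewrite size_enum_ord.
rewrite enum_ordSl/= [x in vec x]tuple_consE -vcons_vec foldl_lift.
transitivity (foldl (fun h i => coord_translation ((al \o lift ord0) i) i (tnth (tbehead y) i) h)
   (fun w => coord_translation (al ord0) ord0 (tnth y ord0) f (vcons (thead x) w))
   (enum 'I_n) (vec (tbehead x))).
  apply: (congr1 (fun k => foldl k _ (enum 'I_n) (vec (tbehead x)))).
  apply/funext => h; apply/funext => i.
  by rewrite [y in LHS]tuple_consE tnth_tconsS.
rewrite IH; apply: (congr1 (fun F => iter_translation _ _ F _)); apply/funext => z /=.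
rewrite /coord_translation /translation1; congr (_ * _).
rewrite Rintegral_0pi_open; apply: eq_Rintegral => th _; congr (_ * _).
have -> : vcons (thead x) (vec z) 0 ord0 = thead x by rewrite mxE unlift_none.
by rewrite set_coord_vcons0 vcons_vec.
Qed.

Lemma bessel_translationE n (a : 'rV[R]_n) (y x : tup n) (f : 'rV[R]_n -> R) :
  bessel_translation a (vec y) f (vec x) =
  iter_translation (fun i => (a 0 i - 1) / 2) y (f \o @vec R n) x.
Proof.
rewrite -foldl_iter_translation /bessel_translation; apply: (congr1 (fun k => foldl k f (enum 'I_n) (vec x))).
by apply/funext => h; apply/funext => i; rewrite mxE.
Qed.

End iterated_translation.

(** * Integrability of the spherical mean *)

Section spherical_mean_integrable.
Context {R : realType}.
Local Notation mu := (@lebesgue_measure R).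
Local Notation tup n := (n.-tuple (measurableTypeR R)).
Variables (n : nat) (a : 'rV[R]_n.+1) (f : 'rV[R]_n.+1 -> R) (x : 'rV[R]_n.+1).
Hypotheses (a0 : forall i, 0 < a 0 i) (fL1 : L1_weighted a f) (x0 : orthant x).

Let g i := (a 0 i - 1) / 2.
Let g0 i : -1 / 2 < g i. Proof. by have := a0 i; rewrite /g => h; lra. Qed.

Let wprodE (y : tup n.+1) : pow_weight g y = mxpow (vec y) a.
Proof.
apply: eq_bigr => i _; rewrite mxE; congr (_ `^ _).
by rewrite /g mulrC divfK// subrK.
Qed.

Let xt : tup n.+1 := [tuple x 0 i | i < n.+1].
Let xtE : vec xt = x. Proof. by apply/rowP => i; rewrite mxE tnth_mktuple. Qed.
Let xt0 : orthant_tuples xt. Proof. by rewrite /orthant_tuples /= xtE. Qed.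

Let ft : tup n.+1 -> R := (f \o @vec R n.+1) \_ (@orthant_tuples R n.+1).
Let mpos := @measurable_orthant_tuples R n.+1.

Let pow_weight_gt0 (y : tup n.+1) : orthant_tuples y -> 0 < pow_weight g y.
Proof. by move=> /orthant_tuplesP py; apply: prodr_gt0 => i _; rewrite powR_gt0. Qed.

Let mft : measurable_fun setT ft.
Proof.
apply/(measurable_restrictT (f \o @vec R n.+1)) => //.
have /integrableP[/measurable_EFinP m1 _] := fL1.
have m2 : measurable_fun (@orthant_tuples R n.+1) (fun u => f (vec u) * mxpow (vec u) a * (pow_weight g u)^-1).
  apply: measurable_funM => //.
  apply: measurable_funTS; apply: (measurableT_comp (@measurable_invr R)).
  exact: measurable_pow_weight.
apply: eq_measurable_fun m2 => u; rewrite inE => pu.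
by rewrite -wprodE mulfK// gt_eqF// pow_weight_gt0.
Qed.

Let W (y : tup n.+1) : \bar R := (eiter_translation g y (fun z => `|ft z|%:E) xt * (pow_weight g y)%:E)%E.

Let W0 y : (0 <= W y)%E.
Proof. by apply: mule_ge0; [apply: eiter_translation_ge0 => // z; rewrite lee_fin|rewrite lee_fin pow_weight_ge0]. Qed.

Let mW : measurable_fun setT W.
Proof.
apply: emeasurable_funM; last by apply/measurable_EFinP; exact: measurable_pow_weight.
apply: (@measurable_eiter_translation _ _ _ _ g g0 id (fun p => `|ft p.2|%:E)) => //.
apply/measurable_EFinP; apply: (measurableT_comp (@normr_measurable _ _)).
exact: measurableT_comp.
Qed.

Let W_fin : (orthant_integral W < +oo)%E.
Proof.
rewrite /W eiter_translation_mass//; last by apply/measurable_EFinP; exact: (measurableT_comp (@normr_measurable _ _)).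
have /integrableP[_] := fL1; apply: le_lt_trans.
rewrite le_eqVlt; apply/orP; left; apply/eqP; apply: eq_integral => u; rewrite inE => pu.
rewrite /ft patchE mem_set//= -wprodE.
by rewrite normrM (ger0_norm (pow_weight_ge0 g u)).
Qed.

Let measurable_chart : measurable (@sphere_chart R n).
Proof.
rewrite (_ : @sphere_chart R n = @orthant_tuples R n `&` (@sq_norm R n @^-1` `]-oo, 1[)).
  apply: measurableI; first exact: measurable_orthant_tuples.
  by rewrite -[X in measurable X]setTI; apply: measurable_sq_norm => //; exact: measurable_itv.
by apply/seteqP; split=> u /=; rewrite /sphere_chart /= in_itv.
Qed.

Let h (u : tup n) : R := sphere_height u.
Let mh : measurable_fun setT h.
Proof.
have mq := @measurable_sq_norm R n.
rewrite /h /sphere_height -[X in measurable_fun _ X]/(fun u => Num.sqrt (1 - sq_norm u)).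
by mfun.
Qed.

Let pt (t : R) (u : tup n) : tup n.+1 := tscale t (tcons (h u : measurableTypeR R, u)).

Let m_pt : measurable_fun setT (fun z : R * tup n => pt z.1 z.2).
Proof.
apply: measurable_tscale; first by mfun.
by apply: measurable_tcons2; [exact: (measurableT_comp mh)|mfun].
Qed.

Let K (z : R * tup n) : R := iter_translation g (pt z.1 z.2) ft xt * pow_weight g (pt 1 z.2) / h z.2.

Let mK : measurable_fun setT K.
Proof.
apply: measurable_funM; last first.
  exact: (measurableT_comp (@measurable_invr R) (measurableT_comp mh measurable_snd)).
apply: measurable_funM.
  apply: (@measurable_iter_translation _ _ _ _ g (fun z : R * tup n => pt z.1 z.2) (fun p => ft p.2)) => //.
  exact: measurableT_comp.
have m1 : measurable_fun setT (fun z : R * tup n => ((1 : R), z.2)) by exact: measurable_fun_pair.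
exact: (measurableT_comp (@measurable_pow_weight _ _ g) (measurableT_comp m_pt m1)).
Qed.

Let C := (sphere_integral (fun theta => mxpow theta a))^-1.
Let Psi (t : R) := C * \int[lebesgue_tuple n]_(u in @sphere_chart R n) K (t, u).

Let mPsi : measurable_fun setT Psi.
Proof.
apply: measurable_funM => //.
exact: (@measurable_Rintegral _ _ _ _ _ (lebesgue_tuple n) _ measurable_chart _ mK).
Qed.

Let h_gt0 u : @sphere_chart R n u -> 0 < h u.
Proof. by move=> /sphere_chartP[_ u1]; rewrite /h /sphere_height sqrtr_gt0 subr_gt0. Qed.

Let pt_pos t u : 0 < t -> @sphere_chart R n u -> orthant_tuples (pt t u).
Proof.
move=> t0 uc; apply/orthant_tuplesP => i; rewrite tnth_tscale mulr_gt0//.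
move: i; apply/orthant_tuplesP; apply/orthant_tcons; split; first exact: h_gt0.
by case/sphere_chartP: uc.
Qed.

Let PsiE t : 0 < t -> spherical_mean a f x t = Psi t.
Proof.
move=> t0; rewrite /spherical_mean /Psi -/C.
apply: (congr1 (fun q => C * q)); apply: eq_Rintegral => u.
rewrite inE => uc; rewrite /K /=.
have -> : pow_weight g (pt 1 u) = mxpow (sphere_point u) a.
  rewrite wprodE; congr (mxpow _ _).
  by apply/rowP => i; rewrite !mxE tnth_tscale mul1r.
suff -> : bessel_translation a (t *: sphere_point u) f x = iter_translation g (pt t u) ft xt by [].
have -> : t *: sphere_point u = vec (pt t u).
  by apply/rowP => i; rewrite !mxE tnth_tscale.
rewrite -xtE bessel_translationE; apply: iter_translation_ext => //; first exact: pt_pos.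
by move=> z pz; rewrite /ft patchE mem_set.
Qed.

Let prod_powR (t : R) (b : 'I_n.+1 -> R) : 0 < t -> \prod_i t `^ b i = t `^ (\sum_i b i).
Proof.
move=> t0; apply/esym/(big_morph (fun c => t `^ c)); last exact: powRr0.
by move=> c d; rewrite powRD// (gt_eqF t0) implybT.
Qed.

Let pow_weight_pt t u : 0 < t -> @sphere_chart R n u ->
  pow_weight g (pt t u) = t `^ (\sum_i a 0 i) * pow_weight g (pt 1 u).
Proof.
move=> t0 uc; have /orthant_tuplesP p1 := pt_pos ltr01 uc.
rewrite -prod_powR// -big_split/=; apply: eq_bigr => i _.
have -> : tnth (pt t u) i = t * tnth (pt 1 u) i by rewrite !tnth_tscale mul1r.
rewrite powRM ?(ltW t0) ?(ltW (p1 i))//; congr (_ `^ _ * _).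
by rewrite /g mulrC divfK// subrK.
Qed.

(** Off the orthant [f] is replaced by 0, which makes it measurable.  Then polar
    coordinates bound the integral by the mass of the iterated translations of [|f|]
    at [x], which is that of [|f|]. *)
Lemma spherical_mean_integrable : exists Psi : R -> R,
  [/\ measurable_fun setT Psi,
      forall t, 0 < t -> spherical_mean a f x t = Psi t &
      (\int[mu]_(t in `]0%R, +oo[) (`|Psi t| * t `^ (2 * mean_order a + 1))%:E < +oo)%E].
Proof.
exists Psi; split => //.
have pE : 2 * mean_order a + 1 = n%:R + \sum_i a 0 i.
  by rewrite /mean_order -addn1 natrD; field.
have tE (t : R) : 0 < t -> t `^ (2 * mean_order a + 1) = t `^ (\sum_i a 0 i) * t ^+ n.
  move=> t0; rewrite pE powRD ?(gt_eqF t0) ?implybT//.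
  by rewrite powR_mulrn ?(ltW t0)// mulrC.
pose I (t : R) := (\int[lebesgue_tuple n]_(u in @sphere_chart R n)
    (W (pt t u) * (t ^+ n / h u)%:E))%E.
have mIt : measurable_fun setT (fun z : R * tup n =>
    (W (pt z.1 z.2) * (`|z.1| ^+ n / h z.2)%:E)%E).
  apply: emeasurable_funM; first exact: (measurableT_comp mW m_pt).
  apply/measurable_EFinP; apply: measurable_funM; first by mfun.
  exact: (measurableT_comp (@measurable_invr R) (measurableT_comp mh measurable_snd)).
have It0 (z : R * tup n) : (0 <= W (pt z.1 z.2) * (`|z.1| ^+ n / h z.2)%:E)%E.
  rewrite mule_ge0// lee_fin divr_ge0 ?exprn_ge0// /h /sphere_height; exact: sqrtr_ge0.
have mI' : measurable_fun setT (fun t : R => (\int[lebesgue_tuple n]_(u in @sphere_chart R n)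
    (W (pt t u) * (`|t| ^+ n / h u)%:E))%E).
  exact: (measurable_ge0_integral (lebesgue_tuple n) measurable_chart mIt It0).
have I0 t : (0 <= \int[lebesgue_tuple n]_(u in @sphere_chart R n)
    (W (pt t u) * (`|t| ^+ n / h u)%:E))%E.
  by apply: integral_ge0 => u _; exact: (It0 (t, u)).
apply: (@le_lt_trans _ _ (\int[mu]_(t in `]0%R, +oo[) ((`|C|)%:E *
   \int[lebesgue_tuple n]_(u in @sphere_chart R n) (W (pt t u) * (`|t| ^+ n / h u)%:E)))%E).
  apply: le_ge0_integral => t; rewrite /= in_itv/= andbT => t0.
    by rewrite lee_fin mulr_ge0// powR_ge0.
  rewrite tE// /Psi normrM -mulrA EFinM; apply: lee_wpmul2l; first by rewrite lee_fin.
  have mKt : measurable_fun (@sphere_chart R n) (fun u => K (t, u)).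
    by apply: measurable_funTS; exact: (measurableT_comp mK (pair1_measurable t)).
  have T0 : 0 <= t `^ (\sum_i a 0 i) * t ^+ n by rewrite mulr_ge0 ?powR_ge0// exprn_ge0// ltW.
  rewrite mulrC EFinM.
  apply: le_trans (lee_wpmul2l _ (le_abs_Rintegral _ measurable_chart mKt)) _.
    by rewrite lee_fin.
  rewrite -ge0_integralZl//; last first.
    by apply/measurable_EFinP; exact: (measurableT_comp (@normr_measurable _ _) mKt).
  apply: le_ge0_integral => u uc; first by rewrite -EFinM lee_fin mulr_ge0.
  rewrite [K (t, u)](_ : _ = iter_translation g (pt t u) ft xt * pow_weight g (pt 1 u) / h u)//.
  rewrite !normrM (ger0_norm (pow_weight_ge0 _ _)) normfV (gtr0_norm (h_gt0 uc)) (gtr0_norm t0).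
  rewrite /W (pow_weight_pt t0 uc) -EFinM.
  apply: (@le_trans _ _ (`|iter_translation g (pt t u) ft xt|%:E *
     (t `^ (\sum_i a 0 i) * pow_weight g (pt 1 u) * (t ^+ n / h u))%:E))%E.
    rewrite -EFinM lee_fin le_eqVlt; apply/orP; left; apply/eqP.
    move: (`|iter_translation _ _ _ _|) (pow_weight _ _) (h u)^-1 (t `^ _) => p q r s'; ring.
  rewrite -[leRHS]muleA -[X in (_ <= _ * X)%E]EFinM; apply: lee_wpmul2r; last exact: abs_iter_translation_le.
  rewrite lee_fin !mulr_ge0 ?powR_ge0 ?pow_weight_ge0 ?exprn_ge0 ?(ltW t0)// invr_ge0 ltW// h_gt0//.
rewrite ge0_integralZl//; last exact: measurable_funTS.
rewrite lte_mul_pinfty//.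
move: W_fin; rewrite (polar_coordinates mW W0); apply: le_lt_trans.
apply: le_ge0_integral => t; rewrite /= in_itv/= andbT => t0; first exact: I0.
by rewrite (gtr0_norm t0).
Qed.

End spherical_mean_integrable.

(** * Expansions in orthonormal polynomials *)

Section weighted_pairing.
Context {R : realType}.
Local Notation mu := (@lebesgue_measure R).
Variable g : R.
Hypothesis g0 : -1 / 2 < g.

Let mI : measurable (`]0, +oo[%classic : set (measurableTypeR R)).
Proof. exact: measurable_itv. Qed.

(** A class of functions that contains polynomials, bounded functions and
    [expR (4 t x)], is closed under products, and is integrable for the weight. *)
Definition exp_bounded (u : R -> R) := measurable_fun setT u /\
  exists C b : R, [/\ 0 <= C, 0 <= b & forall x, 0 < x -> `|u x| <= C * expR (b * x)].

Lemma exp_bounded_bounded (u : R -> R) (M : R) : measurable_fun setT u ->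
  (forall x, `|u x| <= M) -> exp_bounded u.
Proof.
move=> mu' uM; split => //; exists M, 0; split => //; first exact: le_trans (uM 0).
by move=> x _; rewrite mul0r expR0 mulr1.
Qed.

Lemma exp_boundedD u v : exp_bounded u -> exp_bounded v -> exp_bounded (fun x => u x + v x).
Proof.
move=> [mu' [C [b [C0 b0 uC]]]] [mv [C' [b' [C'0 b'0 vC]]]]; split; first by mfun.
exists (C + C'), (b + b'); split; [exact: addr_ge0|exact: addr_ge0|move=> x x0].
apply: le_trans (ler_normD _ _) _; rewrite mulrDl.
apply: lerD; [apply: le_trans (uC x x0) _|apply: le_trans (vC x x0) _]; apply: ler_wpM2l => //;
  by rewrite ler_expR ler_wpM2r ?(ltW x0)// ?lerDl ?lerDr.
Qed.

Lemma exp_boundedM u v : exp_bounded u -> exp_bounded v -> exp_bounded (fun x => u x * v x).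
Proof.
move=> [mu' [C [b [C0 b0 uC]]]] [mv [C' [b' [C'0 b'0 vC]]]]; split; first by mfun.
exists (C * C'), (b + b'); split; [exact: mulr_ge0|exact: addr_ge0|move=> x x0].
rewrite normrM mulrDl expRD mulrACA.
by apply: ler_pM => //; [exact: uC|exact: vC].
Qed.

Lemma exp_bounded_cst c : exp_bounded (fun=> c).
Proof. exact: (@exp_bounded_bounded _ `|c|). Qed.

Lemma exp_boundedN u : exp_bounded u -> exp_bounded (fun x => - u x).
Proof.
move=> [mu' [C [b [C0 b0 uC]]]]; split; first by mfun.
by exists C, b; split => // x x0; rewrite normrN uC.
Qed.

Lemma exp_bounded_expR b : 0 <= b -> exp_bounded (fun x => expR (b * x)).
Proof.
move=> b0; split; first by mfun.
by exists 1, b; split => // x x0; rewrite mul1r ger0_norm ?expR_ge0.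
Qed.

Lemma exp_bounded_poly (p : {poly R}) : exp_bounded (horner p).
Proof.
elim/poly_ind: p => [|p c IH].
  by rewrite (_ : horner 0 = fun=> 0); [exact: exp_bounded_cst|apply/funext => x; rewrite horner0].
rewrite (_ : horner _ = fun x => p.[x] * x + c); last by apply/funext => x; rewrite hornerMXaddC.
apply: exp_boundedD; last exact: exp_bounded_cst.
apply: exp_boundedM => //; split; first by mfun.
exists 1, 1; split => // x x0; rewrite !mul1r (gtr0_norm x0).
by apply: le_trans (expR_ge1Dx x); rewrite lerDr.
Qed.

Lemma exp_bounded_integrable u : exp_bounded u -> mu.-integrable `]0, +oo[ (fun x => (u x * gauss_weight g x)%:E).
Proof. by move=> [mu' [C [b [_ _ uC]]]]; exact: (integrable_bnd_gauss_weight g0 mu' uC). Qed.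

Definition weight_pairing (u v : R -> R) : R := \int[mu]_(x in `]0, +oo[) (u x * v x * gauss_weight g x).

Lemma weight_pairingC u v : weight_pairing u v = weight_pairing v u.
Proof. by apply: eq_Rintegral => x _; rewrite (mulrC (u x)). Qed.

Lemma weight_pairingDr u v w : exp_bounded u -> exp_bounded v -> exp_bounded w -> weight_pairing u (fun x => v x + w x) = weight_pairing u v + weight_pairing u w.
Proof.
move=> tu tv tw; rewrite /weight_pairing -RintegralD//.
- by apply: eq_Rintegral => x _; rewrite mulrDr mulrDl.
- exact: (exp_bounded_integrable (exp_boundedM tu tv)).
- exact: (exp_bounded_integrable (exp_boundedM tu tw)).
Qed.

Lemma weight_pairingZr u v c : exp_bounded u -> exp_bounded v -> weight_pairing u (fun x => c * v x) = c * weight_pairing u v.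
Proof.
move=> tu tv; rewrite /weight_pairing -RintegralZl//.
- by apply: eq_Rintegral => x _; move: (gauss_weight g x) => W; ring.
- exact: (exp_bounded_integrable (exp_boundedM tu tv)).
Qed.

Lemma weight_pairing_le u v : exp_bounded u -> exp_bounded v -> (forall x, 0 < x -> `|u x| <= v x) -> weight_pairing u u <= weight_pairing v v.
Proof.
move=> tu tv uv; apply: le_Rintegral => //.
- exact: (exp_bounded_integrable (exp_boundedM tu tu)).
- exact: (exp_bounded_integrable (exp_boundedM tv tv)).
move=> x; rewrite /= in_itv/= andbT => x0; apply: ler_wpM2r; first exact: gauss_weight_ge0.
by rewrite -!expr2 -real_normK ?num_real// ler_pXn2r ?nnegrE ?uv// (le_trans _ (uv x x0)).
Qed.

Lemma weight_pairing_ge0 u : 0 <= weight_pairing u u.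
Proof. by apply: Rintegral_ge0 => x _; rewrite mulr_ge0 ?gauss_weight_ge0// -expr2 sqr_ge0. Qed.

(** Cauchy-Schwarz with the arithmetic in place of the geometric mean; this avoids
    square roots and costs only constants. *)
Lemma abs_weight_pairing_le u v : exp_bounded u -> exp_bounded v -> `|weight_pairing u v| <= (weight_pairing u u + weight_pairing v v) / 2.
Proof.
move=> tu tv.
have tm := exp_boundedM (exp_bounded_cst (2 : R)).
have key (s : R) : s ^+ 2 = 1 -> 0 <= weight_pairing u u + weight_pairing v v + 2 * s * weight_pairing u v.
  move=> s1; have ts : exp_bounded (fun x => s * v x) by apply: exp_boundedM => //; exact: exp_bounded_cst.
  have -> : weight_pairing u u + weight_pairing v v + 2 * s * weight_pairing u v =
      weight_pairing (fun x => u x + s * v x) (fun x => u x + s * v x).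
    have tw := exp_boundedD tu ts.
    have wE z : exp_bounded z -> weight_pairing z (fun x => u x + s * v x) = weight_pairing z u + s * weight_pairing z v.
      by move=> tz; rewrite weight_pairingDr// weight_pairingZr.
    rewrite (wE _ tw) (weight_pairingC (fun x => u x + s * v x) u) (weight_pairingC (fun x => u x + s * v x) v).
    rewrite (wE u tu) (wE v tv) (weight_pairingC v u).
    by rewrite mulrDr mulrA -expr2 s1 mul1r; ring.
  exact: weight_pairing_ge0.
have k1 := key 1 (expr1n _ _); have k2 : 0 <= weight_pairing u u + weight_pairing v v + 2 * (-1) * weight_pairing u v.
  by apply: key; rewrite sqrrN expr1n.
by rewrite ler_norml; apply/andP; split; lra.
Qed.

Section projection.
Variables (p : nat -> {poly R}) (op : orthonormal_polynomials g p).

Let P k : R -> R := horner (p k).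

Let P_orth k l : weight_pairing (P k) (P l) = (k == l)%:R.
Proof. by case: op => _ /(_ k l). Qed.

Let tP k : exp_bounded (P k). Proof. exact: exp_bounded_poly. Qed.

(** Induction on [k]: subtract from [q] the multiple of [p k] that kills its
    coefficient of degree [k].  The induction hypothesis, applied to [p k] in place
    of [u], gives the orthogonality of [p k] to polynomials of lower degree. *)
Lemma projection_poly k (q : {poly R}) u : (size q <= k)%N -> exp_bounded u ->
  weight_pairing u (horner q) = \sum_(0 <= j < k) weight_pairing (P j) u * weight_pairing (P j) (horner q).
Proof.
elim: k q u => [|k IH] q u sq tu.
  rewrite big_geq// (_ : horner q = fun x => 0 * 0); last first.
    apply/funext => x; rewrite mul0r; move: sq; rewrite leqn0 size_poly_eq0 => /eqP ->.
    by rewrite horner0.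
  by rewrite (weight_pairingZr _ tu (exp_bounded_cst 0)) mul0r.
case: op => sp _; set b := q`_k / lead_coef (p k).
have lp : lead_coef (p k) != 0 by rewrite lead_coef_eq0 -size_poly_eq0 sp.
set r := q - b *: p k.
have sr : (size r <= k)%N.
  apply/leq_sizeP => j; rewrite leq_eqVlt => /orP[/eqP <-|kj].
    rewrite coefB coefZ /b; have -> : (p k)`_k = lead_coef (p k) by rewrite lead_coefE sp.
    by rewrite divfK// subrr.
  by rewrite coefB coefZ !nth_default ?mulr0 ?subrr// ?sp//; exact: leq_trans sq _.
have tr : exp_bounded (horner r) by exact: exp_bounded_poly.
have qE : horner q = fun x => r.[x] + b * P k x.
  by apply/funext => x; rewrite /r hornerD hornerN hornerZ subrK.
have tb : exp_bounded (fun x => b * P k x) by apply: exp_boundedM => //; exact: exp_bounded_cst.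
have D z : exp_bounded z -> weight_pairing z (horner q) = weight_pairing z (horner r) + b * weight_pairing z (P k).
  by move=> tz; rewrite qE weight_pairingDr// weight_pairingZr.
have rk : weight_pairing (P k) (horner r) = 0.
  rewrite (IH r (P k))//; apply: big1_seq => j /andP[_]; rewrite mem_index_iota => /andP[_ jk].
  by rewrite P_orth (ltn_eqF jk) mul0r.
rewrite D// (IH r u)// big_nat_recr//= D// rk P_orth eqxx mulr1 add0r.
rewrite (weight_pairingC u) (mulrC b); congr (_ + _); apply: eq_big_nat => j /andP[_ jk].
by rewrite D// P_orth (ltn_eqF jk) mulr0 addr0.
Qed.

Lemma abs_coef_le k u : exp_bounded u -> `|weight_pairing (P k) u| <= (1 + weight_pairing u u) / 2.
Proof. by move=> tu; apply: le_trans (abs_weight_pairing_le (tP k) tu) _; rewrite P_orth eqxx. Qed.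

(** The polynomial part of [v] contributes nothing by [projection_poly]; each of the
    [k + 1] remaining terms is at most [eps] times a constant. *)
Lemma parseval_defect k (q : {poly R}) u v E eps : (size q <= k)%N ->
  exp_bounded u -> exp_bounded v -> exp_bounded E -> 0 < eps ->
  (forall x, 0 < x -> `|v x - q.[x]| <= eps * E x) ->
  `|weight_pairing u v - \sum_(0 <= j < k) weight_pairing (P j) u * weight_pairing (P j) v| <=
  eps * (k.+1)%:R * ((1 + weight_pairing u u) * (1 + weight_pairing E E)).
Proof.
move=> sq tu tv tE e0 vq.
have tq := exp_bounded_poly q; pose s x := eps^-1 * (v x - q.[x]).
have ts : exp_bounded s by apply: exp_boundedM; [exact: exp_bounded_cst|apply: exp_boundedD => //; exact: exp_boundedN].
have vE : v = fun x => q.[x] + eps * s x.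
  by apply/funext => x; rewrite /s mulVKf ?gt_eqF// addrC subrK.
have tes : exp_bounded (fun x => eps * s x) by apply: exp_boundedM => //; exact: exp_bounded_cst.
have D z : exp_bounded z -> weight_pairing z v = weight_pairing z (horner q) + eps * weight_pairing z s.
  by move=> tz; rewrite vE weight_pairingDr// weight_pairingZr.
have sE : weight_pairing s s <= weight_pairing E E.
  apply: weight_pairing_le => // x x0; rewrite /s normrM (gtr0_norm _) ?invr_gt0//.
  by rewrite mulrC ler_pdivrMr// mulrC vq.
have -> : weight_pairing u v - \sum_(0 <= j < k) weight_pairing (P j) u * weight_pairing (P j) v =
    eps * (weight_pairing u s - \sum_(0 <= j < k) weight_pairing (P j) u * weight_pairing (P j) s).
  have -> : \sum_(0 <= j < k) weight_pairing (P j) u * weight_pairing (P j) v =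
      \sum_(0 <= j < k) weight_pairing (P j) u * weight_pairing (P j) (horner q) +
      eps * \sum_(0 <= j < k) weight_pairing (P j) u * weight_pairing (P j) s.
    rewrite mulr_sumr -big_split/=; apply: eq_bigr => j _.
    by rewrite D//; ring.
  by rewrite D// (projection_poly sq tu); ring.
rewrite normrM (gtr0_norm e0) -mulrA ler_wpM2l ?(ltW e0)//.
set A := weight_pairing u u; set B := weight_pairing E E in sE *.
have A0 : 0 <= A by exact: weight_pairing_ge0.
have B0 : 0 <= B by exact: weight_pairing_ge0.
apply: le_trans (ler_normB _ _) _.
have h1 : `|weight_pairing u s| <= (A + B) / 2.
  by apply: le_trans (abs_weight_pairing_le tu ts) _; rewrite -/A; lra.
have h2 : `|\sum_(0 <= j < k) weight_pairing (P j) u * weight_pairing (P j) s| <= k%:R * ((1 + A) * (1 + B)).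
  apply: le_trans (ler_norm_sum _ _ _) _.
  apply: (@le_trans _ _ (\sum_(0 <= j < k) (1 + A) * (1 + B))); last first.
    by rewrite sumr_const_nat subn0 mulr_natl.
  apply: ler_sum => j _; rewrite normrM; apply: ler_pM => //.
    by apply: le_trans (abs_coef_le j tu) _; rewrite -/A; lra.
  by apply: le_trans (abs_coef_le j ts) _; lra.
apply: le_trans (lerD h1 h2) _; rewrite -[k.+1%:R]natr1 [leRHS]mulrDl mul1r addrC lerD2l.
have : 0 <= A * B by exact: mulr_ge0.
by move=> h; rewrite mulrDl !mulrDr; lra.
Qed.

End projection.

End weighted_pairing.

(** * The Cesaro error *)

Section bessel_polynomial.
Context {R : realType}.
Variable g : R.
Hypothesis g0 : -1 / 2 < g.

(** The Taylor polynomial with [uphalf k] terms has size at most [k], and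
    [16^-(uphalf k) <= 4^-k]. *)
Lemma bessel_j_poly_approx (t : R) k : 0 <= t -> exists2 q : {poly R}, (size q <= k)%N &
  forall x, 0 < x -> `|bessel_j g (t * x) - q.[x]| <= 4^-1 ^+ k * expR (4 * t * x).
Proof.
move=> t0; pose m := uphalf k.
exists (\sum_(0 <= i < m) bessel_term g t i *: 'X^(2 * i)).
  apply: (leq_trans (size_sum _ _ _)); apply/bigmax_leqP_seq => i.
  rewrite mem_index_iota => /andP[_ im] _.
  apply: (leq_trans (size_scale_leq _ _)); rewrite size_polyXn.
  by move: im; rewrite /m uphalf_half; have := odd_double_half k; lia.
move=> x x0.
have -> : (\sum_(0 <= i < m) bessel_term g t i *: 'X^(2 * i)).[x] = series (bessel_term g (t * x)) m.
  rewrite horner_sum; apply: eq_bigr => i _.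
  by rewrite hornerZ hornerXn /bessel_term (mulrAC t) (exprMn _ (t / 2)); ring.
apply: le_trans (bessel_term_tail g0 (t * x) m) _.
rewrite ger0_norm ?mulr_ge0 ?(ltW x0)// mulrA; apply: ler_wpM2r; first exact: expR_ge0.
have -> : (16^-1 : R) = 4^-1 ^+ 2 by field.
rewrite -exprM; apply: ler_wiXn2l; [by rewrite invr_ge0|by rewrite invf_le1// ler1n|].
by rewrite /m uphalf_half; have := odd_double_half k; lia.
Qed.

End bessel_polynomial.

Section cesaro.
Context {R : realType}.

Lemma sum_half_pow_le1 N : \sum_(0 <= k < N) (2^-1 : R) ^+ k.+1 <= 1.
Proof.
suff -> : \sum_(0 <= k < N) (2^-1 : R) ^+ k.+1 = 1 - 2^-1 ^+ N by rewrite gerBl exprn_ge0// invr_ge0.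
elim: N => [|N IH]; first by rewrite big_geq// expr0 subrr.
by rewrite big_nat_recr//= IH exprS; field.
Qed.

(** The errors of the partial sums are summable, so their mean is O(1/N). *)
Lemma cesaro_mean_bound (s : R^nat) (L B : R) (N : nat) : 0 <= B -> (0 < N)%N ->
  (forall k, `|L - \sum_(0 <= j < k) s j| <= B * 2^-1 ^+ k) ->
  `|L - cesaro_mean s N| <= B * N%:R^-1.
Proof.
move=> B0 N0 H; have NR : N%:R != 0 :> R by rewrite pnatr_eq0 -lt0n.
have -> : L - cesaro_mean s N = N%:R^-1 * \sum_(0 <= k < N) (L - \sum_(0 <= j < k.+1) s j).
  rewrite /cesaro_mean sumrB mulrBr sumr_const_nat subn0 -[L *+ N]mulr_natl mulKf//.
rewrite normrM ger0_norm ?invr_ge0// mulrC; apply: ler_wpM2r; first by rewrite invr_ge0.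
apply: le_trans (ler_norm_sum _ _ _) _.
apply: (@le_trans _ _ (\sum_(0 <= k < N) B * 2^-1 ^+ k.+1)); first by apply: ler_sum => k _; exact: H.
by rewrite -mulr_sumr -[leRHS]mulr1 ler_wpM2l// sum_half_pow_le1.
Qed.

Lemma four_pow_le k : (4^-1 : R) ^+ k * k.+1%:R <= 2^-1 ^+ k.
Proof.
have -> : (4^-1 : R) = 2^-1 * 2^-1 by field.
rewrite exprMn -mulrA -[leRHS]mulr1 ler_wpM2l ?exprn_ge0 ?invr_ge0//.
rewrite exprVn mulrC ler_pdivrMr ?exprn_gt0// mul1r -natrX ler_nat.
exact: ltn_expl.
Qed.

End cesaro.

Section hankel_transform.
Context {R : realType}.
Local Notation mu := (@lebesgue_measure R).
Variable g : R.
Hypothesis g0 : -1 / 2 < g.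

Let mI : measurable (`]0, +oo[%classic : set (measurableTypeR R)).
Proof. exact: measurable_itv. Qed.

(** The transform of an integrable function is bounded, as [bessel_j] is. *)
Lemma exp_bounded_hankel (F : R -> R) : measurable_fun setT F ->
  (\int[mu]_(s in `]0%R, +oo[) (`|F s| * s `^ (2 * g + 1))%:E < +oo)%E ->
  exp_bounded (hankel g F).
Proof.
move=> mF iF; have mj := @measurable_bessel_j R g g0.
set M := (X in (X < _)%E) in iF.
have M0 : (0 <= M)%E by apply: integral_ge0 => s _; rewrite lee_fin mulr_ge0// powR_ge0.
have mf : measurable_fun setT (fun z : R * R => F z.2 * bessel_j g (z.2 * z.1) * z.2 `^ (2 * g + 1)).
  apply: measurable_funM; last by mfun.
  apply: measurable_funM; first exact: measurableT_comp.
  by apply: (measurableT_comp mj); mfun.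
apply: (@exp_bounded_bounded _ _ (fine M)).
  exact: (@measurable_Rintegral _ _ _ _ _ mu _ mI _ mf).
move=> tau; rewrite -lee_fin fineK ?ge0_fin_numE//.
have mft : measurable_fun setT (fun s : R => F s * bessel_j g (s * tau) * s `^ (2 * g + 1)).
  exact: (measurableT_comp mf (pair1_measurable tau)).
apply: le_trans (le_abs_Rintegral mu mI (measurable_funTS mft)) _.
apply: le_ge0_integral => s _; first by rewrite lee_fin.
rewrite lee_fin !normrM (ger0_norm (powR_ge0 _ _)); apply: ler_wpM2r; first exact: powR_ge0.
by rewrite -[leRHS]mulr1; apply: ler_wpM2l => //; exact: bessel_j_le1.
Qed.

(** The main estimate, for an arbitrary integrable profile in place of the spherical
    mean.  The constant may depend on [t]. *)
Lemma chromatic_cesaro_bound (F : R -> R) (p : nat -> {poly R}) (t : R) :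
  measurable_fun setT F ->
  (\int[mu]_(s in `]0%R, +oo[) (`|F s| * s `^ (2 * g + 1))%:E < +oo)%E ->
  orthonormal_polynomials g p -> 0 <= t ->
  exists2 B, 0 <= B & forall N, (0 < N)%N ->
    `|bessel_convolution g F (fun s => expR (- (s ^+ 2 / 4))) t
      - cesaro_mean (SCE g p F t) N| <= B * N%:R^-1.
Proof.
move=> mF iF op t0.
set u := hankel g F; have tu : exp_bounded u by exact: exp_bounded_hankel.
pose v (x : R) := bessel_j g (t * x).
have tv : exp_bounded v.
  apply: (@exp_bounded_bounded _ _ 1) => [|x]; last exact: bessel_j_le1.
  by apply: (measurableT_comp (@measurable_bessel_j R g g0)); mfun.
pose E (x : R) := expR (4 * t * x).
have tE : exp_bounded E by apply: exp_bounded_expR; rewrite mulr_ge0.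
set c : R := 2 / Gamma (g + 1).
have c0 : 0 < c by rewrite divr_gt0// Gamma_gt0//; have := g0; lra.
pose B := c * ((1 + weight_pairing g u u) * (1 + weight_pairing g E E)).
have B0 : 0 <= B.
  by rewrite mulr_ge0 ?(ltW c0)// mulr_ge0// addr_ge0// weight_pairing_ge0.
exists B => // N N0; apply: cesaro_mean_bound => // k.
rewrite (convolution_gauss g0 t0 mF iF) -/c.
have -> : \sum_(0 <= j < k) SCE g p F t j =
    c * \sum_(0 <= j < k) weight_pairing g (horner (p j)) u * weight_pairing g (horner (p j)) v.
  rewrite mulr_sumr; apply: eq_bigr => j _.
  rewrite /SCE /chromatic_coef /chromatic_fun -/c [RHS]mulrCA; congr (_ * (_ * _)).
    by apply: eq_Rintegral => x _; rewrite /gauss_weight [RHS]mulrA.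
  apply: eq_Rintegral => x _; rewrite /gauss_weight /v.
  by move: (p j).[x] (expR _) (bessel_j _ _) (x `^ _) => a1 a2 a3 a4; ring.
rewrite -[X in c * X - _]/(weight_pairing g u v) -mulrBr normrM (gtr0_norm c0) /B.
rewrite -mulrA; apply: ler_wpM2l; first exact: ltW.
have [q sq qv] := @bessel_j_poly_approx R g g0 t k t0.
have e0 : 0 < (4^-1 : R) ^+ k by rewrite exprn_gt0// invr_gt0.
apply: le_trans (parseval_defect g0 op sq tu tv tE e0 qv) _.
rewrite [leRHS]mulrC; apply: ler_wpM2r; last exact: four_pow_le.
by rewrite mulr_ge0// addr_ge0// weight_pairing_ge0.
Qed.

End hankel_transform.

Theorem theorem1 (R : realType) (n : nat) (a : 'rV[R]_n.+1)
    (f : 'rV[R]_n.+1 -> R) (x : 'rV[R]_n.+1) (p : nat -> {poly R}) :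
  let gam := mean_order a in
  let Phi := spherical_mean a f x in
  let hatPhi := hankel gam Phi in
  (forall i, 0 < a 0 i) ->
  L1_weighted a f ->
  {within @orthant R n.+1, continuous f} ->
  locally_BV f ->
  orthant x ->
  orthonormal_polynomials gam p ->
  {ae @lebesgue_measure R, forall tau, 0 < tau -> derivable hatPhi tau 1} ->
  (Linf_norm (fun tau : R =>
     hatPhi^`()%classic tau * tau `^ (gam + 1) * expR (- (tau ^+ 2 / 2)))%R
   < +oo)%E ->
  forall t : R, 0 <= t ->
  (fun N : nat =>
     `|bessel_convolution gam Phi (fun s => expR (- (s ^+ 2 / 4))) t
       - cesaro_mean (SCE gam p Phi t) N|)
  =O_\oo (fun N : nat => N%:R `^ (- (7 / 32))).
Proof.
move=> gam Phi hatPhi a0 fL1 _ _ x0 op _ _ t t0.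
have g0 : -1 / 2 < gam.
  have : 0 < \sum_i a 0 i.
    rewrite big_ord_recl ltr_pwDl//; apply: sumr_ge0 => i _; exact: ltW.
  rewrite /gam /mean_order -[n.+1%:R]natr1; have := ler0n R n.
  by move: (\sum_i _) (n%:R) => S m m0 S0; lra.
have [Psi [mPsi PhiE iPsi]] := spherical_mean_integrable a0 fL1 x0.
have hankelE : hankel gam Phi = hankel gam Psi.
  apply/funext => tau; apply: eq_Rintegral => s; rewrite inE/= in_itv/= andbT => s0.
  by rewrite /Phi PhiE.
have convE G : bessel_convolution gam Phi G t = bessel_convolution gam Psi G t.
  apply: eq_Rintegral => s; rewrite inE/= in_itv/= andbT => s0; congr (_ * _ * _).
  rewrite /translation1; congr (_ * _); rewrite !Rintegral_0pi_open.
  apply: eq_Rintegral => th; rewrite inE/= in_itv/= => th0; congr (_ * _).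
  apply: PhiE; rewrite sqrtr_gt0; move: t0; rewrite le_eqVlt => /orP[/eqP <-|t1].
    by rewrite mulr0 mul0r expr0n/= addr0 subr0 exprn_gt0.
  exact: cos_law_gt0.
have SCEE : SCE gam p Phi t = SCE gam p Psi t.
  by apply/funext => k; rewrite /SCE /chromatic_coef hankelE.
have [B B0 HB] := chromatic_cesaro_bound g0 mPsi iPsi op t0.
apply/eqO_exP; exists (B + 1); first by rewrite ltr_wpDl.
near=> N.
have N0 : (0 < N)%N by near: N; exact: nbhs_infty_gt.
rewrite normr_id convE SCEE; apply: le_trans (HB N N0) _.
rewrite (ger0_norm (powR_ge0 _ _)).
have NV : N%:R^-1 <= N%:R `^ (- (7 / 32)) :> R.
  rewrite -(powR_inv1 (ler0n R N)); apply: ler_powR; [by rewrite ler1n|lra].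
apply: (ler_pM B0 _ _ NV); first by rewrite invr_ge0.
by rewrite lerDl.
Unshelve. all: by end_near.
Qed.
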